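(* Let $\nu>0$ and $\alpha\in\mathbb{R}$. (1) The eigenspace $\mathcal{E}^{\alpha,\nu}_{\lambda}(\mathbb{C})$ is non-trivial if and only if $\lambda=m$ for some $m\in\{0,1,2,\dots\}$; each of the corresponding eigenvalues occurs with infinite multiplicity (that is, $\mathcal{E}^{\alpha,\nu}_{m}(\mathbb{C})$ is infinite dimensional), and $\mathcal{E}^{\alpha,\nu}_{0}(\mathbb{C})=\mathcal{F}^{2,\nu}_{\alpha}(\mathbb{C})$. (2) The Hilbertian orthogonal decomposition $$\mathcal{L}^{2,\nu}_{\alpha}(\mathbb{C})=\bigoplus_{m=0}^{+\infty}\mathcal{E}^{\alpha,\nu}_{m}(\mathbb{C})=\mathcal{F}^{2,\nu}_{\alpha}(\mathbb{C})\oplus\left(\bigoplus_{m=1}^{+\infty}\mathcal{E}^{\alpha,\nu}_{m}(\mathbb{C})\right)$$ holds. (3) For every fixed $m\in\{1,2,\dots\}$, the operator $(\nu^m m!)^{-1/2}[iA^*]^m$ maps isometrically the orthonormal basis $(\psi_n^{\alpha,\nu})_{n\in\mathbb{Z}}$ of $\mathcal{F}^{2,\nu}_{\alpha}(\mathbb{C})$ to an orthonormal basis of $\mathcal{E}^{\alpha,\nu}_{m}(\mathbb{C})$; more precisely, for every $n\in\mathbb{Z}$, $$\big[(\nu^m m!)^{-1/2}[iA^*]^m\psi_n^{\alpha,\nu}\big](z)=\psi_{m,n}^{\alpha,\nu}(z,\overline{z}),\qquad z\in\mathbb{C}.$$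
   Context: Write $z=x+iy$, $d\lambda(z)=dx\,dy$, $S=[0,1]\times\mathbb{R}=\{x+iy:0\le x\le1,\ y\in\mathbb{R}\}$. The space $\mathcal{L}^{2,\nu}_{\alpha}(\mathbb{C})$ consists of the (classes modulo almost everywhere equality of) measurable functions $f:\mathbb{C}\to\mathbb{C}$ satisfying $$f(z+m)=e^{2i\pi\alpha m}e^{\nu(z+\frac m2)m}f(z)\qquad\text{for almost every }z\in\mathbb{C}\text{ and all }m\in\mathbb{Z},\qquad( * )$$ and $\|f\|_\nu^2=\int_S|f(z)|^2e^{-\nu|z|^2}d\lambda(z)<+\infty$, with inner product $\langle f_1,f_2\rangle_\nu=\int_S f_1\overline{f_2}e^{-\nu|z|^2}d\lambda$. The space $\mathcal{F}^{2,\nu}_{\alpha}(\mathbb{C})$ consists of the entire functions satisfying $( * )$ everywhere and with $\|f\|_\nu<+\infty$. Let $A=\partial/\partial\overline{z}$, $A^*=-\partial/\partial z+\nu\overline{z}$ and let $$\Delta_\nu=A^*A=-\frac{\partial^2}{\partial z\,\partial\overline{z}}+\nu\overline{z}\frac{\partial}{\partial\overline{z}}$$ be the Landau operator. For a complex number $\lambda$, let $\mathcal{E}^{\alpha,\nu}_{\lambda}(\mathbb{C})$ be the space of functions $f\in\mathcal{L}^{2,\nu}_{\alpha}(\mathbb{C})$ with $\Delta_\nu f=\nu\lambda f$; equivalently (by ellipticity of $\Delta_\nu$), the space of $C^\infty$ functions $f:\mathbb{C}\to\mathbb{C}$ satisfying $( * )$, $\Delta_\nu f=\nu\lambda f$ and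 $\|f\|_\nu<+\infty$. For $n\in\mathbb{Z}$, $$\psi_n^{\alpha,\nu}(z)=\left(\frac{2\nu}{\pi}\right)^{1/4}e^{\frac{\nu}{2}z^2}e^{-\frac{\pi^2}{\nu}(n+\alpha)^2+2i\pi(\alpha+n)z},$$ and for $m\in\{0,1,2,\dots\}$, $n\in\mathbb{Z}$, $$\psi_{m,n}^{\alpha,\nu}(z,\overline{z})=(2^m m!)^{-1/2}\,\psi_n^{\alpha,\nu}(z)\,H_m\!\left(\sqrt{2\nu}\,y+\sqrt{\tfrac{2}{\nu}}\,\pi(n+\alpha)\right),$$ where $H_m(\xi)=(-1)^m e^{\xi^2}\frac{d^m}{d\xi^m}e^{-\xi^2}$ is the $m$-th Hermite polynomial. *)

(* Defs.v *)
From mathcomp Require Import all_boot all_order all_algebra.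
From mathcomp Require Import complex.
From mathcomp Require Import all_classical all_reals all_analysis.

Set Implicit Arguments.
Unset Strict Implicit.
Unset Printing Implicit Defensive.

Import Order.TTheory GRing.Theory Num.Theory.
Import numFieldNormedType.Exports.

Local Open Scope classical_set_scope.
Local Open Scope complex_scope.
Local Open Scope ring_scope.

Section ComplexPlane.
Variable R : realType.
Implicit Types (f g : R[i] -> R[i]) (u : R * R -> R) (z : R[i]).

(* Measure theory and real differentiation on the complex plane go through
   the identification of x + iy with the pair (x, y). *)
Definition toC (p : R * R) : R[i] := p.1 +i* p.2.
Definition ofC z : R * R := (complex.Re z, complex.Im z).
Definition rpart f : R * R -> R := fun p => complex.Re (f (toC p)).
Definition ipart f : R * R -> R := fun p => complex.Im (f (toC p)).

Definition cexp z : R[i] :=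
  (expR (complex.Re z))%:C * (cos (complex.Im z) +i* sin (complex.Im z)).

Definition dirx : R * R := (1, 0).
Definition diry : R * R := (0, 1).

Definition partialx f z : R[i] :=
  'D_dirx (rpart f) (ofC z) +i* 'D_dirx (ipart f) (ofC z).
Definition partialy f z : R[i] :=
  'D_diry (rpart f) (ofC z) +i* 'D_diry (ipart f) (ofC z).

Definition d_dz f z : R[i] := (partialx f z - 'i%C * partialy f z) / 2.
Definition d_dzbar f z : R[i] := (partialx f z + 'i%C * partialy f z) / 2.

Fixpoint Ck (k : nat) u : Prop :=
  if k is k'.+1 then
    [/\ forall p, derivable u p dirx, forall p, derivable u p diry,
        Ck k' (fun p => 'D_dirx u p) & Ck k' (fun p => 'D_diry u p)]
  else continuous u.

Definition smooth f : Prop := forall k, Ck k (rpart f) /\ Ck k (ipart f).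

(* R[i]^o is R[i] as a normed module over itself: the increment ranges over
   the complex numbers, so this is complex differentiability. *)
Definition entire f : Prop :=
  forall z, derivable (f : R[i]^o -> R[i]^o) z 1.

Definition lebesgue2 := (@lebesgue_measure R \x @lebesgue_measure R)%E.

Definition ae_eq_plane f g : Prop :=
  {ae lebesgue2, forall p, f (toC p) = g (toC p)}.

Definition measurable_plane f : Prop :=
  measurable_fun setT (rpart f) /\ measurable_fun setT (ipart f).

Definition strip : set (R * R) := `[0, 1]%classic `*` setT.

(* the automorphy equation at the point z, for all integers m *)
Definition quasi_periodic_at (alpha nu : R) f z : Prop :=
  forall m : int,
    f (z + m%:~R) = cexp (2 * 'i%C * (pi * alpha)%:C * m%:~R)
                  * cexp (nu%:C * (z + m%:~R / 2) * m%:~R) * f z.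

(* the square of the norm, as an extended real *)
Definition norm2 (nu : R) f : \bar R :=
  (\int[lebesgue2]_(p in strip)
     (Normc.normc (f (toC p)) ^+ 2 * expR (- (nu * Normc.normc (toC p) ^+ 2)))%:E)%E.

Definition inner (nu : R) f g : R[i] :=
  let h z := f z * (g z)^*%C * (expR (- (nu * Normc.normc z ^+ 2)))%:C in
  (\int[lebesgue2]_(p in strip) rpart h p) +i*
  (\int[lebesgue2]_(p in strip) ipart h p).

(* Elements are representatives of the classes modulo a.e. equality. *)
Definition L2space (alpha nu : R) : set (R[i] -> R[i]) :=
  [set f | [/\ measurable_plane f,
     {ae lebesgue2, forall p, quasi_periodic_at alpha nu f (toC p)} &
     (norm2 nu f < +oo)%E]].

Definition Fspace (alpha nu : R) : set (R[i] -> R[i]) :=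
  [set f | [/\ entire f, forall z, quasi_periodic_at alpha nu f z &
     (norm2 nu f < +oo)%E]].

Definition opA f : R[i] -> R[i] := d_dzbar f.
Definition opAstar (nu : R) f : R[i] -> R[i] :=
  fun z => - d_dz f z + nu%:C * z^*%C * f z.
Definition landau (nu : R) f : R[i] -> R[i] := opAstar nu (opA f).

Definition Espace (alpha nu : R) (lam : R[i]) : set (R[i] -> R[i]) :=
  [set f | [/\ smooth f, forall z, quasi_periodic_at alpha nu f z,
     forall z, landau nu f z = nu%:C * lam * f z &
     (norm2 nu f < +oo)%E]].

Definition nontrivial_space (V : set (R[i] -> R[i])) : Prop :=
  exists2 f, V f & exists z, f z != 0.

Definition infinite_dimensional (V : set (R[i] -> R[i])) : Prop :=
  forall k : nat, exists e : 'I_k -> R[i] -> R[i],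
    (forall i, V (e i)) /\
    (forall c : 'I_k -> R[i],
       (forall z, \sum_(i < k) c i * e i z = 0) -> forall i, c i = 0).

(* The image of V in the quotient modulo a.e. equality is a closed linear
   subspace of L2space. *)
Definition closed_subspace (alpha nu : R) (V : set (R[i] -> R[i])) : Prop :=
  [/\ V `<=` L2space alpha nu,
      V (fun=> 0),
      forall (a : R[i]) f g, V f -> V g -> V (fun z => a * f z + g z) &
      forall f, L2space alpha nu f ->
        (forall eps : R, 0 < eps ->
           exists2 g, V g & (norm2 nu (fun z => f z - g z)%R < eps%:E)%E) ->
        exists2 g, V g & ae_eq_plane f g].

Definition orthogonal_spaces (nu : R) (U V : set (R[i] -> R[i])) : Prop :=
  forall f g, U f -> V g -> inner nu f g = 0.

(* the sums in L2space of the norm-convergent series of elements of the V m *)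
Definition hilbert_sum (alpha nu : R) (V : nat -> set (R[i] -> R[i])) :
    set (R[i] -> R[i]) :=
  [set f | L2space alpha nu f /\
     exists2 g : nat -> R[i] -> R[i], forall m, V m (g m) &
       (fun N => norm2 nu (fun z => f z - \sum_(m < N) g m z)%R) @ \oo
         --> 0%E].

(* L is the Hilbertian orthogonal direct sum of the closed subspaces V m. *)
Definition hilbert_decomposition (alpha nu : R) (L : set (R[i] -> R[i]))
    (V : nat -> set (R[i] -> R[i])) : Prop :=
  [/\ forall m, closed_subspace alpha nu (V m),
      forall m k, m != k -> orthogonal_spaces nu (V m) (V k) &
      L = hilbert_sum alpha nu V].

Definition orthogonal_decomposition2 (alpha nu : R)
    (L U W : set (R[i] -> R[i])) : Prop :=
  [/\ closed_subspace alpha nu U, closed_subspace alpha nu W,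
      orthogonal_spaces nu U W &
      L = [set f | exists g h, [/\ U g, W h & forall z, f z = g z + h z]]].

(* an orthonormal family of elements of V whose linear span is dense in V *)
Definition orthonormal_basis (nu : R) (V : set (R[i] -> R[i]))
    (e : int -> R[i] -> R[i]) : Prop :=
  [/\ forall n, V (e n),
      forall n k, inner nu (e n) (e k) = (n == k)%:R &
      forall f, V f -> forall eps : R, 0 < eps ->
        exists (s : seq int) (c : int -> R[i]),
          (norm2 nu (fun z => f z - \sum_(n <- s) c n * e n z)%R < eps%:E)%E].

Definition psi (alpha nu : R) (n : int) : R[i] -> R[i] := fun z =>
  ((2 * nu / pi) `^ (1 / 4))%:C * cexp ((nu / 2)%:C * z ^+ 2)
  * cexp ((- (pi ^+ 2 / nu) * (n%:~R + alpha) ^+ 2)%:C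
          + 2 * 'i%C * (pi * (alpha + n%:~R))%:C * z).

Definition hermite (m : nat) (xi : R) : R :=
  (-1) ^+ m * expR (xi ^+ 2) * derive1n m (fun t : R => expR (- t ^+ 2)) xi.

Definition psi2 (alpha nu : R) (m : nat) (n : int) : R[i] -> R[i] := fun z =>
  ((Num.sqrt (2 ^+ m * (m`!)%:R))^-1)%:C * psi alpha nu n z
  * (hermite m (Num.sqrt (2 * nu) * complex.Im z
                + Num.sqrt (2 / nu) * pi * (n%:~R + alpha)))%:C.

(* (nu^m m!)^(-1/2) [i A^*]^m *)
Definition opT (nu : R) (m : nat) f : R[i] -> R[i] := fun z =>
  ((Num.sqrt (nu ^+ m * (m`!)%:R))^-1)%:C
  * iter m (fun g w => 'i%C * opAstar nu g w) f z.

End ComplexPlane.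

(* Main.v *)
Require Import Defs.
From mathcomp Require Import all_boot all_order all_algebra.
From mathcomp Require Import complex.
From mathcomp Require Import all_classical all_reals all_analysis.
From mathcomp Require Import measurable_realfun.
From mathcomp Require Import ring lra.

Import Order.TTheory GRing.Theory Num.Theory.
Import numFieldNormedType.Exports.

Local Open Scope classical_set_scope.
Local Open Scope complex_scope.
Local Open Scope ring_scope.

Set Implicit Arguments.
Unset Strict Implicit.
Unset Printing Implicit Defensive.

(** The whole spectral decomposition is read off one orthonormal family. Fix the
    frequencies kappa = n + alpha, n an integer, enumerated by natural numbers j;
    the functions [psi2] of the statement, written [e m j] below, are a Gaussian
    times an exponential of frequency kappa times a Hermite polynomial of degree m
    in an affine function of the ordinate. The operators A and A* act on them as
    annihilation and creation operators of the harmonic oscillator ([opA_lad],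
    [opAstar_lad]), so that they are eigenfunctions of the Landau operator for the
    eigenvalue nu m, and [opT] maps the level 0 to the level m ([opT_synth]).

    Orthonormality ([e_orthonormal]) comes from integration by parts on growing
    rectangles of the strip, whose vertical sides cancel by quasi-periodicity. The
    same computation with a cutoff, applied to an arbitrary square integrable
    eigenfunction f and to [e m j], moves both operators to the second factor and
    shows that f is orthogonal to all levels but its own ([eigen_orthogonal]).

    Completeness ([span_closure_dense]) is proved by hand. The Hermite recurrence
    makes the span invariant under multiplication by the ordinate y, and Euler's
    limit then puts in its closure the products of [e 0 0] with all characters
    exp (2 i pi n x + i t y). Bounded functions which multiply the closure into
    itself, in the sense of [multiplier], form an algebra closed under bounded
    pointwise limits; it contains the characters, hence, by approximation of the
    sign function by polynomials, the indicators of half-planes, of Borel sets,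
    and all bounded measurable functions. Dividing by [e 0 0], which vanishes
    nowhere, and truncating gives density.

    Consequently every f is the sum of its components ([expansion]), the component
    of level m being the series with coefficients <f, e m j>. This series converges
    pointwise together with all its derivatives ([synth_smooth]), and in norm by
    Fatou's lemma ([synth_approx]), so that it is a smooth eigenfunction. A
    continuous quasi-periodic function with a single nonzero component is equal
    to it everywhere ([synth_eq]). This describes all the eigenspaces, and closed
    subspaces and Hilbert sums become conditions on the coefficients.

    For the lowest level it remains to see that entire functions have no component
    of index m > 0 ([entire_coef]). As entire means complex differentiable at each
    point, Goursat's theorem ([goursat]) is needed: divided by the exponential of
    the right frequency, such a function is periodic and its means over horizontal
    periods are constant, so that its coefficients are multiples of those of
    [e 0 j]. Conversely the series of level 0 is a Gaussian times a theta series,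
    which can be differentiated termwise ([cdiff_theta]). *)

(** * The complex exponential and the squared modulus *)

Section ComplexBasics.
Context {R : realType}.
Implicit Types (x y z w : R[i]) (a b : R).

Lemma ReD x y : complex.Re (x + y) = complex.Re x + complex.Re y.
Proof. by case: x y => [? ?] []. Qed.
Lemma ImD x y : complex.Im (x + y) = complex.Im x + complex.Im y.
Proof. by case: x y => [? ?] []. Qed.
Lemma ReN x : complex.Re (- x) = - complex.Re x.
Proof. by case: x. Qed.
Lemma ImN x : complex.Im (- x) = - complex.Im x.
Proof. by case: x. Qed.
Lemma ReM x y :
  complex.Re (x * y) = complex.Re x * complex.Re y - complex.Im x * complex.Im y.
Proof. by case: x y => [? ?] []. Qed.
Lemma ImM x y :
  complex.Im (x * y) = complex.Re x * complex.Im y + complex.Im x * complex.Re y.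
Proof. by case: x y => [? ?] []. Qed.
Lemma ReJ x : complex.Re x^*%C = complex.Re x.
Proof. by case: x. Qed.
Lemma ImJ x : complex.Im x^*%C = - complex.Im x.
Proof. by case: x. Qed.
Lemma ReC a : complex.Re (a%:C) = a. Proof. by []. Qed.
Lemma ImC a : complex.Im (a%:C) = 0. Proof. by []. Qed.
Lemma Re_i : complex.Re ('i%C : R[i]) = 0. Proof. by []. Qed.
Lemma Im_i : complex.Im ('i%C : R[i]) = 1. Proof. by []. Qed.
Lemma Re_nat (n : nat) : complex.Re (n%:R : R[i]) = n%:R.
Proof. by rewrite -(rmorph_nat (real_complex R)). Qed.
Lemma Im_nat (n : nat) : complex.Im (n%:R : R[i]) = 0.
Proof. by rewrite -(rmorph_nat (real_complex R)). Qed.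
Lemma Re_int (n : int) : complex.Re (n%:~R : R[i]) = n%:~R.
Proof. by rewrite -(rmorph_int (real_complex R)). Qed.
Lemma Im_int (n : int) : complex.Im (n%:~R : R[i]) = 0.
Proof. by rewrite -(rmorph_int (real_complex R)). Qed.

Definition ReIm := (ReD, ImD, ReN, ImN, ReM, ImM, ReJ, ImJ, ReC, ImC, Re_i, Im_i,
  Re_nat, Im_nat, Re_int, Im_int).

Lemma complex_ext x y :
  complex.Re x = complex.Re y -> complex.Im x = complex.Im y -> x = y.
Proof. by case: x y => [? ?] [? ?] /= -> ->. Qed.

Lemma Re_sum (I : Type) (s : seq I) (P : pred I) (F : I -> R[i]) :
  complex.Re (\sum_(i <- s | P i) F i) = \sum_(i <- s | P i) complex.Re (F i).
Proof. by elim/big_ind2 : _ => // x a y b <- <-; rewrite ReD. Qed.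
Lemma Im_sum (I : Type) (s : seq I) (P : pred I) (F : I -> R[i]) :
  complex.Im (\sum_(i <- s | P i) F i) = \sum_(i <- s | P i) complex.Im (F i).
Proof. by elim/big_ind2 : _ => // x a y b <- <-; rewrite ImD. Qed.

Lemma toCK p : ofC (toC p) = p :> R * R. Proof. by case: p. Qed.
Lemma ofCK z : toC (ofC z) = z. Proof. by case: z. Qed.

(** The squared modulus, as a real number. *)
Definition sqc z : R := complex.Re z ^+ 2 + complex.Im z ^+ 2.

Lemma sqc_ge0 z : 0 <= sqc z.
Proof. by rewrite addr_ge0// sqr_ge0. Qed.
Lemma normc_sqr z : Normc.normc z ^+ 2 = sqc z.
Proof. by case: z => a b; rewrite /= sqr_sqrtr// addr_ge0// sqr_ge0. Qed.
Lemma sqcM x y : sqc (x * y) = sqc x * sqc y.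
Proof. by rewrite /sqc !ReIm; ring. Qed.
Lemma sqcC a : sqc (a%:C) = a ^+ 2.
Proof. by rewrite /sqc /= expr0n addr0. Qed.
Lemma sqcN x : sqc (- x) = sqc x.
Proof. by rewrite /sqc !ReIm !sqrrN. Qed.
Lemma sqc0 : sqc 0 = 0. Proof. by rewrite /sqc /= expr0n addr0. Qed.
Lemma sqc_eq0 x : (sqc x == 0) = (x == 0).
Proof.
rewrite /sqc paddr_eq0 ?sqr_ge0// !sqrf_eq0.
by apply/andP/eqP => [[/eqP ? /eqP ?]|->//]; apply: complex_ext.
Qed.
Lemma sqc_gt0 x : (0 < sqc x) = (x != 0).
Proof. by rewrite lt_def sqc_ge0 andbT sqc_eq0. Qed.
Lemma sqcD_le x y : sqc (x + y) <= 2 * sqc x + 2 * sqc y.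
Proof.
rewrite /sqc !ReIm.
have := sqr_ge0 (complex.Re x - complex.Re y).
have := sqr_ge0 (complex.Im x - complex.Im y).
rewrite !sqrrB !sqrrD; lra.
Qed.
Lemma mulcJ x : x * x^*%C = (sqc x)%:C.
Proof. by apply: complex_ext; rewrite !ReIm /sqc; ring. Qed.

Lemma sqc_cexp z : sqc (cexp z) = expR (2 * complex.Re z).
Proof.
by rewrite sqcM sqcC /sqc /= cos2Dsin2 mulr1 -expRM_natl.
Qed.
Lemma cexpD x y : cexp (x + y) = cexp x * cexp y.
Proof.
apply: complex_ext; rewrite /cexp !ReIm /= expRD cosD sinD; ring.
Qed.
Lemma cexp0 : cexp (0 : R[i]) = 1.
Proof. by apply: complex_ext; rewrite /cexp !ReIm /= expR0 cos0 sin0; ring. Qed.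
Lemma cexp_neq0 z : cexp z != 0.
Proof. by rewrite -sqc_eq0 sqc_cexp gt_eqF// expR_gt0. Qed.
Lemma cexpN z : cexp (- z) = (cexp z)^-1.
Proof.
by apply: (mulfI (cexp_neq0 z)); rewrite -cexpD subrr cexp0 mulfV// cexp_neq0.
Qed.
Lemma cexpC a : cexp (a%:C) = (expR a)%:C.
Proof. by rewrite /cexp /= cos0 sin0; apply: complex_ext; rewrite !ReIm/=; ring. Qed.

End ComplexBasics.

(** * Square integrable functions on the strip *)

Section WeightedL2.
Context {R : realType}.
Variable nu : R.
Local Notation mu2 := (@lebesgue2 R).
Local Notation S := (@strip R).
Implicit Types (f g h k : R[i] -> R[i]) (u v : R * R -> R) (a : R[i]).

(** The Gaussian weight, and the weighted squared modulus integrated by the norm. *)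
Definition wt (p : R * R) : R := expR (- (nu * sqc (toC p))).

Definition sqw f (p : R * R) : R := sqc (f (toC p)) * wt p.

Lemma wt_ge0 p : 0 <= wt p. Proof. exact: expR_ge0. Qed.
Lemma sqw_ge0 f p : 0 <= sqw f p.
Proof. by rewrite mulr_ge0// ?sqc_ge0 ?wt_ge0. Qed.

Lemma norm2E f : norm2 nu f = (\int[mu2]_(p in S) (sqw f p)%:E)%E.
Proof.
by apply: eq_integral => p _; rewrite /sqw /wt !normc_sqr.
Qed.

Lemma measurable_strip :
  measurable (S : set (measurableTypeR R * measurableTypeR R)).
Proof. by apply: measurableX => //; exact: measurable_itv. Qed.
Hint Resolve measurable_strip : core.

Lemma measurable_wt : measurable_fun setT wt.
Proof.
apply: measurableT_comp => //.
apply: measurableT_comp => //.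
apply: measurable_funM => //; apply: measurable_funD; apply: measurable_funX => /=.
  exact: measurable_fst.
exact: measurable_snd.
Qed.

Lemma measurable_plane_cst a : measurable_plane (fun=> a).
Proof. by split; exact: measurable_cst. Qed.

Lemma measurable_planeD f g : measurable_plane f -> measurable_plane g ->
  measurable_plane (fun z => f z + g z).
Proof.
move=> [f1 f2] [g1 g2]; split.
  by under [rpart _]funext => p do rewrite /rpart ReD; apply: measurable_funD.
by under [ipart _]funext => p do rewrite /ipart ImD; apply: measurable_funD.
Qed.

Lemma measurable_planeM f g : measurable_plane f -> measurable_plane g ->
  measurable_plane (fun z => f z * g z).
Proof.
move=> [f1 f2] [g1 g2]; split.
  under [rpart _]funext => p do rewrite /rpart ReM.
  by apply: measurable_funB; apply: measurable_funM.
under [ipart _]funext => p do rewrite /ipart ImM.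
by apply: measurable_funD; apply: measurable_funM.
Qed.

Lemma measurable_planeJ f : measurable_plane f ->
  measurable_plane (fun z => (f z)^*%C).
Proof.
move=> [f1 f2]; split.
  by under [rpart _]funext => p do rewrite /rpart ReJ.
under [ipart _]funext => p do rewrite /ipart ImJ.
exact: measurableT_comp.
Qed.

Lemma measurable_plane_real u : measurable_fun setT u ->
  measurable_plane (fun z => (u (ofC z))%:C).
Proof.
move=> mu; split.
  by under [rpart _]funext => p do rewrite /rpart toCK.
under [ipart _]funext => p do rewrite /ipart toCK.
exact: measurable_cst.
Qed.

Lemma measurable_sqw f : measurable_plane f -> measurable_fun setT (sqw f).
Proof.
move=> [f1 f2]; apply: measurable_funM; last exact: measurable_wt.
by apply: measurable_funD; exact: measurable_funX.
Qed.

Lemma measurable_sqwE f (D : set (R * R)) : measurable_plane f ->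
  measurable_fun D (EFin \o sqw f).
Proof.
move=> mf; apply/measurable_EFinP; apply: measurable_funTS; exact: measurable_sqw.
Qed.

(** The condition of square integrability alone, without quasi-periodicity: the
    subspaces of the theorem are all cut out of this vector space. *)
Definition L2s f := measurable_plane f /\ (norm2 nu f < +oo)%E.

Lemma norm2_ge0 f : (0 <= norm2 nu f)%E.
Proof. by rewrite norm2E; apply: integral_ge0 => p _; rewrite lee_fin sqw_ge0. Qed.

Definition nrm f : R := fine (norm2 nu f).

Lemma nrmE f : L2s f -> norm2 nu f = (nrm f)%:E.
Proof. by move=> [_ fy]; rewrite fineK// ge0_fin_numE// norm2_ge0. Qed.

Lemma nrm_ge0 f : 0 <= nrm f.
Proof. by rewrite fine_ge0// norm2_ge0. Qed.

Lemma L2s_integrable f : L2s f -> mu2.-integrable S (EFin \o sqw f).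
Proof.
move=> [mf fy]; apply/integrableP; split; first exact: measurable_sqwE.
rewrite norm2E in fy; apply: le_lt_trans fy.
by under eq_integral => p _ do rewrite /= ger0_norm ?sqw_ge0//.
Qed.

Lemma norm2_le f g : measurable_plane f -> measurable_plane g ->
  (forall p, S p -> sqw f p <= sqw g p) -> (norm2 nu f <= norm2 nu g)%E.
Proof.
move=> mf mg fg; rewrite !norm2E; apply: ge0_le_integral => //.
- by move=> x _; rewrite lee_fin sqw_ge0.
- exact: measurable_sqwE.
- exact: measurable_sqwE.
Qed.

Lemma norm2Z a f : measurable_plane f ->
  norm2 nu (fun z => a * f z) = ((sqc a)%:E * norm2 nu f)%E.
Proof.
move=> mf; rewrite !norm2E -ge0_integralZl//.
- by apply: eq_integral => p _; rewrite /sqw sqcM -mulrA EFinM.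
- exact: measurable_sqwE.
- by move=> x _; rewrite lee_fin sqw_ge0.
- by rewrite lee_fin sqc_ge0.
Qed.

Lemma norm2D f g : measurable_plane f -> measurable_plane g ->
  (norm2 nu (fun z => f z + g z)%R <= 2%:E * norm2 nu f + 2%:E * norm2 nu g)%E.
Proof.
move=> mf mg; rewrite !norm2E -!ge0_integralZl//; last 4 first.
- exact: measurable_sqwE.
- by move=> x _; rewrite lee_fin sqw_ge0.
- exact: measurable_sqwE.
- by move=> x _; rewrite lee_fin sqw_ge0.
have nn h x : (0 <= 2%:E * (sqw h x)%:E)%E.
  by rewrite -EFinM lee_fin mulr_ge0// sqw_ge0.
have mm h : measurable_plane h -> measurable_fun S (fun x => (2%:E * (sqw h x)%:E)%E).
  move=> mh; under eq_fun do rewrite -EFinM.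
  apply/measurable_EFinP/measurable_funTS; apply: measurable_funM => //.
  exact: measurable_sqw.
rewrite -ge0_integralD//; last 2 first.
- exact: mm.
- exact: mm.
apply: ge0_le_integral => //.
- by move=> x _; rewrite lee_fin sqw_ge0.
- by apply: measurable_sqwE; exact: measurable_planeD.
- by apply: emeasurable_funD; exact: mm.
- move=> x _; rewrite -!EFinM -EFinD lee_fin /sqw !mulrA -mulrDl.
  by rewrite ler_wpM2r ?wt_ge0// sqcD_le.
Qed.

Lemma L2sZ a f : L2s f -> L2s (fun z => a * f z).
Proof.
move=> [mf fy]; split; first by apply: measurable_planeM => //; exact: measurable_plane_cst.
by rewrite norm2Z// lte_mul_pinfty// lee_fin sqc_ge0.
Qed.

Lemma L2sD f g : L2s f -> L2s g -> L2s (fun z => f z + g z).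
Proof.
move=> [mf fy] [mg gy]; split; first exact: measurable_planeD.
apply: le_lt_trans (norm2D mf mg) _.
by rewrite lte_add_pinfty// lte_mul_pinfty// lee_fin.
Qed.

Lemma L2s0 : L2s (fun=> 0).
Proof.
split; first exact: measurable_plane_cst.
by rewrite norm2E integral0_eq// => x _; rewrite /sqw sqc0 mul0r.
Qed.

Lemma L2sB f g : L2s f -> L2s g -> L2s (fun z => f z - g z).
Proof.
move=> Lf Lg; under [X in L2s X]funext => z do rewrite -mulN1r.
by apply: L2sD => //; exact: L2sZ.
Qed.

Lemma L2s_sum (I : Type) (s : seq I) (F : I -> R[i] -> R[i]) :
  (forall i, L2s (F i)) -> L2s (fun z => \sum_(i <- s) F i z).
Proof.
move=> LF; elim: s => [|i s ih].
  by under [X in L2s X]funext => z do rewrite big_nil; exact: L2s0.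
by under [X in L2s X]funext => z do rewrite big_cons; exact: L2sD.
Qed.

Lemma nrmZ a f : L2s f -> nrm (fun z => a * f z) = sqc a * nrm f.
Proof. by move=> Lf; rewrite /nrm norm2Z ?(nrmE Lf)//; exact: (proj1 Lf). Qed.

Lemma nrmD_le f g : L2s f -> L2s g ->
  nrm (fun z => f z + g z) <= 2 * nrm f + 2 * nrm g.
Proof.
move=> Lf Lg; rewrite -lee_fin -nrmE; last exact: L2sD.
by rewrite EFinD !EFinM -!nrmE// norm2D//; [case: Lf|case: Lg].
Qed.

Lemma nrmB_sym f g : nrm (fun z => f z - g z) = nrm (fun z => g z - f z).
Proof.
rewrite /nrm !norm2E; congr fine; apply: eq_integral => p _.
by rewrite /sqw -sqcN opprB.
Qed.

(** The factor 2 is the price of working with the square of the norm. *)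
Lemma nrm_triangle f g h : L2s f -> L2s g -> L2s h ->
  nrm (fun z => f z - h z) <=
  2 * nrm (fun z => f z - g z) + 2 * nrm (fun z => g z - h z).
Proof.
move=> Lf Lg Lh.
have -> : (fun z => f z - h z) = (fun z => (f z - g z) + (g z - h z)).
  by apply/funext => z; ring.
by apply: nrmD_le; exact: L2sB.
Qed.

(** The integrand of the inner product. *)
Definition ips f g : R[i] -> R[i] := fun z => f z * (g z)^*%C * (wt (ofC z))%:C.

Lemma innerE f g : inner nu f g =
  (\int[mu2]_(p in S) rpart (ips f g) p) +i*
  (\int[mu2]_(p in S) ipart (ips f g) p).
Proof.
rewrite /inner; have -> : (fun z => f z * (g z)^*%C *
    (expR (- (nu * Normc.normc z ^+ 2)))%:C) = ips f g => //.
by apply/funext => z; rewrite /ips /wt ofCK normc_sqr.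
Qed.

Lemma measurable_ips f g : measurable_plane f -> measurable_plane g ->
  measurable_plane (ips f g).
Proof.
move=> mf mg; apply: measurable_planeM.
  by apply: measurable_planeM => //; exact: measurable_planeJ.
by apply: measurable_plane_real; exact: measurable_wt.
Qed.

Lemma ips_le f g p :
  `|rpart (ips f g) p| <= sqw f p + sqw g p /\
  `|ipart (ips f g) p| <= sqw f p + sqw g p.
Proof.
rewrite /rpart /ipart /ips /sqw toCK.
move: (f _) (g _) (wt_ge0 p) => [a b] [c d] w0.
rewrite !ReIm /= !mulr0 subr0 add0r -mulrDl !normrM (ger0_norm w0).
have s (x y : R) : `|x * y| <= (x ^+ 2 + y ^+ 2) / 2.
  rewrite ler_norml; apply/andP; split.
    by have := sqr_ge0 (x + y); rewrite sqrrD; lra.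
  by have := sqr_ge0 (x - y); rewrite sqrrB; lra.
have n0 : 0 <= a ^+ 2 + b ^+ 2 + (c ^+ 2 + d ^+ 2) by rewrite !addr_ge0// sqr_ge0.
rewrite !ler_wpM2r// /sqc /=.
  have := ler_normD (a * - d) (b * c); rewrite mulrN normrN.
  have := s a d; have := s b c; lra.
have := ler_normB (a * c) (b * - d); rewrite mulrN normrN.
have := s a c; have := s b d; lra.
Qed.

Lemma ips_integrable f g : L2s f -> L2s g ->
  mu2.-integrable S (EFin \o rpart (ips f g)) /\
  mu2.-integrable S (EFin \o ipart (ips f g)).
Proof.
move=> Lf Lg; have [m1 m2] := measurable_ips (proj1 Lf) (proj1 Lg).
have ifg := integrableD measurable_strip (L2s_integrable Lf) (L2s_integrable Lg).
have le u : measurable_fun setT u -> (forall p, `|u p| <= sqw f p + sqw g p) ->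
    mu2.-integrable S (EFin \o u).
  move=> mu ule; apply: le_integrable ifg => //.
    by apply/measurable_EFinP; apply: measurable_funTS.
  move=> x _ /=; rewrite lee_fin (le_trans (ule x))//.
  by rewrite ler_norm.
by split; apply: le => // p; have [] := ips_le f g p.
Qed.

Lemma eq_inner f f' g : f =1 f' -> inner nu f g = inner nu f' g.
Proof. by move=> /funext ->. Qed.

Lemma inner_linear a f g k : L2s f -> L2s g -> L2s k ->
  inner nu (fun z => a * f z + g z) k = a * inner nu f k + inner nu g k.
Proof.
move=> Lf Lg Lk; rewrite !innerE.
have [f1 f2] := ips_integrable Lf Lk; have [g1 g2] := ips_integrable Lg Lk.
have iZ c u : mu2.-integrable S (EFin \o u) -> mu2.-integrable S (EFin \o (fun p => c * u p)).
  by move=> iu; have := integrableZl measurable_strip c iu.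
have iD u v : mu2.-integrable S (EFin \o u) -> mu2.-integrable S (EFin \o v) ->
    mu2.-integrable S (EFin \o (fun p => u p + v p)).
  by move=> iu iv; have := integrableD measurable_strip iu iv.
have Er : rpart (ips (fun z => a * f z + g z) k) = fun p =>
    complex.Re a * rpart (ips f k) p + - complex.Im a * ipart (ips f k) p
    + rpart (ips g k) p.
  by apply/funext => p; rewrite /rpart /ipart /ips !ReIm; ring.
have Ei : ipart (ips (fun z => a * f z + g z) k) = fun p =>
    complex.Re a * ipart (ips f k) p + complex.Im a * rpart (ips f k) p
    + ipart (ips g k) p.
  by apply/funext => p; rewrite /rpart /ipart /ips !ReIm; ring.
rewrite Er Ei.
rewrite RintegralD//; last by apply: iD; apply: iZ.
rewrite RintegralD ?RintegralZl//; [|exact: iZ|exact: iZ].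
rewrite RintegralD//; last by apply: iD; apply: iZ.
rewrite RintegralD ?RintegralZl//; [|exact: iZ|exact: iZ].
move: (Rintegral _ _ _) (Rintegral _ _ _) (Rintegral _ _ _) (Rintegral _ _ _).
by move=> x1 x2 x3 x4; case: a {Er Ei} => a1 a2; apply: complex_ext => /=; ring.
Qed.

Lemma inner_conj f g : L2s f -> L2s g -> inner nu g f = (inner nu f g)^*%C.
Proof.
move=> Lf Lg; rewrite !innerE; apply: complex_ext; rewrite !ReIm /=.
  by apply: eq_Rintegral => p _; rewrite /rpart /ips !ReIm; ring.
have [_ i2] := ips_integrable Lf Lg.
rewrite -mulN1r -RintegralZl//.
by apply: eq_Rintegral => p _; rewrite /ipart /ips !ReIm; ring.
Qed.

Lemma inner_nrm f : L2s f -> inner nu f f = (nrm f)%:C.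
Proof.
move=> Lf; rewrite innerE /nrm norm2E; apply: complex_ext => /=.
  by apply: eq_Rintegral => p _; rewrite /rpart /ips /sqw mulcJ toCK !ReIm; ring.
rewrite (_ : \int[mu2]_(x in S) _ = \int[mu2]_(x in S) 0); last first.
  by apply: eq_Rintegral => p _; rewrite /ipart /ips mulcJ !ReIm; ring.
by rewrite /Rintegral integral0.
Qed.

Lemma inner0l g : L2s g -> inner nu (fun=> 0) g = 0.
Proof.
move=> Lg; have := inner_linear 1 L2s0 L2s0 Lg.
have -> : (fun z : R[i] => 1 * (0:R[i]) + 0) = fun=> 0.
  by apply/funext => z; ring.
by rewrite mul1r => /(congr1 (fun x => x - inner nu (fun=> 0) g)); rewrite subrr addrK.
Qed.

Lemma innerZl a f g : L2s f -> L2s g -> inner nu (fun z => a * f z) g = a * inner nu f g.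
Proof.
move=> Lf Lg; rewrite -[RHS]addr0 -(inner0l Lg) -inner_linear//.
  by apply: eq_inner => z; rewrite addr0.
exact: L2s0.
Qed.

Lemma innerDl f g k : L2s f -> L2s g -> L2s k ->
  inner nu (fun z => f z + g z) k = inner nu f k + inner nu g k.
Proof.
move=> Lf Lg Lk; rewrite -[X in X + _]mul1r -inner_linear//.
by apply: eq_inner => z; rewrite mul1r.
Qed.

Lemma innerBl f g k : L2s f -> L2s g -> L2s k ->
  inner nu (fun z => f z - g z) k = inner nu f k - inner nu g k.
Proof.
move=> Lf Lg Lk; rewrite -mulN1r addrC -inner_linear//.
by apply: eq_inner => z; ring.
Qed.

Lemma innerZr a f g : L2s f -> L2s g ->
  inner nu f (fun z => a * g z) = a^*%C * inner nu f g.
Proof.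
move=> Lf Lg; rewrite inner_conj//; last exact: L2sZ.
by rewrite innerZl// rmorphM/= [in RHS]inner_conj.
Qed.

Lemma inner_suml (I : Type) (s : seq I) (F : I -> R[i] -> R[i]) g :
  (forall i, L2s (F i)) -> L2s g ->
  inner nu (fun z => \sum_(i <- s) F i z) g = \sum_(i <- s) inner nu (F i) g.
Proof.
move=> LF Lg; elim: s => [|i s ih].
  by rewrite big_nil; under [X in inner _ X]funext => z do rewrite big_nil; exact: inner0l.
rewrite big_cons -ih -innerDl//; last exact: L2s_sum.
by apply: eq_inner => z; rewrite big_cons.
Qed.

Lemma nrmB f g : L2s f -> L2s g ->
  nrm (fun z => f z - g z) = nrm f - 2 * complex.Re (inner nu f g) + nrm g.
Proof.
move=> Lf Lg; apply: complexI; rewrite -inner_nrm; last exact: L2sB.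
have LB := L2sB Lf Lg.
rewrite innerBl// (inner_conj LB Lf) (inner_conj LB Lg) !innerBl// !inner_nrm//.
rewrite (inner_conj Lf Lg); move: (inner _ _ _) => z.
by apply: complex_ext; rewrite !ReIm ?Re_nat ?Im_nat /=; ring.
Qed.

(** Cauchy-Schwarz, from the positivity of the norm of [f - t g]. *)
Lemma cauchy_schwarz f g : L2s f -> L2s g -> sqc (inner nu f g) <= nrm f * nrm g.
Proof.
move=> Lf Lg; set c := inner nu f g.
have key t : 0 <= nrm f - 2 * t * sqc c + t ^+ 2 * sqc c * nrm g.
  have := nrm_ge0 (fun z => f z - (t%:C * c) * g z).
  rewrite nrmB//; last exact: L2sZ.
  rewrite innerZr// nrmZ// sqcM sqcC -/c.
  have -> : (t%:C * c)^*%C * c = (t * sqc c)%:C.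
    by move: (c) => [c1 c2]; apply: complex_ext; rewrite !ReIm /sqc/=; ring.
  rewrite ReC; lra.
have [g0|g0] := ltrP 0 (nrm g).
  have := key (nrm g)^-1.
  rewrite -(pmulr_rge0 _ g0) => H.
  rewrite -subr_ge0; move: H; congr (0 <= _).
  field. exact: lt0r_neq0.
have g00 : nrm g = 0 by apply/eqP; rewrite eq_le g0 nrm_ge0.
rewrite g00 mulr0 leNgt; apply/negP => c0.
have := key ((nrm f + 1) / (2 * sqc c)).
rewrite g00 mulr0 addr0.
rewrite (_ : 2 * _ * _ = nrm f + 1); last by field; exact: lt0r_neq0.
lra.
Qed.

(** Every limit taken in the density argument is an instance of this form of
    dominated convergence. *)
Lemma nrm_dominated (F : nat -> R[i] -> R[i]) f (G : R * R -> R) :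
  (forall n, measurable_plane (F n)) -> measurable_plane f ->
  mu2.-integrable S (EFin \o G) ->
  (forall p, S p -> (fun n => sqw (fun z => F n z - f z) p) @ \oo --> 0) ->
  (forall n p, S p -> sqw (fun z => F n z - f z) p <= G p) ->
  forall e : R, 0 < e ->
    exists n, (norm2 nu (fun z => (F n z - f z)%R) < e%:E)%E.
Proof.
move=> mF mf iG cF leG e e0.
have mFf n : measurable_plane (fun z => F n z - f z).
  under [X in measurable_plane X]funext => z do rewrite -mulN1r.
  apply: measurable_planeD => //.
  by apply: measurable_planeM => //; exact: measurable_plane_cst.
have H : {ae mu2, forall (p : R * R) (n : nat), S p ->
    (`|(sqw (fun z => F n z - f z) p)%:E| <= (EFin \o G) p)%E}.
  by apply: aeW => p n Sp; rewrite gee0_abs ?lee_fin ?sqw_ge0// leG.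
have C : {ae mu2, forall p : R * R, S p ->
    (fun n => (sqw (fun z => F n z - f z) p)%:E) @ \oo --> (0%:E : \bar R)}.
  by apply: aeW => p Sp; apply: cvg_EFin; [exact: nearW|exact: cF].
have [_ _] := @dominated_convergence _ _ _ mu2 S measurable_strip
  (fun n p => (sqw (fun z => F n z - f z) p)%:E) (fun=> 0%E) (EFin \o G)
  (fun n => measurable_sqwE (D:=S) (mFf n)) (@measurable_cst _ _ _ _ _ _) C iG H.
rewrite integral0.
move/fine_cvgP => [_] /cvgrPdist_lt /(_ e e0) [n _ /(_ n (leqnn n))] /=.
rewrite sub0r normrN => ne; exists n.
have L : L2s (fun z => F n z - f z).
  split => //; rewrite norm2E.
  have : (\int[mu2]_(x in S) (sqw (fun z => F n z - f z) x)%:E <=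
     \int[mu2]_(x in S) `|(EFin \o G) x|)%E.
    apply: ge0_le_integral => //.
    - by move=> x _; rewrite lee_fin sqw_ge0.
    - exact: measurable_sqwE.
    - by apply: measurableT_comp => //; case/integrableP : iG.
    - move=> x Sx; rewrite (le_trans _ (lee_abs _))// lee_fin leG//.
  move/le_lt_trans; apply; by case/integrableP : iG.
rewrite (nrmE L) lte_fin /nrm norm2E.
by apply: le_lt_trans ne; rewrite ler_norm.
Qed.

Lemma norm2_eq0_ae f : measurable_plane f -> norm2 nu f = 0%E ->
  {ae mu2, forall p, S p -> f (toC p) = 0}.
Proof.
move=> mf; rewrite norm2E => f0.
have /(ae_eq_integral_abs mu2 measurable_strip (measurable_sqwE (D:=S) mf)) :
    (\int[mu2]_(x in S) `|(EFin \o sqw f) x| = 0)%E.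
  by rewrite -[RHS]f0; apply: eq_integral => p _; rewrite gee0_abs// lee_fin sqw_ge0.
apply: filterS => p H Sp; have /= [] := H Sp.
by move/eqP; rewrite mulf_eq0 (gt_eqF (expR_gt0 _)) orbF sqc_eq0 => /eqP.
Qed.

End WeightedL2.

(** * Partial derivatives of functions of a complex variable *)

Section PartialDerivatives.
Context {R : realType}.
Implicit Types (f g : R[i] -> R[i]) (u : R * R -> R) (p v : R * R).

Local Notation nc := (@Normc.normc R).

Lemma nc_ge0 z : 0 <= nc z.
Proof. by case: z => a b; exact: sqrtr_ge0. Qed.
Lemma Re_le_nc z : `|complex.Re z| <= nc z.
Proof.
rewrite -(@ler_pXn2r _ 2) ?nnegrE ?nc_ge0// normc_sqr real_normK ?num_real//.
by rewrite lerDl sqr_ge0.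
Qed.
Lemma Im_le_nc z : `|complex.Im z| <= nc z.
Proof.
rewrite -(@ler_pXn2r _ 2) ?nnegrE ?nc_ge0// normc_sqr real_normK ?num_real//.
by rewrite lerDr sqr_ge0.
Qed.
Lemma nc_le_ReIm z : nc z <= `|complex.Re z| + `|complex.Im z|.
Proof.
rewrite -(@ler_pXn2r _ 2) ?nnegrE ?addr_ge0 ?nc_ge0// normc_sqr /sqc.
rewrite sqrrD !real_normK ?num_real// addrAC lerDl.
by rewrite mulrn_wge0// mulr_ge0.
Qed.
Lemma ncC (a : R) : nc a%:C = `|a|.
Proof. by rewrite /= expr0n addr0 sqrtr_sqr. Qed.
Lemma ncM x y : nc (x * y) = nc x * nc y.
Proof. exact: Normc.normcM. Qed.
Lemma ncD x y : nc (x + y) <= nc x + nc y.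
Proof. exact: le_normcD. Qed.
Lemma ncN x : nc (- x) = nc x.
Proof. exact: normcN. Qed.
Lemma ncB x y : nc (x - y) <= nc x + nc y.
Proof. by rewrite -[nc y]ncN; exact: ncD. Qed.
Lemma nc0 : nc 0 = 0. Proof. exact: Normc.normc0. Qed.
Lemma nc1 : nc 1 = 1. Proof. exact: Normc.normc1. Qed.
Lemma nc_i : nc 'i%C = 1. Proof. by rewrite /= expr0n expr1n add0r sqrtr1. Qed.
Lemma ncX x n : nc (x ^+ n) = nc x ^+ n.
Proof. by elim: n => [|n ih]; rewrite ?expr0 ?nc1// !exprS ncM ih. Qed.
Lemma nc_cexp z : nc (cexp z) = expR (complex.Re z).
Proof.
apply/eqP; rewrite -(@eqrXn2 _ 2) ?nc_ge0 ?expR_ge0//.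
by rewrite normc_sqr sqc_cexp expRM_natl.
Qed.
Lemma nc_eq0 z : (nc z == 0) = (z == 0).
Proof. by rewrite -sqrf_eq0 normc_sqr sqc_eq0. Qed.
Lemma is_derive_rem (V : normedModType R) (u : V -> R) (p v : V) (L C : R) :
  (forall h : R, `|h| <= 1 -> `|u (h *: v + p) - u p - h * L| <= C * h ^+ 2) ->
  is_derive p v u L.
Proof.
move=> H.
have cv : (fun h => h^-1 *: ((u \o shift p) (h *: v) - u p)) @ 0^' --> L.
  apply/cvgrPdist_le => e e0.
  have C0 : 0 < `|C| + 1 by rewrite ltr_pwDr.
  near=> h.
  have h0 : h != 0 by near: h; exact: nbhs_dnbhs_neq.
  have h1 : `|h| <= 1 by near: h; exact: dnbhs0_le.
  have he : `|h| <= e / (`|C| + 1) by near: h; apply: dnbhs0_le; exact: divr_gt0.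
  have -> : L - h^-1 *: ((u \o shift p) (h *: v) - u p) =
      - (h^-1 * (u (h *: v + p) - u p - h * L)).
    by rewrite /= /GRing.scale /=; field.
  rewrite normrN normrM normfV ler_pdivrMl ?normr_gt0//.
  apply: le_trans (H _ h1) _; rewrite -real_normK ?num_real// expr2 mulrCA.
  rewrite ler_wpM2l//.
  apply: (@le_trans _ _ ((`|C| + 1) * `|h|)).
    by rewrite ler_wpM2r// (le_trans (ler_norm _))// lerDl.
  by rewrite mulrC -ler_pdivlMr.
by apply: DeriveDef; [apply/cvg_ex; exists L|exact: cvg_lim].
Unshelve. all: by end_near. Qed.

Lemma is_derive_dirx u p l :
  is_derive p (dirx R) u l <-> is_derive p.1 1 (fun t : R => u (t, p.2)) l.
Proof.
have E : (fun h : R => h^-1 *: ((u \o shift p) (h *: dirx R) - u p)) =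
    (fun h : R => h^-1 *: (((fun t : R => u (t, p.2)) \o shift p.1) (h *: 1) - u (p.1, p.2))).
  apply/funext => h; case: p => x y; congr (_ *: (u _ - _)).
  by apply/pair_equal_spec; rewrite /= /GRing.scale /=; split; ring.
by split=> -[d v]; split; move: d v; rewrite /derivable /derive E.
Qed.

Lemma is_derive_diry u p l :
  is_derive p (diry R) u l <-> is_derive p.2 1 (fun t : R => u (p.1, t)) l.
Proof.
have E : (fun h : R => h^-1 *: ((u \o shift p) (h *: diry R) - u p)) =
    (fun h : R => h^-1 *: (((fun t : R => u (p.1, t)) \o shift p.2) (h *: 1) - u (p.1, p.2))).
  apply/funext => h; case: p => x y; congr (_ *: (u _ - _)).
  by apply/pair_equal_spec; rewrite /= /GRing.scale /=; split; ring.
by split=> -[d v]; split; move: d v; rewrite /derivable /derive E.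
Qed.

(** The function g is the derivative of f in the direction v; as a relation, it
    can be composed without computing the directional derivatives first. *)
Definition pder v f g : Prop := forall p,
  is_derive p v (rpart f) (rpart g p) /\ is_derive p v (ipart f) (ipart g p).

Lemma pder_partialx f g : pder (dirx R) f g -> partialx f = g.
Proof.
move=> H; apply/funext => z; have [h1 h2] := H (ofC z).
rewrite /partialx !derive_val /rpart /ipart ofCK; by case: (g z).
Qed.
Lemma pder_partialy f g : pder (diry R) f g -> partialy f = g.
Proof.
move=> H; apply/funext => z; have [h1 h2] := H (ofC z).
rewrite /partialy !derive_val /rpart /ipart ofCK; by case: (g z).
Qed.

Lemma rpartD f g : rpart (fun z => f z + g z) = fun p => rpart f p + rpart g p.
Proof. by apply/funext => p; rewrite /rpart ReD. Qed.
Lemma ipartD f g : ipart (fun z => f z + g z) = fun p => ipart f p + ipart g p.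
Proof. by apply/funext => p; rewrite /ipart ImD. Qed.
Lemma rpartM f g : rpart (fun z => f z * g z) =
  fun p => rpart f p * rpart g p - ipart f p * ipart g p.
Proof. by apply/funext => p; rewrite /rpart /ipart ReM. Qed.
Lemma ipartM f g : ipart (fun z => f z * g z) =
  fun p => rpart f p * ipart g p + ipart f p * rpart g p.
Proof. by apply/funext => p; rewrite /rpart /ipart ImM. Qed.
Lemma rpartJ f : rpart (fun z => (f z)^*%C) = rpart f.
Proof. by apply/funext => p; rewrite /rpart ReJ. Qed.
Lemma ipartJ f : ipart (fun z => (f z)^*%C) = fun p => - ipart f p.
Proof. by apply/funext => p; rewrite /ipart ImJ. Qed.

Lemma pder_cst v (a : R[i]) : pder v (fun=> a) (fun=> 0).
Proof. by move=> p; split; exact: is_derive_cst. Qed.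

Lemma pderD v f g f' g' : pder v f f' -> pder v g g' ->
  pder v (fun z => f z + g z) (fun z => f' z + g' z).
Proof.
move=> Hf Hg p; have [f1 f2] := Hf p; have [g1 g2] := Hg p.
split; rewrite ?rpartD ?ipartD; exact: is_deriveD.
Qed.

Lemma pderM v f g f' g' : pder v f f' -> pder v g g' ->
  pder v (fun z => f z * g z) (fun z => f' z * g z + f z * g' z).
Proof.
move=> Hf Hg p; have [f1 f2] := Hf p; have [g1 g2] := Hg p.
split.
  rewrite rpartM; apply: is_derive_eq.
  by rewrite /rpart /ipart !ReIm /GRing.scale /=; ring.
rewrite ipartM; apply: is_derive_eq.
by rewrite /rpart /ipart !ReIm /GRing.scale /=; ring.
Qed.

Lemma pderJ v f f' : pder v f f' ->
  pder v (fun z => (f z)^*%C) (fun z => (f' z)^*%C).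
Proof.
move=> Hf p; have [f1 f2] := Hf p; split; first by rewrite !rpartJ.
by rewrite !ipartJ; exact: is_deriveN.
Qed.

Lemma pderZ v (a : R[i]) f f' : pder v f f' ->
  pder v (fun z => a * f z) (fun z => a * f' z).
Proof.
move=> Hf; have := pderM (pder_cst v a) Hf.
by under [X in pder _ _ X]funext => z do rewrite mul0r add0r.
Qed.

Lemma pder_eq v f g f' g' : f =1 g -> f' =1 g' -> pder v f f' -> pder v g g'.
Proof. by move=> /funext -> /funext ->. Qed.

Lemma pderx_y (a : R -> R) : pder (dirx R) (fun z => (a (complex.Im z))%:C) (fun=> 0).
Proof. by move=> p; split; [apply/is_derive_dirx; exact: (is_derive_cst (a p.2))|exact: is_derive_cst]. Qed.

Lemma pdery_y (a a' : R -> R) : (forall t : R, is_derive t 1 a (a' t)) ->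
  pder (diry R) (fun z => (a (complex.Im z))%:C) (fun z => (a' (complex.Im z))%:C).
Proof.
by move=> H p; split; [apply/is_derive_diry; exact: H|exact: is_derive_cst].
Qed.

Lemma d_dzE f fx fy : pder (dirx R) f fx -> pder (diry R) f fy ->
  d_dz f = fun z => (fx z - 'i%C * fy z) / 2.
Proof. by move=> hx hy; apply/funext => z; rewrite /d_dz (pder_partialx hx) (pder_partialy hy). Qed.
Lemma d_dzbarE f fx fy : pder (dirx R) f fx -> pder (diry R) f fy ->
  d_dzbar f = fun z => (fx z + 'i%C * fy z) / 2.
Proof. by move=> hx hy; apply/funext => z; rewrite /d_dzbar (pder_partialx hx) (pder_partialy hy). Qed.

Definition cont f := continuous (rpart f) /\ continuous (ipart f).

Lemma cont_cst (a : R[i]) : cont (fun=> a).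
Proof. by split=> p; exact: cvg_cst. Qed.
Lemma contD f g : cont f -> cont g -> cont (fun z => f z + g z).
Proof.
move=> [f1 f2] [g1 g2]; rewrite /cont rpartD ipartD; split=> p.
  by apply: cvgD; [exact: f1|exact: g1].
by apply: cvgD; [exact: f2|exact: g2].
Qed.
Lemma contM f g : cont f -> cont g -> cont (fun z => f z * g z).
Proof.
move=> [f1 f2] [g1 g2]; rewrite /cont rpartM ipartM; split=> p.
  by apply: cvgB; apply: cvgM; [exact: f1|exact: g1|exact: f2|exact: g2].
by apply: cvgD; apply: cvgM; [exact: f1|exact: g2|exact: f2|exact: g1].
Qed.
Lemma contJ f : cont f -> cont (fun z => (f z)^*%C).
Proof.
move=> [f1 f2]; rewrite /cont rpartJ ipartJ; split=> // p.
by apply: cvgN; exact: f2.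
Qed.
Lemma cont_y (a : R -> R) : continuous a -> cont (fun z => (a (complex.Im z))%:C).
Proof.
move=> ca; split=> p; last exact: cvg_cst.
by apply: (@continuous_comp _ _ _ snd a); [exact: cvg_snd|exact: ca].
Qed.

(** Induction on the order of differentiation, once and for all: smoothness is
    proved below by exhibiting a class of continuous functions which contains
    its partial derivatives. *)
Lemma smooth_stable (P : (R[i] -> R[i]) -> Prop) :
  (forall f, P f -> cont f /\ exists fx fy,
     [/\ pder (dirx R) f fx, pder (diry R) f fy, P fx & P fy]) ->
  forall f, P f -> smooth f.
Proof.
move=> H f + k; elim: k f => [|k ih] f Pf.
  by have [] := H f Pf.
have [cf [fx [fy [hx hy Px Py]]]] := H f Pf.
have [x1 x2] := ih _ Px; have [y1 y2] := ih _ Py.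
have rx : (fun p => 'D_(dirx R) (rpart f) p) = rpart fx.
  by apply/funext => p; have [? ?] := hx p; rewrite derive_val.
have ix : (fun p => 'D_(dirx R) (ipart f) p) = ipart fx.
  by apply/funext => p; have [? ?] := hx p; rewrite derive_val.
have ry : (fun p => 'D_(diry R) (rpart f) p) = rpart fy.
  by apply/funext => p; have [? ?] := hy p; rewrite derive_val.
have iy : (fun p => 'D_(diry R) (ipart f) p) = ipart fy.
  by apply/funext => p; have [? ?] := hy p; rewrite derive_val.
split; split; rewrite ?rx ?ix ?ry ?iy// => p;
  by have [? ?] := hx p; have [? ?] := hy p; exact: ex_derive.
Qed.

Lemma smooth_pder f : smooth f -> [/\ cont f,
  pder (dirx R) f (partialx f), pder (diry R) f (partialy f),
  smooth (partialx f) & smooth (partialy f)].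
Proof.
move=> sf; split.
- exact: sf 0%N.
- move=> p; have [[d1 _ _ _] [d2 _ _ _]] := sf 1%N.
  by rewrite /rpart /ipart /partialx /= toCK; split; apply/derivableP.
- move=> p; have [[_ d1 _ _] [_ d2 _ _]] := sf 1%N.
  by rewrite /rpart /ipart /partialy /= toCK; split; apply/derivableP.
- move=> k; have [[_ _ d1 _] [_ _ d2 _]] := sf k.+1.
  split; [move: d1|move: d2]; congr Ck; apply/funext => p;
    by rewrite /rpart /ipart /partialx /= toCK.
- move=> k; have [[_ _ _ d1] [_ _ _ d2]] := sf k.+1.
  split; [move: d1|move: d2]; congr Ck; apply/funext => p;
    by rewrite /rpart /ipart /partialy /= toCK.
Qed.

Lemma smooth_lin (a : R[i]) f g : smooth f -> smooth g ->
  smooth (fun z => a * f z + g z).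
Proof.
move=> sf sg.
apply: (@smooth_stable (fun h => exists f g, [/\ smooth f, smooth g &
  h = fun z => a * f z + g z])); last by exists f, g.
move=> _ [{sf}f [{sg}g [sf sg ->]]].
have [cf fx fy sfx sfy] := smooth_pder sf; have [cg gx gy sgx sgy] := smooth_pder sg.
split; first by apply: contD => //; apply: contM => //; exact: cont_cst.
exists (fun z => a * partialx f z + partialx g z), (fun z => a * partialy f z + partialy g z).
split.
- by apply: pderD => //; exact: pderZ.
- by apply: pderD => //; exact: pderZ.
- by exists (partialx f), (partialx g).
- by exists (partialy f), (partialy g).
Qed.

End PartialDerivatives.

(** * Complex derivatives with a quadratic remainder *)

Section ComplexDerivative.
Context {R : realType}.
Local Notation nc := (@Normc.normc R).
Implicit Types (f g : R[i] -> R[i]) (z h s : R[i]).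

Lemma sin_le_norm (x : R) : `|sin x| <= `|x|.
Proof.
wlog x0 : x / 0 <= x.
  move=> H; have [|x0] := leP 0 x; first exact: H.
  by rewrite -normrN -sinN -[`|x|]normrN H// oppr_ge0 ltW.
have [c _] := @MVT_segment R sin cos 0 x x0 (fun y _ => is_derive_sin y)
  (continuous_subspaceT (@continuous_sin R)).
by rewrite sin0 !subr0 => ->; rewrite normrM ler_piMl// cos_max.
Qed.

Lemma cos_sub1 (x : R) : `|cos x - 1| <= x ^+ 2.
Proof.
have -> : cos x - 1 = - (2 * sin (x / 2) ^+ 2).
  have {1}-> : x = (x / 2) *+ 2 by rewrite -mulr_natr; field.
  by rewrite cos_mulr2n cos2sin2 -mulr_natr; ring.
rewrite normrN normrM normrX ger0_norm//.
have := sin_le_norm (x / 2); rewrite normrM normfV (ger0_norm (_ : 0 <= 2))// => H.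
have : `|sin (x / 2)| ^+ 2 <= (`|x| / 2) ^+ 2 by rewrite ler_pXn2r// nnegrE// divr_ge0.
have := real_normK (num_real x); have := sqr_ge0 x; lra.
Qed.

Lemma sin_sub (x : R) : `|sin x - x| <= x ^+ 2.
Proof.
wlog x0 : x / 0 <= x.
  move=> H; have [|x0] := leP 0 x; first exact: H.
  have := H (- x); rewrite sinN -opprD normrN sqrrN; apply.
  by rewrite oppr_ge0 ltW.
have D (y : R) : is_derive y 1 (fun t : R => sin t - t) (cos y - 1).
  by apply: is_deriveB.
have C : {within `[0, x], continuous (fun t : R => sin t - t)}.
  apply: continuous_subspaceT => t.
  by apply: cvgB; [exact: continuous_sin|exact: cvg_id].
have [c cx] := @MVT_segment R _ (fun y => cos y - 1) 0 x x0 (fun y _ => D y) C.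
rewrite sin0 !subr0 => ->; rewrite normrM (ger0_norm x0) expr2 ler_wpM2r//.
have /andP[c0 cx'] : 0 <= c <= x by move: cx; rewrite in_itv.
have -> : cos c - 1 = - (2 * sin (c / 2) ^+ 2).
  have {1}-> : c = (c / 2) *+ 2 by rewrite -mulr_natr; field.
  by rewrite cos_mulr2n cos2sin2 -mulr_natr; ring.
rewrite normrN normrM normrX ger0_norm//.
have := sin_le_norm (c / 2); rewrite normrM normfV (ger0_norm (_ : 0 <= 2))// (ger0_norm c0) => H.
have H1 : `|sin (c / 2)| ^+ 2 <= `|sin (c / 2)|.
  by rewrite expr2 ler_piMr// sin_max.
lra.
Qed.

Lemma expR_sub1 (x : R) : `|expR x - 1| <= `|x| * expR `|x|.
Proof.
have e1 := expR_ge1Dx x; have e2 := expR_ge1Dx (- x).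
have ee : expR x * expR (- x) = 1 by rewrite -expRD subrr expR0.
have ex := expR_gt0 x.
have up : expR x - 1 <= x * expR x.
  have : expR x * (1 - x) <= expR x * expR (- x) by rewrite ler_wpM2l// ltW.
  by rewrite ee; lra.
have [x0|x0] := leP 0 x.
  by rewrite !ger0_norm// subr_ge0 -expR0 ler_expR.
have : 1 <= expR (- x) by rewrite -expR0 ler_expR oppr_ge0 ltW.
rewrite ler0_norm; last by rewrite subr_le0 -expR0 ler_expR ltW.
rewrite (ltr0_norm x0) => e3.
have : - x * 1 <= - x * expR (- x) by rewrite ler_wpM2l// oppr_ge0 ltW.
lra.
Qed.

Lemma expR_sub2 (x : R) : `|expR x - 1 - x| <= x ^+ 2 * expR `|x|.
Proof.
have e1 := expR_ge1Dx x; have e2 := expR_ge1Dx (- x).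
have ee : expR x * expR (- x) = 1 by rewrite -expRD subrr expR0.
have ex := expR_gt0 x.
have up : expR x - 1 <= x * expR x.
  have : expR x * (1 - x) <= expR x * expR (- x) by rewrite ler_wpM2l// ltW.
  by rewrite ee; lra.
have := expR_sub1 x.
rewrite (ger0_norm (_ : 0 <= expR x - 1 - x)); last lra.
have n2 : x ^+ 2 = `|x| * `|x| by rewrite -expr2 real_normK ?num_real.
rewrite n2 -mulrA => H.
apply: (@le_trans _ _ (`|x| * `|expR x - 1|)); last by rewrite ler_wpM2l.
by rewrite -normrM; apply: le_trans (ler_norm _); lra.
Qed.

(** The remainders of the real functions exp, cos and sin are recombined; the
    second order is needed for the differentiability of theta series. *)
Lemma cexp_rem s : nc (cexp s - 1 - s) <= 3 * nc s ^+ 2 * expR `|complex.Re s|.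
Proof.
rewrite normc_sqr; apply: le_trans (nc_le_ReIm _) _.
have -> : complex.Re (cexp s - 1 - s) = expR (complex.Re s) * cos (complex.Im s) -
    0 * sin (complex.Im s) - 1 - complex.Re s by rewrite /cexp !ReIm /=; ring.
have -> : complex.Im (cexp s - 1 - s) = expR (complex.Re s) * sin (complex.Im s) +
    0 * cos (complex.Im s) - 0 - complex.Im s by rewrite /cexp !ReIm /=; ring.
case: s => a b; rewrite /sqc /=.
have E1 : 1 <= expR `|a| by rewrite -expR0 ler_expR.
have Ea : expR a <= expR `|a| by rewrite ler_expR ler_norm.
have ea := expR_ge0 a.
have H1 : `|expR a * cos b - 0 * sin b - 1 - a| <=
    a ^+ 2 * expR `|a| + b ^+ 2 * expR `|a|.
  have -> : expR a * cos b - 0 * sin b - 1 - a =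
    (expR a - 1 - a) + expR a * (cos b - 1) by ring.
  apply: le_trans (ler_normD _ _) _; apply: lerD; first exact: expR_sub2.
  rewrite normrM (ger0_norm ea) mulrC; apply: ler_pM => //; exact: cos_sub1.
have H2 : `|expR a * sin b + 0 * cos b - 0 - b| <=
    `|a| * `|b| * expR `|a| + b ^+ 2 * expR `|a|.
  have -> : expR a * sin b + 0 * cos b - 0 - b =
    (expR a - 1) * b + expR a * (sin b - b) by ring.
  apply: le_trans (ler_normD _ _) _; apply: lerD.
    by rewrite normrM mulrAC ler_wpM2r// expR_sub1.
  rewrite normrM (ger0_norm ea) mulrC; apply: ler_pM => //; exact: sin_sub.
have H3 : `|a| * `|b| <= (a ^+ 2 + b ^+ 2) / 2.
  have := sqr_ge0 (`|a| - `|b|); rewrite sqrrB !real_normK ?num_real//; lra.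
have : `|a| * `|b| * expR `|a| <= (a ^+ 2 + b ^+ 2) / 2 * expR `|a|.
  by rewrite ler_wpM2r// expR_ge0.
have := mulr_ge0 (sqr_ge0 a) (expR_ge0 `|a|).
have := mulr_ge0 (sqr_ge0 b) (expR_ge0 `|a|).
move: H1 H2; lra.
Qed.

(** Complex differentiability with a quadratic remainder: enough for all the
    explicit functions below, and stable under products and fast series. *)
Definition cdiff f f' : Prop := forall z, exists C : R, forall h, nc h <= 1 ->
  nc (f (z + h) - f z - h * f' z) <= C * nc h ^+ 2.

Lemma toC_scale (t : R) (v p : R * R) : toC (t *: v + p) = toC p + t%:C * toC v.
Proof. case: v p => [v1 v2] [p1 p2]; apply: complex_ext; rewrite !ReIm /=.
  by transitivity (t * v1 + p1) => //; ring.
by transitivity (t * v2 + p2) => //; ring. Qed.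

Lemma pder_cdiff f f' (v : R * R) : nc (toC v) = 1 -> cdiff f f' ->
  pder v f (fun z => toC v * f' z).
Proof.
move=> nv H p; have [C HC] := H (toC p).
have K (t : R) : `|t| <= 1 ->
    nc (f (toC (t *: v + p)) - f (toC p) - t%:C * (toC v * f' (toC p))) <= C * t ^+ 2.
  move=> t1; rewrite toC_scale mulrA.
  have := HC (t%:C * toC v); rewrite ncM ncC nv mulr1 real_normK ?num_real//.
  exact.
split; apply: (@is_derive_rem _ _ _ _ _ _ C) => t t1; apply: le_trans (K t t1).
  apply: le_trans (Re_le_nc _); rewrite le_eqVlt; apply/orP; left; apply/eqP.
  by congr (`|_|); rewrite /rpart !ReIm; ring.
apply: le_trans (Im_le_nc _); rewrite le_eqVlt; apply/orP; left; apply/eqP.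
by congr (`|_|); rewrite /ipart !ReIm; ring.
Qed.

Lemma pderx_cdiff f f' : cdiff f f' -> pder (dirx R) f f'.
Proof.
have t1 : toC (dirx R) = 1 by [].
move=> H; apply: pder_eq (pder_cdiff _ H) => //; last by rewrite t1 nc1.
by move=> z; rewrite t1 mul1r.
Qed.

Lemma pdery_cdiff f f' : cdiff f f' -> pder (diry R) f (fun z => 'i%C * f' z).
Proof. by move=> H; apply: pder_eq (pder_cdiff _ H) => //; exact: nc_i. Qed.

Lemma cont_lip f : (forall z, exists C : R, forall h, nc h <= 1 ->
  nc (f (z + h) - f z) <= C * nc h) -> cont f.
Proof.
move=> H.
have K p (e : R) : 0 < e -> \forall q \near p, nc (f (toC q) - f (toC p)) <= e.
  move=> e0; have [C HC] := H (toC p).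
  have C0 : 0 < `|C| + 1 by rewrite ltr_pwDr.
  pose d := Num.min 1 (e / (`|C| + 1)).
  have d0 : 0 < d by rewrite lt_min ltr01 divr_gt0.
  have : \forall q \near p, ball p (d / 2) q by apply: nbhsx_ballx; rewrite divr_gt0.
  apply: filterS => q [q1 q2].
  have le2 : nc (toC q - toC p) <= d.
    apply: le_trans (nc_le_ReIm _) _; rewrite !ReIm /=.
    by move: q1 q2; rewrite /ball /= distrC (distrC p.2) => q1 q2; lra.
  have -> : f (toC q) = f (toC p + (toC q - toC p)) by congr f; ring.
  apply: le_trans (HC _ _) _; first by rewrite (le_trans le2)// ge_min lexx.
  apply: (@le_trans _ _ ((`|C| + 1) * d)).
    apply: (@le_trans _ _ ((`|C| + 1) * nc (toC q - toC p))).
      by rewrite ler_wpM2r ?nc_ge0// (le_trans (ler_norm _))// lerDl.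
    by rewrite ler_wpM2l// ltW.
  rewrite mulrC -ler_pdivlMr// ge_min lexx orbT//.
split=> p; apply/cvgrPdist_le => e e0; apply: filterS (K p e e0) => q;
  apply: le_trans; rewrite distrC.
  apply: le_trans (Re_le_nc _); rewrite le_eqVlt; apply/orP; left; apply/eqP.
  by congr (`|_|); rewrite /rpart !ReIm; ring.
apply: le_trans (Im_le_nc _); rewrite le_eqVlt; apply/orP; left; apply/eqP.
by congr (`|_|); rewrite /ipart !ReIm; ring.
Qed.

Lemma cdiff_lip f f' : cdiff f f' -> forall z, exists C : R, 0 <= C /\
  forall h, nc h <= 1 -> nc (f (z + h) - f z) <= C * nc h.
Proof.
move=> H z; have [C HC] := H z.
exists (`|C| + nc (f' z)); split; first by rewrite addr_ge0// nc_ge0.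
move=> h h1; have -> : f (z + h) - f z = (f (z + h) - f z - h * f' z) + h * f' z by ring.
apply: le_trans (ncD _ _) _; rewrite mulrDl ncM [nc h * _]mulrC lerD2r.
apply: le_trans (HC h h1) _; rewrite expr2 mulrA ler_wpM2r ?nc_ge0//.
apply: (@le_trans _ _ (`|C| * nc h)); first by rewrite ler_wpM2r ?nc_ge0// ler_norm.
by rewrite ler_piMr.
Qed.

Lemma cont_cdiff f f' : cdiff f f' -> cont f.
Proof.
by move=> H; apply: cont_lip => z; have [C [_ ?]] := cdiff_lip H z; exists C.
Qed.

Lemma cdiff_gauss (nu : R) : cdiff (fun z => cexp ((nu / 2)%:C * z ^+ 2))
  (fun z => nu%:C * z * cexp ((nu / 2)%:C * z ^+ 2)).
Proof.
move=> z; set E := cexp ((nu / 2)%:C * z ^+ 2).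
pose K := `|nu| * nc z + `|nu|.
have K0 : 0 <= K by rewrite addr_ge0// mulr_ge0// nc_ge0.
exists (nc E * (3 * K ^+ 2 * expR K + `|nu|)) => h h1.
pose s := nu%:C * z * h + (nu / 2)%:C * h ^+ 2.
have two : ((nu / 2)%:C : R[i]) * 2 = nu%:C.
  by rewrite -(rmorph_nat (real_complex R)) -rmorphM/= divfK.
have -> : cexp ((nu / 2)%:C * (z + h) ^+ 2) = E * cexp s.
  by rewrite -cexpD; congr cexp; rewrite /s -two; ring.
have -> : E * cexp s - E - h * (nu%:C * z * E) =
   E * ((cexp s - 1 - s) + (nu / 2)%:C * h ^+ 2) by rewrite /s; ring.
have h0 := nc_ge0 h; have hh : 0 <= nc h ^+ 2 by rewrite exprn_ge0.
have sK : nc s <= K * nc h.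
  apply: le_trans (ncD _ _) _; rewrite !(ncX, ncM, ncC) mulrDl lerD2l.
  rewrite normrM normfV (ger0_norm (_ : 0 <= 2))// expr2 mulrA ler_wpM2r//.
  have : `|nu| * nc h <= `|nu| * 1 by rewrite ler_wpM2l.
  have := mulr_ge0 (normr_ge0 nu) h0; lra.
rewrite ncM -[leRHS]mulrA ler_wpM2l ?nc_ge0//.
apply: le_trans (ncD _ _) _; rewrite mulrDl; apply: lerD.
  apply: le_trans (cexp_rem s) _.
  have A : nc s ^+ 2 * expR `|complex.Re s| <= (K * nc h) ^+ 2 * expR K.
    apply: ler_pM; rewrite ?exprn_ge0 ?nc_ge0 ?expR_ge0//.
      by rewrite ler_pXn2r// nnegrE ?nc_ge0// mulr_ge0.
    rewrite ler_expR; apply: le_trans (Re_le_nc _) _; apply: le_trans sK _.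
    by rewrite ler_piMr.
  move: A; rewrite exprMn; lra.
rewrite ncM ncX ncC ler_wpM2r// normrM normfV (ger0_norm (_ : 0 <= 2))//.
have := normr_ge0 nu; lra.
Qed.

Lemma entire_cdiff f f' : cdiff f f' -> entire f.
Proof.
move=> H z; have [C HC] := H z.
apply/cvg_ex; exists (f' z : R[i]^o); apply/cvgrPdist_le => e e0.
have C0 : 0 < `|C| + 1 by rewrite ltr_pwDr.
have [ei er] : complex.Im e = 0 /\ 0 < complex.Re e.
  by move: e0; rewrite ltcE => /andP[/eqP].
have ee : e = (complex.Re e)%:C by apply: complex_ext.
pose d := Num.min 1 (complex.Re e / (`|C| + 1)).
have d0 : 0 < d by rewrite lt_min ltr01 divr_gt0.
have nE (x : R[i]) : `|x| = (nc x)%:C by [].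
have dC : (0 : R[i]) < d%:C by rewrite ltcR.
near=> h.
have h0 : h != 0 by near: h; exact: nbhs_dnbhs_neq.
have hd : nc h <= d.
  by rewrite -lecR -nE; near: h; exact: dnbhs0_le.
rewrite [leRHS]ee nE lecR.
have -> : f' z - h^-1 *: (((f : R[i]^o -> R[i]^o) \o shift z) (h *: 1) - f z) =
   - (h^-1 * (f (z + h) - f z - h * f' z)).
  rewrite /= /GRing.scale /= mulr1 [h + z]addrC; field. exact: h0.
rewrite ncN ncM.
have n0 : 0 < nc h by rewrite lt_def nc_ge0 nc_eq0 h0.
have -> : nc h^-1 = (nc h)^-1 by exact: Normc.normcV.
rewrite ler_pdivrMl//; apply: le_trans (HC h _) _.
  by rewrite (le_trans hd)// ge_min lexx.
rewrite expr2 mulrCA ler_wpM2l ?nc_ge0//.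
apply: (@le_trans _ _ ((`|C| + 1) * d)).
  apply: (@le_trans _ _ ((`|C| + 1) * nc h)).
    by rewrite ler_wpM2r ?nc_ge0// (le_trans (ler_norm _))// lerDl.
  by rewrite ler_wpM2l// ltW.
by rewrite mulrC -ler_pdivlMr// ge_min lexx orbT.
Unshelve. all: by end_near. Qed.

End ComplexDerivative.

(** * Series dominated by a geometric one *)

Section FastSeries.
Context {R : realType}.
Local Notation nc := (@Normc.normc R).
Implicit Types (u v : nat -> R[i]) (a z h : R[i]).

(** Sum of a complex series; meaningful for the geometrically bounded ones. *)
Definition csum u : R[i] :=
  limn (series (fun j => complex.Re (u j))) +i* limn (series (fun j => complex.Im (u j))).

(** Domination by a geometric series of ratio one half. *)
Definition fast_with (M : R) u := forall j, nc (u j) <= M * 2^-1 ^+ j.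
Definition fast u := exists M, fast_with M u.

Lemma half_lt1 : `|2^-1| < 1 :> R.
Proof. by rewrite ger0_norm// invf_lt1// ltr1n. Qed.

Lemma fast_with_ge0 M u : fast_with M u -> 0 <= M.
Proof. by move=> /(_ 0%N); rewrite expr0 mulr1; apply: le_trans; exact: nc_ge0. Qed.

Lemma geom_series_bound (M : R) (w : nat -> R) : 0 <= M ->
  (forall j, `|w j| <= M * 2^-1 ^+ j) ->
  cvgn (series w) /\ `|limn (series w)| <= 2 * M.
Proof.
move=> M0 H.
have cg : series (geometric M 2^-1) @ \oo --> (2 * M).
  rewrite (_ : 2 * M = M * (1 - 2^-1)^-1); first exact: cvg_geometric_series half_lt1.
  by field.
have cn : cvgn [normed series w].
  by apply: series_le_cvg (cvgP _ cg) => j //=; rewrite ?mulr_ge0 ?exprn_ge0.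
split; first exact: normed_cvg cn.
apply: le_trans (lim_series_norm cn) _.
rewrite -(cvg_lim _ cg)//; apply: lim_series_le => //.
exact: cvgP cg.
Qed.

Lemma fast_cvg u : fast u ->
  cvgn (series (fun j => complex.Re (u j))) /\ cvgn (series (fun j => complex.Im (u j))).
Proof.
move=> [M H]; have M0 := fast_with_ge0 H.
split; apply: (proj1 (geom_series_bound M0 _)) => j; apply: le_trans (H j).
  exact: Re_le_nc.
exact: Im_le_nc.
Qed.

Lemma nc_csum M u : fast_with M u -> nc (csum u) <= 4 * M.
Proof.
move=> H; have M0 := fast_with_ge0 H.
have [_ h1] := geom_series_bound M0 (fun j => le_trans (Re_le_nc _) (H j)).
have [_ h2] := geom_series_bound M0 (fun j => le_trans (Im_le_nc _) (H j)).
apply: le_trans (nc_le_ReIm _) _.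
have : `|complex.Re (csum u)| <= 2 * M by exact: h1.
have : `|complex.Im (csum u)| <= 2 * M by exact: h2.
lra.
Qed.

Lemma fastZ a u : fast u -> fast (fun j => a * u j).
Proof.
by move=> [M H]; exists (nc a * M) => j; rewrite ncM -mulrA ler_wpM2l// nc_ge0.
Qed.
Lemma fastD u v : fast u -> fast v -> fast (fun j => u j + v j).
Proof.
move=> [M H] [N K]; exists (M + N) => j.
by rewrite mulrDl (le_trans (ncD _ _))// lerD.
Qed.

Lemma csumD u v : fast u -> fast v -> csum (fun j => u j + v j) = csum u + csum v.
Proof.
move=> /fast_cvg[u1 u2] /fast_cvg[v1 v2]; rewrite /csum.
rewrite (_ : (fun j => complex.Re (u j + v j)) =
  (fun j => complex.Re (u j)) + (fun j => complex.Re (v j))); last first.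
  by apply/funext => j; rewrite ReD.
rewrite (_ : (fun j => complex.Im (u j + v j)) =
  (fun j => complex.Im (u j)) + (fun j => complex.Im (v j))); last first.
  by apply/funext => j; rewrite ImD.
by rewrite !lim_seriesD.
Qed.

Lemma csumZ a u : fast u -> csum (fun j => a * u j) = a * csum u.
Proof.
move=> /fast_cvg[u1 u2]; case: a => a b; rewrite /csum.
have E1 : (fun j => complex.Re ((a +i* b) * u j)) =
    (a *: (fun j => complex.Re (u j)) - b *: (fun j => complex.Im (u j)) : R ^nat).
  by apply/funext => j; rewrite ReM.
have E2 : (fun j => complex.Im ((a +i* b) * u j)) =
    (a *: (fun j => complex.Im (u j)) + b *: (fun j => complex.Re (u j)) : R ^nat).
  by apply/funext => j; rewrite ImM.
rewrite E1 E2 lim_seriesB ?lim_seriesD; try exact: is_cvg_seriesZ.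
by rewrite !lim_seriesZ.
Qed.

Lemma csum_partial u : fast u -> forall e : R, 0 < e ->
  exists N, forall n, (N <= n)%N -> nc (csum u - \sum_(j < n) u j) <= e.
Proof.
move=> /fast_cvg[c1 c2] e e0.
have e2 : 0 < e / 2 by rewrite divr_gt0.
have /cvgrPdist_le/(_ _ e2)[N1 _ H1] := c1.
have /cvgrPdist_le/(_ _ e2)[N2 _ H2] := c2.
exists (maxn N1 N2) => n; rewrite geq_max => /andP[n1 n2].
have := H1 _ n1; have := H2 _ n2; rewrite /series /= !big_mkord => h2 h1.
apply: le_trans (nc_le_ReIm _) _; rewrite !ReIm /csum /= Re_sum Im_sum; lra.
Qed.

Lemma fast_finite u n : (forall j, (n <= j)%N -> u j = 0) -> fast u.
Proof.
move=> u0; exists (\sum_(j < n) nc (u j) * 2 ^+ j) => j.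
have [jn|nj] := ltnP j n; last first.
  rewrite u0// nc0 mulr_ge0 ?exprn_ge0// sumr_ge0// => i _.
  by rewrite mulr_ge0 ?nc_ge0// exprn_ge0.
rewrite exprVn ler_pdivlMr ?exprn_gt0// (bigD1 (Ordinal jn))//= lerDl.
by rewrite sumr_ge0// => i _; rewrite mulr_ge0 ?nc_ge0// exprn_ge0.
Qed.

Lemma csum_finite u n : (forall j, (n <= j)%N -> u j = 0) ->
  csum u = \sum_(j < n) u j.
Proof.
move=> u0; apply/eqP; rewrite -subr_eq0 -nc_eq0 eq_le nc_ge0 andbT.
apply/ler_addgt0Pl => e e0; rewrite addr0.
have [N HN] := csum_partial (fast_finite u0) e0.
have := HN _ (leq_maxl N n); congr (nc (_ - _) <= _).
rewrite [LHS](big_ord_widen_cond (maxn N n) xpredT) ?leqnn//=.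
rewrite [RHS](big_ord_widen (maxn N n)) ?leq_maxr// [RHS]big_mkcond/=.
apply: eq_big => [i|i _]; first by rewrite ltn_ord.
by case: ltnP => // /u0.
Qed.

End FastSeries.

(** * Theta series *)

Section Theta.
Context {R : realType}.
Local Notation nc := (@Normc.normc R).
Variables (kap : nat -> R) (B : R).
Hypothesis kapB : forall j, `|kap j| <= j%:R + B.
Implicit Types (d : nat -> R[i]) (z h : R[i]).

Definition freq j : R[i] := (2 * pi * kap j)%:C * 'i%C.
Definition wave j z : R[i] := cexp (freq j * z).

(** Decay faster than any geometric sequence, so that the series stays dominated
    after multiplication by the waves at any point and by powers of the frequency. *)
Definition rapid d := forall K : nat, exists M : R, forall j, nc (d j) * K%:R ^+ j <= M.

Lemma nc_wave j z : nc (wave j z) = expR (- (2 * pi * kap j * complex.Im z)).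
Proof. rewrite nc_cexp; congr expR. rewrite /freq !ReIm ?(mulr0, mul0r, mulr1, subr0, addr0). by ring. Qed.

Lemma rapid_mul (c : nat -> R[i]) d (C : R) (D : nat) : 0 <= C ->
  (forall j, nc (c j) <= C * D%:R ^+ j) -> rapid d -> rapid (fun j => c j * d j).
Proof.
move=> C0 Hc Hd K; have [M HM] := Hd (D * K)%N.
exists (C * M) => j; rewrite ncM.
apply: le_trans (_ : C * D%:R ^+ j * (nc (d j) * K%:R ^+ j) <= _).
  by rewrite -mulrA ler_wpM2r// mulr_ge0 ?nc_ge0// exprn_ge0.
by rewrite -mulrA ler_wpM2l// mulrCA -exprMn -natrM.
Qed.

Lemma kap_le2 j : `|kap j| <= (1 + `|B|) * 2%:R ^+ j.
Proof.
apply: le_trans (kapB j) _; rewrite mulrDl mul1r; apply: lerD.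
  by rewrite -natrX ler_nat ltnW// ltn_expl.
apply: (le_trans (ler_norm _)); rewrite ler_peMr// exprn_ege1// ler1n//.
Qed.

Lemma rapid_kap (c : R[i]) d : rapid d -> rapid (fun j => c * (kap j)%:C * d j).
Proof.
apply: (@rapid_mul _ _ (nc c * (1 + `|B|)) 2); first by rewrite mulr_ge0 ?nc_ge0.
by move=> j; rewrite ncM ncC -mulrA ler_wpM2l ?nc_ge0// kap_le2.
Qed.

Lemma rapid_exp d (c : R) : 0 <= c -> rapid d ->
  exists M : R, forall j, nc (d j) * expR (c * `|kap j|) <= M * 2^-1 ^+ j.
Proof.
move=> c0 Hd; pose K := (Num.truncn (2 * expR c)).+1.
have KP : 2 * expR c <= K%:R.
  by rewrite ltW// truncnS_gt.
have [M HM] := Hd K.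
exists (M * expR (c * B)) => j.
rewrite exprVn ler_pdivlMr ?exprn_gt0// -mulrA.
apply: le_trans (_ : nc (d j) * K%:R ^+ j * expR (c * B) <= _); last first.
  by rewrite ler_wpM2r ?expR_ge0.
rewrite -mulrA ler_wpM2l ?nc_ge0//.
apply: (@le_trans _ _ (expR (c * (j%:R + B)) * 2 ^+ j)).
  by rewrite ler_wpM2r ?exprn_ge0// ler_expR ler_wpM2l.
rewrite mulrDr expRD mulrAC ler_wpM2r ?expR_ge0//.
rewrite expRM_natr -exprMn; apply: lerXn2r; rewrite ?nnegrE ?mulr_ge0 ?expR_ge0//.
by rewrite mulrC.
Qed.

Definition theta d z := csum (fun j => d j * wave j z).

Lemma theta_fast d z : rapid d -> fast (fun j => d j * wave j z).
Proof.
move=> Hd; have c0 : 0 <= 2 * pi * `|complex.Im z| by rewrite !mulr_ge0// pi_ge0.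
have [M HM] := rapid_exp c0 Hd; exists M => j; apply: le_trans (HM j).
rewrite ncM nc_wave ler_wpM2l ?nc_ge0// ler_expR.
apply: le_trans (ler_norm _) _.
rewrite normrN !normrM (ger0_norm (pi_ge0 R)) (ger0_norm (_ : 0 <= 2))//.
by rewrite mulrAC.
Qed.

(** Termwise differentiation: the quadratic remainders of the waves, multiplied by
    the coefficients, are dominated by a convergent series. *)
Lemma cdiff_theta d : rapid d -> cdiff (theta d) (theta (fun j => freq j * d j)).
Proof.
move=> Hd z.
have Hd' : rapid (fun j => freq j * d j).
  have := rapid_kap ((2 * pi)%:C * 'i%C) Hd; congr rapid; apply/funext => j.
  by rewrite /freq rmorphM/=; ring.
pose c := 2 + 2 * pi * `|complex.Im z| + 2 * pi.
have p0 := pi_ge0 R.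
have c0 : 0 <= c by rewrite !addr_ge0// !mulr_ge0.
have [M HM] := rapid_exp c0 Hd.
exists (4 * (12 * pi ^+ 2 * M)) => h h1.
pose s j := freq j * h.
have F1 := theta_fast (z + h) Hd; have F2 := theta_fast z Hd.
have F3 := theta_fast z Hd'.
have -> : theta d (z + h) - theta d z - h * theta (fun j => freq j * d j) z =
    csum (fun j => d j * wave j z * (cexp (s j) - 1 - s j)).
  have -> : (fun j => d j * wave j z * (cexp (s j) - 1 - s j)) =
    (fun j => d j * wave j (z + h) + (-1 * (d j * wave j z) +
                        (- h) * (freq j * d j * wave j z))).
    apply/funext => j.
    have -> : wave j (z + h) = wave j z * cexp (s j) by rewrite /wave mulrDr cexpD.
    by rewrite /s; ring.
  rewrite !csumD ?csumZ//; [by rewrite /theta; ring|exact: fastZ|exact: fastZ|].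
  by apply: fastD; exact: fastZ.
rewrite -[4 * _ * _]mulrA; apply: nc_csum => j.
have h0 := nc_ge0 h.
have ns : nc (s j) = 2 * pi * `|kap j| * nc h.
  rewrite /s /freq !ncM nc_i mulr1 ncC !normrM (ger0_norm p0).
  by rewrite (ger0_norm (_ : 0 <= 2)).
have rs : `|complex.Re (s j)| <= 2 * pi * `|kap j|.
  apply: le_trans (Re_le_nc _) _; rewrite ns ler_piMr//.
  by rewrite !mulr_ge0.
have k2 : `|kap j| ^+ 2 <= expR (2 * `|kap j|).
  rewrite expRM_natl ler_pXn2r ?nnegrE ?expR_ge0//.
  by apply: le_trans (expR_ge1Dx _); rewrite lerDr.
have -> : 12 * pi ^+ 2 * M * nc h ^+ 2 * 2^-1 ^+ j =
   12 * pi ^+ 2 * nc h ^+ 2 * (M * 2^-1 ^+ j) by ring.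
apply: le_trans (_ : 12 * pi ^+ 2 * nc h ^+ 2 * (nc (d j) * expR (c * `|kap j|)) <= _);
  last by rewrite ler_wpM2l// ?mulr_ge0// exprn_ge0.
rewrite ncM [nc (d j * _)]ncM nc_wave.
have := cexp_rem (s j); rewrite ns => cr.
apply: (@le_trans _ _ (nc (d j) * expR (2 * pi * `|complex.Im z| * `|kap j|) *
   (3 * (2 * pi * `|kap j| * nc h) ^+ 2 * expR (2 * pi * `|kap j|)))).
  apply: ler_pM; rewrite ?mulr_ge0 ?nc_ge0 ?expR_ge0//.
    rewrite ler_wpM2l ?nc_ge0// ler_expR; apply: le_trans (ler_norm _) _.
    rewrite normrN !normrM (ger0_norm p0) (ger0_norm (_ : 0 <= 2))//.
    by rewrite mulrAC.
  apply: le_trans cr _; rewrite ler_wpM2l ?mulr_ge0 ?exprn_ge0// ?ler_expR//.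
have -> : nc (d j) * expR (2 * pi * `|complex.Im z| * `|kap j|) *
   (3 * (2 * pi * `|kap j| * nc h) ^+ 2 * expR (2 * pi * `|kap j|)) =
  12 * pi ^+ 2 * nc h ^+ 2 * (nc (d j) * (`|kap j| ^+ 2 *
   (expR (2 * pi * `|complex.Im z| * `|kap j|) * expR (2 * pi * `|kap j|)))) by ring.
rewrite ler_wpM2l ?mulr_ge0 ?exprn_ge0// ler_wpM2l ?nc_ge0//.
rewrite -expRD /c.
apply: (@le_trans _ _ (expR (2 * `|kap j|) * expR (2 * pi * `|complex.Im z| * `|kap j| + 2 * pi * `|kap j|))).
  by rewrite ler_wpM2r ?expR_ge0.
by rewrite -expRD ler_expR le_eqVlt; apply/orP; left; apply/eqP; ring.
Qed.

End Theta.

(** * Hermite functions against theta series *)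

Section HermiteTheta.
Context {R : realType}.

(** Hermite polynomials, by their three-term recurrence. *)
Fixpoint hp (m : nat) (x : R) {struct m} : R :=
  if m is m1.+1 then
    if m1 is m2.+1 then 2 * x * hp m1 x - 2 * m1%:R * hp m2 x else 2 * x
  else 1.

Lemma hpS m x : hp m.+1 x = 2 * x * hp m x - 2 * m%:R * hp m.-1 x.
Proof. by case: m => [|m] //=; ring. Qed.

Lemma is_derive_hp m (x : R) : is_derive x 1 (hp m) (2 * m%:R * hp m.-1 x).
Proof.
elim/ltn_ind: m x => -[|m] ih x.
  by rewrite mulr0 mul0r; exact: is_derive_cst.
have -> : hp m.+1 = (fun t => 2 * t * hp m t - 2 * m%:R * hp m.-1 t).
  by apply/funext => t; rewrite hpS.
have i1 := ih m (ltnSn m) x.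
have i2 := ih m.-1 (leq_ltn_trans (leq_pred m) (ltnSn m)) x.
have d1 : is_derive x 1 (fun t : R => 2 * t) 2.
  by apply: is_derive_eq; rewrite /GRing.scale /=; ring.
have d2 : is_derive x 1 (fun t : R => 2 * t * hp m t)
   (2 * x * (2 * m%:R * hp m.-1 x) + hp m x * 2).
  by apply: is_derive_eq (is_deriveM d1 i1) _.
have d3 : is_derive x 1 (fun t : R => 2 * m%:R * hp m.-1 t)
   (2 * m%:R * (2 * (m.-1)%:R * hp m.-1.-1 x)).
  by apply: is_derive_eq (is_deriveZ (2 * m%:R) i2) _.
apply: is_derive_eq (is_deriveB d2 d3) _.
case: m {ih i1 i2 d1 d2 d3} => [|m]; first by rewrite /=; ring.
rewrite [m.+1.-1]/= [m.+2.-1]/= (hpS m) -!natr1; ring.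
Qed.

(** Induction on m: the derivative of the Gaussian times the polynomial of degree
    m produces the recurrence. *)
Lemma hermiteE m x : hermite m x = hp m x.
Proof.
have D (t : R) : is_derive t 1 (fun t : R => expR (- t ^+ 2)) (- (2 * t) * expR (- t ^+ 2)).
  have d : is_derive t 1 (fun t : R => - t ^+ 2) (- (2 * t)).
    by apply: is_derive_eq; rewrite /GRing.scale /=; ring.
  by apply: is_derive_eq (is_derive1_comp (is_derive_expR _) d) _; rewrite mulrC.
have H : derive1n m (fun t : R => expR (- t ^+ 2)) =
    (fun t => (-1) ^+ m * (hp m t * expR (- t ^+ 2))).
  elim: m => [|m ih]; first by apply/funext => t /=; rewrite expr0 !mul1r.
  rewrite derive1nS ih; apply/funext => t; rewrite derive1E.
  have DD : is_derive t 1 (fun t => (-1) ^+ m * (hp m t * expR (- t ^+ 2)))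
      ((-1) ^+ m.+1 * (hp m.+1 t * expR (- t ^+ 2))).
    apply: is_derive_eq (is_deriveZ ((-1) ^+ m) (is_deriveM (is_derive_hp m t) (D t))) _.
    by rewrite hpS [(-1) ^+ m.+1]exprS /GRing.scale /=; ring.
  by rewrite derive_val.
rewrite /hermite H mulrACA -exprMn mulN1r opprK expr1n mul1r.
by rewrite mulrCA -expRD subrr expR0 mulr1.
Qed.

Variables (kap : nat -> R) (B nu : R).
Hypothesis kapB : forall j, `|kap j| <= j%:R + B.
Hypothesis nu_gt0 : 0 < nu.
Implicit Types (d : nat -> R[i]) (z : R[i]).

Let a := Num.sqrt (2 * nu).
Let b := Num.sqrt (2 / nu) * pi.

Lemma sqr_hscale : a ^+ 2 = 2 * nu.
Proof. by rewrite sqr_sqrtr// mulr_ge0// ltW. Qed.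
Lemma hscaleM : a * b = 2 * pi.
Proof.
rewrite /a /b mulrA -sqrtrM ?mulr_ge0 ?ltW//.
rewrite (_ : 2 * nu * (2 / nu) = 2 ^+ 2); last by field; exact: lt0r_neq0.
by rewrite sqrtr_sqr ger0_norm.
Qed.

Definition hterm m d z j := d j * (hp m (a * complex.Im z + b * kap j))%:C * wave kap j z.
(** A theta series whose terms carry the Hermite polynomial of their frequency;
    the series is not holomorphic for m > 0, but the recurrence reduces it to
    products of the ordinate with theta series. *)
Definition W m d z := csum (hterm m d z).

Definition shift1 d : nat -> R[i] := fun j => (2 * b)%:C * (kap j)%:C * d j.
Definition shift2 d : nat -> R[i] := fun j => freq kap j * d j.

Lemma rapid_shift1 d : rapid d -> rapid (shift1 d).
Proof. exact: rapid_kap. Qed.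
Lemma rapid_shift2 d : rapid d -> rapid (shift2 d).
Proof.
move=> Hd; have := rapid_kap kapB ((2 * pi)%:C * 'i%C) Hd.
congr rapid; apply/funext => j.
by rewrite /shift2 /freq rmorphM/=; ring.
Qed.

Lemma htermS m d z : hterm m.+1 d z = fun j =>
  (2 * a * complex.Im z)%:C * hterm m d z j +
  (hterm m (shift1 d) z j + (- (2 * m%:R))%:C * hterm m.-1 d z j).
Proof.
apply/funext => j; rewrite /hterm hpS /shift1.
move: (hp m _) (hp m.-1 _) => x y.
have -> : (2 * (a * complex.Im z + b * kap j) * x - 2 * m%:R * y)%:C =
  (2 * a * complex.Im z)%:C * x%:C + (2 * b)%:C * (kap j)%:C * x%:C
   + (- (2 * m%:R))%:C * y%:C :> R[i].
  by rewrite -!rmorphM -!rmorphD/=; congr (_%:C); ring.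
by ring.
Qed.

Lemma W_fast m d z : rapid d -> fast (hterm m d z).
Proof.
elim/ltn_ind: m d => -[|m] ih d Hd.
  have := theta_fast kapB z Hd; congr fast; apply/funext => j.
  by rewrite /hterm /= mulr1.
rewrite htermS; apply: fastD; first by apply: fastZ; exact: ih.
apply: fastD; first by apply: ih => //; exact: rapid_shift1.
by apply: fastZ; apply: ih => //; rewrite ltnS leq_pred.
Qed.

Lemma WS m d z : rapid d -> W m.+1 d z =
  (2 * a * complex.Im z)%:C * W m d z + (W m (shift1 d) z +
  (- (2 * m%:R))%:C * W m.-1 d z).
Proof.
move=> Hd; have F1 := W_fast m z Hd; have F2 := W_fast m z (rapid_shift1 Hd).
have F3 := W_fast m.-1 z Hd.
rewrite /W htermS !csumD ?csumZ//; try exact: fastZ.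
by apply: fastD => //; exact: fastZ.
Qed.

Lemma W0 d z : W 0 d z = theta kap d z.
Proof. by congr csum; apply/funext => j; rewrite /hterm /= mulr1. Qed.

Lemma WZ m (c : R[i]) d z : rapid d -> W m (fun j => c * d j) z = c * W m d z.
Proof.
move=> Hd; rewrite /W -csumZ; last exact: W_fast.
by congr csum; apply/funext => j; rewrite /hterm; ring.
Qed.

Lemma shift12 d : shift1 (shift2 d) = shift2 (shift1 d).
Proof. by apply/funext => j; rewrite /shift1 /shift2; ring. Qed.

Lemma W_pder m d : rapid d ->
  [/\ cont (W m d), pder (dirx R) (W m d) (W m (shift2 d)) &
      pder (diry R) (W m d)
        (fun z => 'i%C * W m (shift2 d) z + (2 * m%:R * a)%:C * W m.-1 d z)].
Proof.
elim/ltn_ind: m d => -[|m] ih d Hd.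
  have E d' : W 0 d' = theta kap d' by apply/funext => z; exact: W0.
  have C := cdiff_theta kapB Hd; rewrite !E; split.
  - exact: cont_cdiff C.
  - exact: pderx_cdiff C.
  - by apply: pder_eq (pdery_cdiff C) => // z; rewrite mulr0 mul0r mul0r addr0.
have Hd1 := rapid_shift1 Hd; have Hd2 := rapid_shift2 Hd.
have [c1 x1 y1] := ih m (ltnSn m) d Hd.
have [c2 x2 y2] := ih m (ltnSn m) _ Hd1.
have [c3 x3 y3] := ih m.-1 (leq_ltn_trans (leq_pred m) (ltnSn m)) d Hd.
have E d' : rapid d' -> (fun z => (2 * a * complex.Im z)%:C * W m d' z +
    (W m (shift1 d') z + (- (2 * m%:R))%:C * W m.-1 d' z)) =1 W m.+1 d'.
  by move=> Hd' z; rewrite WS.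
have lin (t : R) : is_derive t 1 (fun t => 2 * a * t) (2 * a).
  by apply: is_derive_eq; rewrite /GRing.scale /=; ring.
split.
- rewrite -(funext (E d Hd)); apply: contD.
    apply: contM => //; apply: (@cont_y R (fun t => 2 * a * t)) => t.
    by apply: cvgM; [exact: cvg_cst|exact: cvg_id].
  by apply: contD => //; apply: contM => //; exact: cont_cst.
- apply: pder_eq (E d Hd) _ (pderD (pderM (@pderx_y R (fun t => 2 * a * t)) x1)
     (pderD x2 (pderZ _ x3))) => z.
  by rewrite (WS _ _ Hd2) shift12; ring.
- apply: pder_eq (E d Hd) _ (pderD (pderM (pdery_y lin) y1)
     (pderD y2 (pderZ _ y3))) => z.
  rewrite (WS _ _ Hd2) shift12.
  have K : (2 * m%:R * a)%:C * W m d z = (2 * m%:R * a)%:C *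
     ((2 * a * complex.Im z)%:C * W m.-1 d z + (W m.-1 (shift1 d) z +
       (- (2 * m.-1%:R))%:C * W m.-1.-1 d z)).
    by case: (m) => [|n]; rewrite ?mulr0 ?mul0r ?mul0r// -WS.
  have -> : (2 * m.+1%:R * a)%:C * W m d z =
     (2 * a)%:C * W m d z + (2 * m%:R * a)%:C * W m d z :> R[i].
    by rewrite -mulrDl -rmorphD/=; congr (_%:C * _); rewrite -natr1; ring.
  rewrite K.
  rewrite !(rmorphM, rmorphN, rmorphD) /=; ring.
Qed.

Definition gaussC z : R[i] := cexp ((nu / 2)%:C * z ^+ 2).

(** The building blocks: superpositions of the functions [psi2]. *)
Definition Z m d z := gaussC z * W m d z.

(** The class to which the criterion of smoothness is applied. *)
Inductive elem : (R[i] -> R[i]) -> Prop :=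
| elem_cst c : elem (fun=> c)
| elem_id : elem id
| elem_gauss : elem gaussC
| elem_W m d : rapid d -> elem (W m d)
| elemD f g : elem f -> elem g -> elem (fun z => f z + g z)
| elemM f g : elem f -> elem g -> elem (fun z => f z * g z).

Lemma cdiff_id : cdiff (@id R[i]) (fun=> 1).
Proof.
by move=> z; exists 0 => h _; rewrite mul0r /= (_ : z + h - z - h * 1 = 0) ?nc0//; ring.
Qed.

Lemma elem_smooth f : elem f -> smooth f.
Proof.
move: f; apply: smooth_stable => f; elim=> {f}.
- move=> c; split; first exact: cont_cst.
  by exists (fun=> 0), (fun=> 0); split; [exact: pder_cst|exact: pder_cst|exact: elem_cst|exact: elem_cst].
- split; first exact: (cont_cdiff cdiff_id).
  exists (fun=> 1), (fun=> 'i%C * 1); split; [exact: (pderx_cdiff cdiff_id)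
    |exact: (pdery_cdiff cdiff_id)|exact: elem_cst|exact: elem_cst].
- have C := cdiff_gauss nu; split; first exact: cont_cdiff C.
  exists (fun z => nu%:C * z * gaussC z), (fun z => 'i%C * (nu%:C * z * gaussC z)).
  have e : elem (fun z => nu%:C * z * gaussC z).
    by apply: elemM; [apply: elemM; [exact: elem_cst|exact: elem_id]|exact: elem_gauss].
  split => //; [exact: pderx_cdiff C|exact: pdery_cdiff C|].
  by apply: elemM => //; exact: elem_cst.
- move=> m d Hd; have [c x y] := W_pder m Hd; split => //.
  exists (W m (shift2 d)), (fun z => 'i%C * W m (shift2 d) z + (2 * m%:R * a)%:C * W m.-1 d z).
  have H2 := rapid_shift2 Hd.
  split => //; first exact: elem_W.
  by apply: elemD; apply: elemM; try exact: elem_cst; exact: elem_W.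
- move=> f g ef [cf [fx [fy [hx hy ex ey]]]] eg [cg [gx [gy [kx ky fgx fgy]]]].
  split; first exact: contD.
  exists (fun z => fx z + gx z), (fun z => fy z + gy z).
  by split; [exact: pderD|exact: pderD|exact: elemD|exact: elemD].
- move=> f g ef [cf [fx [fy [hx hy ex ey]]]] eg [cg [gx [gy [kx ky fgx fgy]]]].
  split; first exact: contM.
  exists (fun z => fx z * g z + f z * gx z), (fun z => fy z * g z + f z * gy z).
  by split; [exact: pderM|exact: pderM| |]; apply: elemD; exact: elemM.
Qed.

Lemma Z_smooth m d : rapid d -> smooth (Z m d).
Proof.
by move=> Hd; apply: elem_smooth; apply: elemM; [exact: elem_gauss|exact: elem_W].
Qed.

Lemma Z_pder m d : rapid d ->
  pder (dirx R) (Z m d) (fun z => nu%:C * z * Z m d z + Z m (shift2 d) z) /\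
  pder (diry R) (Z m d) (fun z => 'i%C * (nu%:C * z * Z m d z + Z m (shift2 d) z)
      + (2 * m%:R * a)%:C * Z m.-1 d z).
Proof.
move=> Hd; have [_ x y] := W_pder m Hd; have C := cdiff_gauss nu; split.
  apply: pder_eq (pderM (pderx_cdiff C) x) => // z.
  by rewrite /Z /gaussC; ring.
apply: pder_eq (pderM (pdery_cdiff C) y) => // z.
by rewrite /Z /gaussC; ring.
Qed.

Lemma ii : 'i%C * 'i%C = -1 :> R[i].
Proof. by rewrite -expr2 sqr_i. Qed.

(** The factor depending on the frequency is annihilated, being holomorphic;
    only the Hermite polynomial is differentiated. *)
Lemma opA_Z m d : rapid d -> opA (Z m d) = fun z => 'i%C * (a * m%:R)%:C * Z m.-1 d z.
Proof.
move=> Hd; have [x y] := Z_pder m Hd; rewrite /opA (d_dzbarE x y).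
apply/funext => z; set u := nu%:C * z * Z m d z + Z m (shift2 d) z.
have -> : u + 'i%C * ('i%C * u + (2 * m%:R * a)%:C * Z m.-1 d z) =
   (1 + 'i%C * 'i%C) * u + 'i%C * (2 * m%:R * a)%:C * Z m.-1 d z by ring.
rewrite ii subrr mul0r add0r.
have -> : (2 * m%:R * a)%:C = 2 * (a * m%:R)%:C :> R[i].
  by rewrite !rmorphM/= !rmorph_nat; ring.
by field.
Qed.

(** The Hermite recurrence recombines the derivative of the Gaussian, the
    frequency and the weight into the next Hermite polynomial. *)
Lemma opAstar_Z m d : rapid d ->
  opAstar nu (Z m d) = fun z => - 'i%C * (a / 2)%:C * Z m.+1 d z.
Proof.
move=> Hd; have [x y] := Z_pder m Hd; rewrite /opAstar (d_dzE x y).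
apply/funext => z.
have Hs : shift2 d = fun j => 'i%C * (a / 2)%:C * shift1 d j.
  apply/funext => j; rewrite /shift1 /shift2 /freq.
  have -> : (2 * pi * kap j)%:C = (a / 2)%:C * (2 * b)%:C * (kap j)%:C :> R[i].
    by rewrite -!rmorphM/= -hscaleM; congr (real_complex R _); field.
  by ring.
have -> : Z m (shift2 d) z = 'i%C * (a / 2)%:C * Z m (shift1 d) z.
  by rewrite /Z Hs WZ; [ring|exact: rapid_shift1].
have -> : Z m.+1 d z = (2 * a * complex.Im z)%:C * Z m d z + (Z m (shift1 d) z +
    (- (2 * m%:R))%:C * Z m.-1 d z) by rewrite /Z (WS _ _ Hd); ring.
have -> : z^*%C = z - 2 * 'i%C * (complex.Im z)%:C.
  by apply: complex_ext; rewrite !ReIm ?(mulr0, mul0r, mulr1, subr0, addr0); ring.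
set u := nu%:C * z * Z m d z + _.
have -> : u - 'i%C * ('i%C * u + (2 * m%:R * a)%:C * Z m.-1 d z) =
   (1 - 'i%C * 'i%C) * u - 'i%C * (2 * m%:R * a)%:C * Z m.-1 d z by ring.
have nuE : nu%:C = a%:C * (a / 2)%:C :> R[i].
  by rewrite -rmorphM/= mulrA -expr2 sqr_hscale; congr (real_complex R _); field.
have aE : a%:C = 2 * (a / 2)%:C :> R[i].
  by rewrite -(rmorph_nat (real_complex R)) -rmorphM/=; congr (real_complex R _); field.
rewrite ii opprK /u nuE !(rmorphM, rmorphN, rmorph_nat) /= -?rmorph_nat.
have -> : ((2 : R)^-1)%:C = 2^-1 :> R[i] by rewrite fmorphV rmorph_nat.
by field.
Qed.

End HermiteTheta.

(** * Fubini's theorem and Gaussian majorants on the strip *)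

Section StripIntegrals.
Context {R : realType}.
Local Notation mu2 := (@lebesgue2 R).
Local Notation mu := (@lebesgue_measure R).
Local Notation S := (@strip R).
Local Notation T := (measurableTypeR R).
Implicit Types (A B : set R) (u : R * R -> R) (k : R -> R).

Lemma fubini_rect A B u : measurable (A : set T) -> measurable (B : set T) ->
  mu2.-integrable (A `*` B) (EFin \o u) ->
  (\int[mu2]_(p in A `*` B) (u p)%:E =
     \int[mu]_(x in A) \int[mu]_(y in B) (u (x, y))%:E)%E /\
  (\int[mu2]_(p in A `*` B) (u p)%:E =
     \int[mu]_(y in B) \int[mu]_(x in A) (u (x, y))%:E)%E.
Proof.
move=> mA mB iu.
have mAB : measurable (A `*` B : set (T * T)) by exact: measurableX.
set f := (EFin \o u) \_ (A `*` B).
have jf : (mu \x mu)%E.-integrable [set: T * T] f.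
  exact/(integrable_mkcond _ mAB).
have fE x y : f (x, y) = if (x \in A) && (y \in B) then (u (x, y))%:E else 0%E.
  rewrite /f patchE /=; congr (if _ then _ else _).
  by apply/idP/andP => [/set_mem[/= ? ?]|[/set_mem ? /set_mem ?]];
    [split; exact/mem_set|exact/mem_set].
split.
  rewrite [LHS]integral_mkcond -[LHS](integral12_prod_meas1 jf).
  rewrite [RHS]integral_mkcond; apply: eq_integral => x _.
  rewrite /fubini_F [RHS]patchE; case: ifPn => xA.
    rewrite [RHS]integral_mkcond; apply: eq_integral => y _.
    by rewrite fE xA /= patchE.
  by rewrite integral0_eq// => y _; rewrite fE (negbTE xA).
rewrite [LHS]integral_mkcond -[LHS](integral21_prod_meas1 jf).
rewrite [RHS]integral_mkcond; apply: eq_integral => y _.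
rewrite /fubini_G [RHS]patchE; case: ifPn => yB.
  rewrite [RHS]integral_mkcond; apply: eq_integral => x _.
  by rewrite fE yB andbT patchE.
by rewrite integral0_eq// => x _; rewrite fE (negbTE yB) andbF.
Qed.

Lemma mu01 : mu `[0, 1]%classic = 1%E.
Proof. by rewrite lebesgue_measure_itv/= lte01 oppr0 adde0. Qed.

Lemma strip_measurable : measurable (S : set (T * T)).
Proof. exact: measurable_strip. Qed.

Lemma measurable_snd_comp k : measurable_fun setT k ->
  measurable_fun setT (fun p : R * R => k p.2).
Proof. by move=> mk; apply: (measurableT_comp mk); exact: measurable_snd. Qed.

Lemma ge0_strip_y k : measurable_fun setT k -> (forall y, 0 <= k y) ->
  (\int[mu2]_(p in S) (k p.2)%:E = \int[mu]_y (k y)%:E)%E.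
Proof.
move=> mk k0; rewrite integral_mkcond.
set f := (fun p : T * T => (k p.2)%:E) \_ S.
have mf0 : measurable_fun S (fun p : T * T => (k p.2)%:E).
  by apply/measurable_EFinP; apply: measurable_funTS; exact: measurable_snd_comp.
have mf : measurable_fun [set: T * T] f.
  exact/(measurable_restrictT _ strip_measurable).
have f0 p : (0 <= f p)%E by rewrite /f patchE; case: ifP => // _; rewrite lee_fin.
have H := @fubini_tonelli2 _ _ T T R mu mu f mf f0.
apply: etrans H _; apply: eq_integral => y _.
rewrite /fubini_G -[RHS]mule1 -mu01 -integral_cst; last exact: measurable_itv.
rewrite [RHS]integral_mkcond; apply: eq_integral => x _.
rewrite /f !patchE; congr (if _ then _ else _).
by apply/idP/idP => /set_mem; [move=> [] /= ? _|move=> ?]; exact/mem_set.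
Qed.

Lemma strip_y_integrable k : mu.-integrable setT (EFin \o k) ->
  mu2.-integrable S (EFin \o (fun p => k p.2)).
Proof.
move=> /integrableP[mk ik].
have mk' : measurable_fun setT k by apply/measurable_EFinP.
apply/integrableP; split.
  by apply/measurable_EFinP; apply: measurable_funTS; exact: measurable_snd_comp.
have := @ge0_strip_y (fun y => `|k y|) _ (fun y => normr_ge0 _).
rewrite /=; move=> -> //; exact: measurableT_comp.
Qed.

(** An integrable majorant for polynomials and exponentials against Gaussians. *)
Lemma integrable_gauss (C L c : R) : 0 < c ->
  mu.-integrable setT (EFin \o (fun y => C * expR (L * `|y| - c * y ^+ 2))).
Proof.
move=> c0; have s0 : (Num.sqrt c)^-1 != 0 :> R by rewrite invr_eq0 sqrtr_eq0 -ltNge.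
have i1 := integrable_normal_pdf 0 (Num.sqrt c)^-1.
pose K := `|C| * expR (L ^+ 2 / (2 * c)) / normal_peak (Num.sqrt c)^-1.
have mf : measurable_fun setT (fun y : R => C * expR (L * `|y| - c * y ^+ 2)).
  apply: measurable_funM => //; apply: measurableT_comp => //.
  by apply: measurable_funB => //; apply: measurable_funM => //; exact: measurableT_comp.
have := integrableZl measurableT K i1; apply: le_integrable => //.
  exact/measurable_EFinP.
move=> y _ /=; rewrite lee_fin normrM (ger0_norm (expR_ge0 _)).
apply: le_trans (ler_norm _).
rewrite normal_pdfE// /K /normal_fun.
have pk := normal_peak_gt0 s0.
have Q (u w : R) : u / normal_peak (Num.sqrt c)^-1 * (normal_peak (Num.sqrt c)^-1 * w) = u * w.
  by field; exact: lt0r_neq0.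
rewrite Q -mulrA ler_wpM2l// -expRD ler_expR.
rewrite subr0 exprVn sqr_sqrtr ?(ltW c0)//.
have y2 : y ^+ 2 = `|y| ^+ 2 by rewrite real_normK ?num_real.
rewrite y2 -subr_ge0.
have -> : L ^+ 2 / (2 * c) + - `|y| ^+ 2 / (c^-1 *+ 2) - (L * `|y| - c * `|y| ^+ 2) =
   (c * `|y| - L) ^+ 2 / (2 * c).
  by rewrite -mulr_natr; field; exact: lt0r_neq0.
by rewrite divr_ge0 ?sqr_ge0// mulr_ge0// ltW.
Qed.

(** An exponential bound is enough against Gaussians, and passes more easily
    through the recurrence than a polynomial one. *)
Lemma hp_bound m : exists C : R, 0 <= C /\ forall x, `|hp m x| <= C * expR (m%:R * `|x|).
Proof.
elim/ltn_ind: m => -[|m] ih.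
  by exists 1; split=> // x; rewrite mul0r expR0 mulr1 normr1.
have [C [C0 HC]] := ih m (ltnSn m).
have [D [D0 HD]] := ih m.-1 (leq_ltn_trans (leq_pred m) (ltnSn m)).
exists (2 * C + 2 * m%:R * D); split; first by rewrite addr_ge0// !mulr_ge0.
move=> x; rewrite hpS; apply: le_trans (ler_normB _ _) _.
rewrite [leRHS]mulrDl; apply: lerD.
  have x1 : `|x| <= expR `|x| by apply: le_trans (expR_ge1Dx _); rewrite lerDr.
  rewrite !normrM (ger0_norm (ler0n _ 2)) -[m.+1%:R]natr1 [(m%:R + 1) * `|x|]mulrDl mul1r expRD.
  rewrite -!mulrA ler_wpM2l//.
  rewrite [_ * expR `|x|]mulrC mulrCA; apply: ler_pM => //.
rewrite !normrM (ger0_norm (ler0n _ _)) (ger0_norm (ler0n _ m)) -!mulrA.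
rewrite ler_wpM2l// ler_wpM2l//; apply: le_trans (HD x) _; rewrite ler_wpM2l//.
rewrite ler_expR ler_wpM2r// ler_nat.
by rewrite (leq_trans (leq_pred m)).
Qed.

End StripIntegrals.

(** * Superpositions of the functions of a Landau level *)

Section Basis.
Context {R : realType}.
Local Notation nc := (@Normc.normc R).
Variables (nu alpha : R).
Hypothesis nu_gt0 : 0 < nu.
Implicit Types (c : nat -> R[i]) (z : R[i]).

(** The integers are enumerated by the naturals, so that sums over the frequencies
    are ordinary series. *)
Definition iz (j : nat) : int := if odd j then Negz j./2 else Posz j./2.
Definition zi (n : int) : nat := match n with Posz k => k.*2 | Negz k => k.*2.+1 end.

Lemma ziK : cancel zi iz.
Proof.
by case=> k; rewrite /iz /= ?oddS odd_double /= ?uphalf_double ?doubleK.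
Qed.
Lemma izK : cancel iz zi.
Proof.
by move=> j; rewrite /iz; case: ifP => o; rewrite /= -[RHS]odd_double_half o.
Qed.

Definition kap j : R := (iz j)%:~R + alpha.

Lemma iz_norm j : `|(iz j)%:~R| <= j%:R :> R /\ j%:R <= 2 * `|(iz j)%:~R| :> R.
Proof.
have j2 : j%:R = (odd j)%:R + 2 * (j./2)%:R :> R.
  by rewrite -natrM -natrD mul2n odd_double_half.
have h0 : 0 <= (j./2)%:R :> R by [].
rewrite /iz j2; case: ifP => o.
  by rewrite NegzE mulrNz normrN -pmulrn ger0_norm// -natr1; split; rewrite /=; lra.
by rewrite -pmulrn ger0_norm//; split; rewrite /=; lra.
Qed.

Lemma kapC j : (kap j)%:C = (iz j)%:~R + alpha%:C :> R[i].
Proof. by rewrite /kap rmorphD/= rmorph_int. Qed.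

Lemma kapE j : kap j = (iz j)%:~R + alpha. Proof. by []. Qed.

Lemma kap_eq i j : (kap i == kap j) = (i == j).
Proof.
rewrite /kap (inj_eq (addIr _)) eqr_int; apply/eqP/eqP => [|->//].
by move/(can_inj izK).
Qed.

Lemma kapB j : `|kap j| <= j%:R + `|alpha|.
Proof.
by rewrite (le_trans (ler_normD _ _))// lerD2r; case: (iz_norm j).
Qed.

Lemma kap_low j : j%:R <= 2 * `|kap j| + 2 * `|alpha|.
Proof.
have [_ h] := iz_norm j; have : `|(iz j)%:~R| <= `|kap j| + `|alpha|.
  have -> : (iz j)%:~R = kap j - alpha by rewrite /kap addrK.
  exact: ler_normB.
lra.
Qed.

Definition psi_cst j : R := (2 * nu / pi) `^ (1 / 4) * expR (- (pi ^+ 2 / nu) * kap j ^+ 2).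

(** A Gaussian of the index decays faster than any geometric sequence. *)
Lemma rapid_gauss c (M : R) : (forall j, nc (c j) <= M) ->
  rapid (fun j => c j * (psi_cst j)%:C).
Proof.
move=> Hc K; have M0 : 0 <= M by apply: le_trans (Hc 0%N); exact: nc_ge0.
pose g : R := pi ^+ 2 / nu.
have g0 : 0 < g by rewrite divr_gt0// exprn_gt0// pi_gt0.
set P := (2 * nu / pi) `^ (1 / 4); have P0 : 0 <= P by exact: powR_ge0.
exists (M * (P * expR (2 * K%:R * `|alpha| + K%:R ^+ 2 / g))) => j.
rewrite ncM -mulrA; apply: ler_pM; rewrite ?nc_ge0 ?mulr_ge0 ?exprn_ge0 ?nc_ge0//.
rewrite ncC ger0_norm; last by rewrite mulr_ge0 ?expR_ge0.
rewrite /psi_cst -/P -[leLHS]mulrA ler_wpM2l//.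
apply: (@le_trans _ _ (expR (- g * kap j ^+ 2) * expR (K%:R * j%:R))).
  rewrite ler_wpM2l ?expR_ge0// expRM_natr; apply: lerXn2r; rewrite ?nnegrE ?expR_ge0//.
  by apply: le_trans (expR_ge1Dx _); rewrite lerDr.
rewrite -expRD ler_expR.
have : K%:R * j%:R <= K%:R * (2 * `|kap j| + 2 * `|alpha|) by rewrite ler_wpM2l// kap_low.
have k2 : kap j ^+ 2 = `|kap j| ^+ 2 by rewrite real_normK ?num_real.
have : 0 <= (g * `|kap j| - K%:R) ^+ 2 / g by rewrite divr_ge0 ?sqr_ge0 ?ltW.
rewrite (_ : (g * `|kap j| - K%:R) ^+ 2 / g = g * kap j ^+ 2 - 2 * K%:R * `|kap j| + K%:R ^+ 2 / g); last first.
  by rewrite k2; field; exact: lt0r_neq0.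
lra.
Qed.

Definition hermite_cst (m : nat) : R := (Num.sqrt (2 ^+ m * (m`!)%:R))^-1.
Local Notation "'a'" := (Num.sqrt (2 * nu)).
Local Notation "'b'" := (Num.sqrt (2 / nu) * pi).

(** The series of the functions [psi2] of the level m with coefficients c,
    defined for bounded c: it converges fast on the whole plane, since the
    normalizing constants decay like a Gaussian of the frequency. *)
Definition synth m c z : R[i] := (hermite_cst m)%:C * Z kap nu m (fun j => c j * (psi_cst j)%:C) z.

Lemma synthE m c z : synth m c z = (hermite_cst m)%:C * Z kap nu m (fun j => c j * (psi_cst j)%:C) z.
Proof. by []. Qed.

Definition e m j : R[i] -> R[i] := psi2 alpha nu m (iz j).

Lemma eE m j z : e m j z = (hermite_cst m)%:C * (gaussC nu z *
  ((psi_cst j)%:C * (hp m (a * complex.Im z + b * kap j))%:C * wave kap j z)).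
Proof.
rewrite /e /psi2 /psi /gaussC /psi_cst hermiteE -/(kap j) cexpD cexpC.
have -> : 2 * 'i%C * (pi * (alpha + (iz j)%:~R))%:C * z = freq kap j * z.
  rewrite /freq /kap !(rmorphM, rmorph_nat, rmorphD) /= -?rmorph_nat/=; ring.
by rewrite /wave !rmorphM/=; ring.
Qed.

Lemma synth_hterm m c z :
  synth m c z = (hermite_cst m)%:C * gaussC nu z * csum (hterm kap nu m (fun j => c j * (psi_cst j)%:C) z).
Proof. by rewrite /synth /Z mulrA. Qed.

Lemma hterm_e m c z j : (hermite_cst m)%:C * gaussC nu z *
  hterm kap nu m (fun j => c j * (psi_cst j)%:C) z j = c j * e m j z.
Proof. by rewrite eE /hterm; ring. Qed.

Lemma synth_cvg m c (M : R) z : (forall j, nc (c j) <= M) -> forall eps : R, 0 < eps ->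
  exists N, forall n, (N <= n)%N -> nc (synth m c z - \sum_(j < n) c j * e m j z) <= eps.
Proof.
move=> Hc eps e0; set K := (hermite_cst m)%:C * gaussC nu z.
have F := W_fast nu kapB m z (rapid_gauss Hc).
have k0 : 0 < nc K + 1 by rewrite ltr_wpDl// nc_ge0.
have [N HN] := csum_partial F (divr_gt0 e0 k0).
exists N => n /HN H.
have -> : synth m c z - \sum_(j < n) c j * e m j z = K *
   (csum (hterm kap nu m (fun j => c j * (psi_cst j)%:C) z) -
    \sum_(j < n) hterm kap nu m (fun j => c j * (psi_cst j)%:C) z j).
  rewrite synth_hterm -/K mulrBr mulr_sumr; congr (_ - _).
  by apply: eq_bigr => j _; rewrite hterm_e.
rewrite ncM; apply: le_trans (_ : (nc K + 1) * (eps / (nc K + 1)) <= _).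
  by apply: ler_pM; rewrite ?nc_ge0// lerDl.
by rewrite mulrC divfK// gt_eqF.
Qed.

Lemma synth_finite m c n z : (forall j, (n <= j)%N -> c j = 0) ->
  synth m c z = \sum_(j < n) c j * e m j z.
Proof.
move=> c0; rewrite synth_hterm (@csum_finite _ _ n); last first.
  by move=> j nj; rewrite /hterm c0// !mul0r.
by rewrite mulr_sumr; apply: eq_bigr => j _; rewrite hterm_e.
Qed.

Lemma e_synth m j : e m j = synth m (fun i => (i == j)%:R).
Proof.
apply/funext => z; rewrite (@synth_finite _ _ j.+1); last first.
  by move=> i ji; rewrite gtn_eqF.
rewrite big_ord_recr/= eqxx mul1r big1 ?add0r// => i _.
by rewrite ltn_eqF ?mul0r.
Qed.

Lemma delta_bound (j i : nat) : nc ((i == j)%:R : R[i]) <= 1.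
Proof. by case: (i == j); rewrite ?nc1 ?nc0. Qed.

Lemma mulCi (x : R) : x%:C * 'i%C = 0 +i* x.
Proof.
by apply: complex_ext; rewrite !ReIm ?(mulr0, mul0r, mulr1, subr0, addr0, add0r).
Qed.

Lemma cexp_int (k : int) : cexp (2 * 'i%C * (pi : R)%:C * k%:~R) = 1.
Proof.
have H1 : cexp (2 * 'i%C * (pi : R)%:C) = 1.
  have -> : 2 * 'i%C * pi%:C = (2 * pi)%:C * 'i%C :> R[i].
    by rewrite rmorphM rmorph_nat/=; ring.
  have -> : (2 : R) * pi = pi *+ 2 by rewrite -(mulr_natl pi 2).
  rewrite mulCi.
  by rewrite /cexp /= expR0 cos2pi sin2pi mul1r.
have Hn (n : nat) : cexp (2 * 'i%C * (pi : R)%:C * n%:R) = 1.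
  elim: n => [|n ih]; first by rewrite mulr0 cexp0.
  by rewrite -[n.+1%:R]natr1 mulrDr mulr1 cexpD ih H1 mulr1.
case: k => n; first by rewrite -pmulrn.
by rewrite NegzE mulrNz mulrN cexpN -pmulrn Hn invr1.
Qed.

Lemma wave_int j z (k : int) :
  wave kap j (z + k%:~R) = cexp (2 * 'i%C * (pi * alpha)%:C * k%:~R) * wave kap j z.
Proof.
rewrite /wave mulrDr cexpD mulrC; congr (_ * _).
have -> : freq kap j * k%:~R = 2 * 'i%C * pi%:C * (iz j * k)%:~R +
   2 * 'i%C * (pi * alpha)%:C * k%:~R.
  rewrite intrM /freq !rmorphM/= kapC rmorph_nat; ring.
by rewrite cexpD cexp_int mul1r.
Qed.

Lemma gaussC_int z (k : int) :
  gaussC nu (z + k%:~R) = cexp (nu%:C * (z + k%:~R / 2) * k%:~R) * gaussC nu z.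
Proof.
rewrite /gaussC -cexpD; congr cexp.
have -> : (nu / 2)%:C = nu%:C / 2 :> R[i] by rewrite fmorph_div rmorph_nat.
by field.
Qed.

Lemma synth_quasi m c (M : R) z : (forall j, nc (c j) <= M) ->
  quasi_periodic_at alpha nu (synth m c) z.
Proof.
move=> Hc k; rewrite /synth /Z gaussC_int.
set d := fun j => _.
have -> : W kap nu m d (z + k%:~R) =
    cexp (2 * 'i%C * (pi * alpha)%:C * k%:~R) * W kap nu m d z.
  rewrite /W -csumZ; last exact: (W_fast nu kapB m z (rapid_gauss Hc)).
  congr csum; apply/funext => j; rewrite /hterm wave_int !ReIm addr0; ring.
by ring.
Qed.

Lemma synth_smooth m c (M : R) : (forall j, nc (c j) <= M) -> smooth (synth m c).
Proof.
move=> Hc; have sZ := Z_smooth nu kapB m (rapid_gauss Hc).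
have s0 : smooth (fun=> 0 : R[i]).
  apply: (@smooth_stable _ (fun f => f = fun=> 0)) => // f ->; split; first exact: cont_cst.
  by exists (fun=> 0), (fun=> 0); split => //; exact: pder_cst.
by have := smooth_lin (hermite_cst m)%:C sZ s0; congr smooth; apply/funext => z; rewrite addr0.
Qed.

Lemma opAstar_scale (w : R[i]) f fx fy : pder (dirx R) f fx -> pder (diry R) f fy ->
  opAstar nu (fun z => w * f z) = fun z => w * opAstar nu f z.
Proof.
move=> hx hy; apply/funext => z; rewrite /opAstar (d_dzE hx hy).
by rewrite (d_dzE (pderZ w hx) (pderZ w hy)); field.
Qed.

Lemma opA_scale (w : R[i]) f fx fy : pder (dirx R) f fx -> pder (diry R) f fy ->
  opA (fun z => w * f z) = fun z => w * opA f z.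
Proof.
move=> hx hy; apply/funext => z; rewrite /opA (d_dzbarE hx hy).
by rewrite (d_dzbarE (pderZ w hx) (pderZ w hy)); field.
Qed.

Lemma opA_synth m c (M : R) : (forall j, nc (c j) <= M) -> opA (synth m c) =
  fun z => 'i%C * (a * m%:R)%:C * ((hermite_cst m)%:C * Z kap nu m.-1 (fun j => c j * (psi_cst j)%:C) z).
Proof.
move=> Hc; have Hd := rapid_gauss Hc; have [x y] := Z_pder nu kapB m Hd.
rewrite /synth (opA_scale _ x y) (opA_Z nu kapB _ Hd).
by apply/funext => z; ring.
Qed.

Lemma opAstar_synth m c (M : R) : (forall j, nc (c j) <= M) -> opAstar nu (synth m c) =
  fun z => - 'i%C * (a / 2)%:C * ((hermite_cst m)%:C * Z kap nu m.+1 (fun j => c j * (psi_cst j)%:C) z).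
Proof.
move=> Hc; have Hd := rapid_gauss Hc; have [x y] := Z_pder nu kapB m Hd.
rewrite /synth (opAstar_scale _ x y) (opAstar_Z kapB nu_gt0 _ Hd).
by apply/funext => z; ring.
Qed.

Lemma landau_synth m c (M : R) z : (forall j, nc (c j) <= M) ->
  landau nu (synth m c) z = nu%:C * m%:R * synth m c z.
Proof.
move=> Hc; have Hd := rapid_gauss Hc; rewrite /landau (opA_synth _ Hc).
have [x y] := Z_pder nu kapB m.-1 Hd.
rewrite (opAstar_scale _ (pderZ _ x) (pderZ _ y)) (opAstar_scale _ x y).
rewrite (opAstar_Z kapB nu_gt0 _ Hd) /synth.
case: m {x y} => [|m]; first by rewrite !mulr0 !mul0r.
rewrite [m.+1.-1]/=; move: (Z _ _ _ _ _) => w.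
have -> : nu%:C = a%:C * (a / 2)%:C :> R[i].
  by rewrite -rmorphM/= mulrA -expr2 (sqr_hscale nu_gt0); congr (real_complex R _); field.
have -> : (a * m.+1%:R)%:C = a%:C * m.+1%:R :> R[i] by rewrite rmorphM/= rmorph_nat.
move: (a%:C) ((a / 2)%:C) ((hermite_cst _)%:C) => x1 x2 x3.
have -> : 'i%C * (x1 * m.+1%:R) * (x3 * (- 'i%C * x2 * w)) =
  - ('i%C * 'i%C) * (x1 * x2 * m.+1%:R * (x3 * w)) by ring.
by rewrite ii opprK mul1r.
Qed.

(** Each application of the creation operator raises the level by one; the
    constants telescope to the one of the statement. *)
Lemma opT_synth m c (M : R) : (forall j, nc (c j) <= M) ->
  opT nu m (synth 0 c) = synth m c.
Proof.
move=> Hc; have Hd := rapid_gauss Hc.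
have E n : iter n (fun g w => 'i%C * opAstar nu g w) (synth 0 c) =
   fun z => ((a / 2) ^+ n)%:C * Z kap nu n (fun j => c j * (psi_cst j)%:C) z.
  elim: n => [|n ih].
    apply/funext => z; rewrite /= /synth /hermite_cst expr0 fact0 mul1r sqrtr1 invr1.
    by rewrite !mul1r.
  rewrite iterS ih; apply/funext => z.
  have [x y] := Z_pder nu kapB n Hd.
  rewrite (opAstar_scale _ x y) (opAstar_Z kapB nu_gt0 _ Hd) exprS [((a / 2) * (a / 2) ^+ n)%:C]rmorphM/=.
  move: (Z _ _ _ _ _) ((a / 2)%:C) (((a / 2) ^+ n)%:C) => w x1 x2.
  have -> : 'i%C * (x2 * (- 'i%C * x1 * w)) = - ('i%C * 'i%C) * (x1 * x2 * w) by ring.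
  by rewrite ii opprK mul1r.
apply/funext => z; rewrite /opT E /synth mulrA -rmorphM/=; congr (_%:C * _).
have f0 : 0 < (m`!)%:R :> R by rewrite ltr0n fact_gt0.
have p1 : 0 < nu ^+ m * (m`!)%:R by rewrite mulr_gt0// exprn_gt0.
have p2 : 0 < 2 ^+ m * (m`!)%:R :> R by rewrite mulr_gt0// exprn_gt0.
have l0 : 0 <= (Num.sqrt (nu ^+ m * (m`!)%:R))^-1 * (a / 2) ^+ m.
  by rewrite mulr_ge0 ?invr_ge0 ?exprn_ge0 ?divr_ge0.
have r0 : 0 <= hermite_cst m by rewrite /hermite_cst invr_ge0.
apply/eqP; rewrite -(@eqrXn2 _ 2 _ _ isT l0 r0).
rewrite /hermite_cst exprMn !exprVn !sqr_sqrtr ?(ltW p1) ?(ltW p2)//.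
rewrite -exprM mulnC exprM expr_div_n (sqr_hscale nu_gt0).
have -> : 2 * nu / 2 ^+ 2 = nu / 2 by field.
rewrite expr_div_n; apply/eqP; field.
by rewrite !lt0r_neq0 ?exprn_gt0.
Qed.

Definition xi j (y : R) : R := a * y + b * kap j.

(** The weight completes the square in the modulus of the Gaussian and the wave,
    and leaves exp (- xi ^ 2): integrals over the strip reduce to integrals of
    Hermite functions in one variable. *)
Lemma sqw_e m j p : sqw nu (e m j) p =
  hermite_cst m ^+ 2 * Num.sqrt (2 * nu / pi) * hp m (xi j p.2) ^+ 2 * expR (- xi j p.2 ^+ 2).
Proof.
have M3 (u v w x y : R[i]) : sqc (u * (v * (w * x * y))) =
    sqc u * (sqc v * (sqc w * sqc x * sqc y)) by rewrite !sqcM.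
rewrite /sqw eE /xi M3 !sqcC /gaussC /wave !sqc_cexp /psi_cst exprMn.
have -> : ((2 * nu / pi) `^ (1 / 4)) ^+ 2 = Num.sqrt (2 * nu / pi).
  rewrite -powR_mulrn ?powR_ge0// -powRrM -powR12_sqrt; last first.
    by rewrite divr_ge0 ?pi_ge0// mulr_ge0// ltW.
  by congr (_ `^ _); field.
case: p => x y /=; set s := Num.sqrt (2 * nu / pi); set h := hp _ _.
have -> : forall A B C D E : R, A * (B * (s * expR C ^+ 2 * h ^+ 2 * D)) * E =
   A * s * h ^+ 2 * (B * expR C ^+ 2 * D * E) by move=> *; ring.
congr (_ * _); rewrite -expRM_natl /wt -!expRD; congr expR.
rewrite /sqc /=.
have a2 := sqr_hscale nu_gt0; have ab := hscaleM nu_gt0.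
have b2 : b ^+ 2 = 2 * pi ^+ 2 / nu.
  rewrite exprMn sqr_sqrtr ?divr_ge0 ?ltW//; field; exact: lt0r_neq0.
have -> : (a * y + b * kap j) ^+ 2 = a ^+ 2 * y ^+ 2 + 2 * (a * b) * y * kap j + b ^+ 2 * kap j ^+ 2 by ring.
rewrite a2 ab b2; field; exact: lt0r_neq0.
Qed.

Lemma sqw_e_bound m j : exists C L : R, 0 <= C /\
  forall p, sqw nu (e m j) p <= C * expR (L * `|p.2| - nu * p.2 ^+ 2).
Proof.
have [C [C0 HC]] := hp_bound (R := R) m.
set s := Num.sqrt (2 * nu / pi).
have s0 : 0 <= hermite_cst m ^+ 2 * s by rewrite mulr_ge0 ?sqr_ge0// sqrtr_ge0.
pose B := b * kap j.
exists (hermite_cst m ^+ 2 * s * (C ^+ 2 * expR (2 * m%:R * `|B| + B ^+ 2))), (2 * m%:R * a).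
split; first by rewrite mulr_ge0// mulr_ge0 ?sqr_ge0 ?expR_ge0.
move=> [x y]; rewrite sqw_e -/s -[leLHS]mulrA -[leRHS]mulrA /=; apply: ler_wpM2l => //.
have h2 : hp m (xi j y) ^+ 2 <= C ^+ 2 * expR (2 * m%:R * `|xi j y|).
  rewrite -real_normK ?num_real// -mulrA (expRM_natl 2) -exprMn.
  by apply: lerXn2r; rewrite ?nnegrE ?mulr_ge0 ?expR_ge0.
apply: (@le_trans _ _ (C ^+ 2 * expR (2 * m%:R * `|xi j y|) * expR (- xi j y ^+ 2))).
  by rewrite ler_wpM2r ?expR_ge0.
rewrite -[leLHS]mulrA -[leRHS]mulrA ler_wpM2l ?sqr_ge0// -!expRD ler_expR.
have x1 : `|xi j y| <= a * `|y| + `|B|.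
  by apply: le_trans (ler_normD _ _) _; rewrite normrM (ger0_norm (sqrtr_ge0 _)).
have : 2 * m%:R * `|xi j y| <= 2 * m%:R * (a * `|y| + `|B|) by rewrite ler_wpM2l// mulr_ge0.
have := sqr_ge0 (a * y + 2 * B).
have -> : xi j y ^+ 2 = a ^+ 2 * y ^+ 2 + 2 * (a * y) * B + B ^+ 2 by rewrite /xi -/B; ring.
have -> : (a * y + 2 * B) ^+ 2 = a ^+ 2 * y ^+ 2 + 4 * (a * y) * B + 4 * B ^+ 2 by ring.
rewrite (sqr_hscale nu_gt0); lra.
Qed.

End Basis.

(** * Integrals over rectangles *)

Section PlaneIntegration.
Context {R : realType}.
Local Notation mu2 := (@lebesgue2 R).
Local Notation mu := (@lebesgue_measure R).
Local Notation T := (measurableTypeR R).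
Implicit Types (u w : R * R -> R).

(** Open sets of the plane are countable unions of rational rectangles, so Borel
    sets and the product of the Borel sets agree where it is needed. *)
Lemma open_measurable2 (U : set (R * R)) : open U -> measurable (U : set (T * T)).
Proof.
move=> oU.
pose box (a b c d : rat) : set (T * T) :=
  `]ratr a, ratr b[%classic `*` `]ratr c, ratr d[%classic.
pose F a b c d : set (T * T) := if `[< box a b c d `<=` U >] then box a b c d else set0.
have -> : U = \bigcup_a \bigcup_b \bigcup_c \bigcup_d F a b c d.
  apply/seteqP; split => [p Up|p [a _ [b _ [c _ [d _]]]]]; last first.
    by rewrite /F; case: asboolP => // sub /sub.
  have /nbhs_ballP[e /= e0 He] : nbhs p U by apply: open_nbhs_nbhs; split.
  have dn (x : R) : exists a, ratr a \in `]x - e, x[.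
    by apply: rat_in_itvoo; rewrite ltrBlDr ltrDl.
  have up (x : R) : exists a, ratr a \in `]x, x + e[.
    by apply: rat_in_itvoo; rewrite ltrDl.
  have [a Ha] := dn p.1; have [b Hb] := up p.1.
  have [c Hc] := dn p.2; have [d Hd] := up p.2.
  exists a => //; exists b => //; exists c => //; exists d => //.
  move: Ha Hb Hc Hd; rewrite !in_itv /= => /andP[a1 a2] /andP[b1 b2] /andP[c1 c2] /andP[d1 d2].
  rewrite /F; case: asboolP => [_|]; first by split; rewrite /= in_itv/= ?a2 ?b1 ?c2 ?d1.
  move=> H; exfalso; apply: H => q [] /=; rewrite !in_itv/= => /andP[q1 q2] /andP[q3 q4].
  by apply: He; split; rewrite /ball/= ltr_norml; apply/andP; split; lra.
apply: bigcupT_measurable_rat => a; apply: bigcupT_measurable_rat => b.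
apply: bigcupT_measurable_rat => c; apply: bigcupT_measurable_rat => d.
rewrite /F; case: asboolP => _; last exact: measurable0.
by apply: measurableX; exact: measurable_itv.
Qed.

Lemma continuous_measurable2 u : continuous u -> measurable_fun setT u.
Proof.
move=> cu; apply: (measurability _ (RGenOInfty.measurableE R)).
move=> _ [_ [x ->] <-]; rewrite setTI.
apply: open_measurable2; apply: open_comp => [p _|]; first exact: cu.
exact: interval_open.
Qed.

Lemma cont_measurable_plane (f : R[i] -> R[i]) : cont f -> measurable_plane f.
Proof. by move=> [c1 c2]; split; exact: continuous_measurable2. Qed.

Definition rect (r : R) : set (R * R) := `[0, 1]%classic `*` `[- r, r]%classic.

Lemma measurable_rect r : measurable (rect r : set (T * T)).
Proof. by apply: measurableX; exact: measurable_itv. Qed.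

Lemma integrable_rect r u : continuous u -> mu2.-integrable (rect r) (EFin \o u).
Proof.
move=> cu; apply: measurable_bounded_integrable.
- exact: measurable_rect.
- have E : mu2 (rect r) = (mu `[0%R, 1%R]%classic * mu `[(- r)%R, r]%classic)%E.
    by apply: product_measure1E; exact: measurable_itv.
  rewrite -[X in (X < _)%E]/(mu2 (rect r)) E mu01 mul1e lebesgue_measure_itv/=; case: ifP => _; last by rewrite ltry.
  by rewrite -EFinD ltry.
- by apply: measurable_funTS; exact: continuous_measurable2.
- have cr : compact (rect r) by apply: compact_setX; exact: segment_compact.
  have := compact_bounded (continuous_compact (continuous_subspaceT cu) cr).
  rewrite /bounded_set /= => -[M [real_multiplier HM]]; exists M; split => // x /HM H p pr.
  by apply: H; exists p.
Qed.

Lemma FTC_line (F f : R -> R) (a b : R) : a < b -> (forall t : R, is_derive t 1 F (f t)) ->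
  continuous f -> (\int[mu]_(t in `[a, b]) (f t)%:E = (F b)%:E - (F a)%:E)%E.
Proof.
move=> ab dF cf; apply: continuous_FTC2 => //.
- exact: continuous_subspaceT.
- have cF : continuous F.
    move=> t; have [d _] := dF t; apply/differentiable_continuous.
    exact/derivable1_diffP.
  split.
  + by move=> t _; have [] := dF t.
  + apply: cvg_at_right_filter; exact: cF.
  + apply: cvg_at_left_filter; exact: cF.
- by move=> t _; rewrite derive1E; have [_ ->] := dF t.
Qed.

(** Fubini's theorem, and the fundamental theorem of calculus along the lines
    of differentiation. *)
Lemma integral_rect_dy0 r w wy : 0 < r ->
  (forall p, is_derive p (diry R) w (wy p)) -> continuous wy ->
  (forall x, w (x, r) = w (x, - r)) ->
  \int[mu2]_(p in rect r) wy p = 0.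
Proof.
move=> r0 dw cw wr.
have [H _] := fubini_rect (measurable_itv _) (measurable_itv _) (integrable_rect r cw).
rewrite /Rintegral /rect H integral0_eq// => x _.
have rr : - r < r by rewrite gtrN.
have D (t : R) : is_derive t 1 (fun t => w (x, t)) (wy (x, t)).
  by apply/(@is_derive_diry _ w (x, t)); exact: dw.
have C : continuous (fun t => wy (x, t)).
  move=> t; apply: (@continuous_comp _ _ _ (fun s => (x, s)) wy); last exact: cw.
  exact: (cvg_pair (cvg_cst x) cvg_id).
by rewrite (FTC_line rr D C) wr -EFinB subrr.
Qed.

Lemma integral_rect_dx0 r w wx :
  (forall p, is_derive p (dirx R) w (wx p)) -> continuous wx ->
  (forall y, w (1, y) = w (0, y)) ->
  \int[mu2]_(p in rect r) wx p = 0.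
Proof.
move=> dw cw wr.
have [_ H] := fubini_rect (measurable_itv _) (measurable_itv _) (integrable_rect r cw).
rewrite /Rintegral /rect H integral0_eq// => y _.
have D (t : R) : is_derive t 1 (fun t => w (t, y)) (wx (t, y)).
  by apply/(@is_derive_dirx _ w (t, y)); exact: dw.
have C : continuous (fun t => wx (t, y)).
  move=> t; apply: (@continuous_comp _ _ _ (fun s => (s, y)) wx); last exact: cw.
  exact: (cvg_pair cvg_id (cvg_cst y)).
by rewrite (FTC_line ltr01 D C) wr -EFinB subrr.
Qed.

Definition cint (D : set (R * R)) (h : R[i] -> R[i]) : R[i] :=
  (\int[mu2]_(p in D) rpart h p) +i* (\int[mu2]_(p in D) ipart h p).

Definition cintegrable (D : set (R * R)) (h : R[i] -> R[i]) :=
  mu2.-integrable D (EFin \o rpart h) /\ mu2.-integrable D (EFin \o ipart h).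

Lemma cintegrable_rect r h : cont h -> cintegrable (rect r) h.
Proof. by move=> [c1 c2]; split; exact: integrable_rect. Qed.

Lemma cint_lin (D : set (R * R)) (a : R[i]) f g : measurable (D : set (T * T)) ->
  cintegrable D f -> cintegrable D g ->
  cint D (fun z => a * f z + g z) = a * cint D f + cint D g.
Proof.
move=> mD [f1 f2] [g1 g2].
have iZ c u : mu2.-integrable D (EFin \o u) -> mu2.-integrable D (EFin \o (fun p => c * u p)).
  by move=> iu; have := integrableZl mD c iu.
have iD u v : mu2.-integrable D (EFin \o u) -> mu2.-integrable D (EFin \o v) ->
    mu2.-integrable D (EFin \o (fun p => u p + v p)).
  by move=> iu iv; have := integrableD mD iu iv.
have Er : rpart (fun z => a * f z + g z) = fun p =>
    complex.Re a * rpart f p + - complex.Im a * ipart f p + rpart g p.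
  by apply/funext => p; rewrite /rpart /ipart !ReIm; ring.
have Ei : ipart (fun z => a * f z + g z) = fun p =>
    complex.Re a * ipart f p + complex.Im a * rpart f p + ipart g p.
  by apply/funext => p; rewrite /rpart /ipart !ReIm; ring.
rewrite /cint Er Ei.
rewrite RintegralD//; last by apply: iD; apply: iZ.
rewrite RintegralD ?RintegralZl//; [|exact: iZ|exact: iZ].
rewrite RintegralD//; last by apply: iD; apply: iZ.
rewrite RintegralD ?RintegralZl//; [|exact: iZ|exact: iZ].
move: (Rintegral _ _ _) (Rintegral _ _ _) (Rintegral _ _ _) (Rintegral _ _ _).
by move=> x1 x2 x3 x4; case: a {Er Ei} => a1 a2; apply: complex_ext => /=; ring.
Qed.

Lemma cintegrable_lin (D : set (R * R)) (a : R[i]) f g : measurable (D : set (T * T)) ->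
  cintegrable D f -> cintegrable D g -> cintegrable D (fun z => a * f z + g z).
Proof.
move=> mD [f1 f2] [g1 g2].
have iZ s u : mu2.-integrable D (EFin \o u) -> mu2.-integrable D (EFin \o (fun p => s * u p)).
  by move=> iu; have := integrableZl mD s iu.
have iD u v : mu2.-integrable D (EFin \o u) -> mu2.-integrable D (EFin \o v) ->
    mu2.-integrable D (EFin \o (fun p => u p + v p)).
  by move=> iu iv; have := integrableD mD iu iv.
have ER : rpart (fun z => a * f z + g z) = fun p =>
    (complex.Re a * rpart f p + - complex.Im a * ipart f p) + rpart g p.
  by apply/funext => p; rewrite /rpart /ipart !ReIm; ring.
have EI : ipart (fun z => a * f z + g z) = fun p =>
    (complex.Re a * ipart f p + complex.Im a * rpart f p) + ipart g p.
  by apply/funext => p; rewrite /rpart /ipart !ReIm; ring.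
by split; rewrite ?ER ?EI; apply: (iD _ _ _ _) => //; apply: (iD _ _ _ _); exact: iZ.
Qed.

Lemma cint0 (D : set (R * R)) : cint D (fun=> 0) = 0.
Proof. by rewrite /cint /rpart /ipart /Rintegral !integral0. Qed.

Lemma eq_cint (D : set (R * R)) f g : f =1 g -> cint D f = cint D g.
Proof. by move=> /funext ->. Qed.

Lemma cint_rect_dy0 (r : R) (w wy : R[i] -> R[i]) : 0 < r -> pder (diry R) w wy -> cont wy ->
  (forall x : R, w (x +i* r) = w (x +i* (- r))) -> cint (rect r) wy = 0.
Proof.
move=> r0 dw [c1 c2] wr; rewrite /cint.
have D1 p : is_derive p (diry R) (rpart w) (rpart wy p) by have [] := dw p.
have D2 p : is_derive p (diry R) (ipart w) (ipart wy p) by have [] := dw p.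
rewrite (integral_rect_dy0 r0 D1 c1) ?(integral_rect_dy0 r0 D2 c2)// => x.
  by rewrite /ipart /toC /= wr.
by rewrite /rpart /toC /= wr.
Qed.

Lemma cint_rect_dx0 (r : R) (w wx : R[i] -> R[i]) : pder (dirx R) w wx -> cont wx ->
  (forall y : R, w (1 +i* y) = w (0 +i* y)) -> cint (rect r) wx = 0.
Proof.
move=> dw [c1 c2] wr; rewrite /cint.
have D1 p : is_derive p (dirx R) (rpart w) (rpart wx p) by have [] := dw p.
have D2 p : is_derive p (dirx R) (ipart w) (ipart wx p) by have [] := dw p.
rewrite (integral_rect_dx0 r D1 c1) ?(integral_rect_dx0 r D2 c2)// => x.
  by rewrite /ipart /toC /= wr.
by rewrite /rpart /toC /= wr.
Qed.

End PlaneIntegration.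

(** * Adjointness of the two operators on rectangles *)

Section Adjoint.
Context {R : realType}.
Local Notation nc := (@Normc.normc R).
Local Notation mu2 := (@lebesgue2 R).
Local Notation T := (measurableTypeR R).
Variables (nu alpha : R).
Implicit Types (f g h : R[i] -> R[i]) (z : R[i]) (u : R * R -> R).

Lemma JM (x y : R[i]) : (x * y)^*%C = x^*%C * y^*%C. Proof. by rewrite rmorphM. Qed.
Lemma JD (x y : R[i]) : (x + y)^*%C = x^*%C + y^*%C. Proof. by rewrite rmorphD. Qed.
Lemma JN (x : R[i]) : (- x)^*%C = - x^*%C. Proof. by rewrite rmorphN. Qed.
Lemma JC (x : R) : (x%:C : R[i])^*%C = x%:C. Proof. exact: conjc_real. Qed.
Lemma Ji : ('i%C : R[i])^*%C = - 'i%C.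
Proof. by apply: complex_ext; rewrite !ReIm ?oppr0. Qed.
Lemma Jhalf (x : R[i]) : (x / 2)^*%C = x^*%C / 2.
Proof.
have -> : (2^-1 : R[i]) = (2^-1 : R)%:C by rewrite fmorphV rmorph_nat.
by rewrite JM JC.
Qed.

(** One continuous derivative is what the integrations by parts need. *)
Definition C1 f : Prop := [/\ cont f, pder (dirx R) f (partialx f),
  pder (diry R) f (partialy f), cont (partialx f) & cont (partialy f)].

Lemma C1_intro f fx fy : cont f -> pder (dirx R) f fx -> pder (diry R) f fy ->
  cont fx -> cont fy -> C1 f.
Proof.
by move=> cf hx hy cx cy; split; rewrite ?(pder_partialx hx) ?(pder_partialy hy).
Qed.

Lemma C1_smooth f : smooth f -> C1 f.
Proof.
move=> /smooth_pder[cf hx hy /smooth_pder[cx _ _ _ _] /smooth_pder[cy _ _ _ _]].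
by split.
Qed.

Lemma C1_cst (c : R[i]) : C1 (fun=> c).
Proof.
apply: (C1_intro (cont_cst c) (pder_cst _ c) (pder_cst _ c)); exact: cont_cst.
Qed.

Lemma C1D f g : C1 f -> C1 g -> C1 (fun z => f z + g z).
Proof.
move=> [cf fx fy cfx cfy] [cg gx gy cgx cgy].
by apply: (C1_intro (contD cf cg) (pderD fx gx) (pderD fy gy)); exact: contD.
Qed.

Lemma C1M f g : C1 f -> C1 g -> C1 (fun z => f z * g z).
Proof.
move=> [cf fx fy cfx cfy] [cg gx gy cgx cgy].
by apply: (C1_intro (contM cf cg) (pderM fx gx) (pderM fy gy));
  apply: contD; exact: contM.
Qed.

Lemma C1_y (t t' : R -> R) : (forall s : R, is_derive s 1 t (t' s)) -> continuous t' ->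
  C1 (fun z => (t (complex.Im z))%:C).
Proof.
move=> dt ct'.
have ct : continuous t.
  by move=> s; apply/differentiable_continuous/derivable1_diffP; have [] := dt s.
apply: (C1_intro (cont_y ct) (pderx_y t) (pdery_y dt)); first exact: cont_cst.
exact: cont_y.
Qed.

Lemma opA_C1 f : opA f = fun z => (partialx f z + 'i%C * partialy f z) / 2.
Proof. by []. Qed.

Lemma opA_smooth f : smooth f -> smooth (opA f).
Proof.
move=> sf; have [_ _ _ sx sy] := smooth_pder sf.
have s0 : smooth (fun=> 0 : R[i]).
  apply: (@smooth_stable _ (fun f => f = fun=> 0)) => // h ->; split; first exact: cont_cst.
  by exists (fun=> 0), (fun=> 0); split => //; exact: pder_cst.
have := smooth_lin 2^-1 (smooth_lin 'i%C sy sx) s0; congr smooth.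
by apply/funext => z; rewrite opA_C1; ring.
Qed.

Lemma opAD f g : C1 f -> C1 g -> opA (fun z => f z + g z) = fun z => opA f z + opA g z.
Proof.
move=> [_ fx fy _ _] [_ gx gy _ _]; apply/funext => z.
by rewrite /opA (d_dzbarE (pderD fx gx) (pderD fy gy)) (d_dzbarE fx fy) (d_dzbarE gx gy); field.
Qed.

Lemma opAstarD f g : C1 f -> C1 g ->
  opAstar nu (fun z => f z + g z) = fun z => opAstar nu f z + opAstar nu g z.
Proof.
move=> [_ fx fy _ _] [_ gx gy _ _]; apply/funext => z.
by rewrite /opAstar (d_dzE (pderD fx gx) (pderD fy gy)) (d_dzE fx fy) (d_dzE gx gy); field.
Qed.

Lemma opAstarZ (w : R[i]) f : C1 f ->
  opAstar nu (fun z => w * f z) = fun z => w * opAstar nu f z.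
Proof. by move=> [_ fx fy _ _]; exact: opAstar_scale fx fy. Qed.

Lemma opA_y (t t' : R -> R) g : (forall s : R, is_derive s 1 t (t' s)) -> C1 g ->
  opA (fun z => (t (complex.Im z))%:C * g z) =
  fun z => (t (complex.Im z))%:C * opA g z + 'i%C / 2 * ((t' (complex.Im z))%:C * g z).
Proof.
move=> dt [_ gx gy _ _]; apply/funext => z.
rewrite /opA (d_dzbarE (pderM (pderx_y t) gx) (pderM (pdery_y dt) gy)).
by rewrite (d_dzbarE gx gy); field.
Qed.

Lemma opAstar_y (t t' : R -> R) g : (forall s : R, is_derive s 1 t (t' s)) -> C1 g ->
  opAstar nu (fun z => (t (complex.Im z))%:C * g z) =
  fun z => (t (complex.Im z))%:C * opAstar nu g z + 'i%C / 2 * ((t' (complex.Im z))%:C * g z).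
Proof.
move=> dt [_ gx gy _ _]; apply/funext => z.
rewrite /opAstar (d_dzE (pderM (pderx_y t) gx) (pderM (pdery_y dt) gy)).
by rewrite (d_dzE gx gy); field.
Qed.

(** The multiplier of the unit translation. *)
Definition muq z : R[i] := cexp (2 * 'i%C * (pi * alpha)%:C) * cexp (nu%:C * (z + 2^-1)).
Definition qp1 f := forall z, f (z + 1) = muq z * f z.

Lemma quasi_qp1 f : (forall z, quasi_periodic_at alpha nu f z) -> qp1 f.
Proof. by move=> H z; have := H z 1; rewrite !mulr1z !mulr1 mul1r. Qed.

Lemma pder_shift v f f' : pder v f f' -> pder v (fun z => f (z + 1)) (fun z => f' (z + 1)).
Proof.
move=> H p; have := H (p + dirx R).
have E q : toC q + 1 = toC (q + dirx R) :> R[i].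
  by case: q => x y; apply: complex_ext; rewrite !ReIm /= ?addr0.
have sh u l : is_derive (p + dirx R) v u l -> is_derive p v (fun q => u (q + dirx R)) l.
  have D : (fun h : R => h^-1 *: ((u \o shift (p + dirx R)) (h *: v) - u (p + dirx R))) =
      (fun h : R => h^-1 *: (((fun q => u (q + dirx R)) \o shift p) (h *: v) - u (p + dirx R))).
    by apply/funext => k; rewrite /= addrA.
  by move=> [d vl]; split; move: d vl; rewrite /derivable /derive D.
have Er g : rpart (fun z => g (z + 1)) = fun q => rpart g (q + dirx R).
  by apply/funext => q; rewrite /rpart E.
have Ei g : ipart (fun z => g (z + 1)) = fun q => ipart g (q + dirx R).
  by apply/funext => q; rewrite /ipart E.
by move=> [/sh h1 /sh h2]; rewrite !Er !Ei.
Qed.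

Lemma cdiff_muq : cdiff muq (fun z => nu%:C * muq z).
Proof.
move=> z; set E := muq z.
exists (nc E * (3 * `|nu| ^+ 2 * expR `|nu|)) => h h1.
have -> : muq (z + h) = E * cexp (nu%:C * h).
  rewrite /E /muq (_ : nu%:C * (z + h + 2^-1) = nu%:C * (z + 2^-1) + nu%:C * h); last ring.
  by rewrite cexpD mulrA.
have -> : E * cexp (nu%:C * h) - E - h * (nu%:C * E) =
    E * (cexp (nu%:C * h) - 1 - nu%:C * h) by ring.
rewrite ncM -[leRHS]mulrA ler_wpM2l ?nc_ge0//.
apply: le_trans (cexp_rem _) _; rewrite ncM ncC exprMn.
have h0 := nc_ge0 h.
have -> : 3 * `|nu| ^+ 2 * expR `|nu| * nc h ^+ 2 =
  3 * (`|nu| ^+ 2 * nc h ^+ 2) * expR `|nu| by ring.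
rewrite ler_wpM2l ?mulr_ge0 ?exprn_ge0// ler_expR.
apply: le_trans (Re_le_nc _) _; rewrite ncM ncC ler_piMr//.
Qed.

Lemma qp1_opA f : C1 f -> qp1 f -> qp1 (opA f).
Proof.
move=> [_ fx fy _ _] qf z.
have E : (fun z => f (z + 1)) = fun z => muq z * f z by apply/funext => w; exact: qf.
have sx := pder_shift fx; have sy := pder_shift fy.
have mx := pderM (pderx_cdiff cdiff_muq) fx; have my := pderM (pdery_cdiff cdiff_muq) fy.
rewrite E in sx sy.
have := pder_partialx sx; rewrite (pder_partialx mx) => /(congr1 (fun F => F z)) X.
have := pder_partialy sy; rewrite (pder_partialy my) => /(congr1 (fun F => F z)) Y.
rewrite !opA_C1 -X -Y.
have -> : 'i%C * ('i%C * (nu%:C * muq z) * f z + muq z * partialy f z) =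
  ('i%C * 'i%C) * (nu%:C * muq z * f z) + 'i%C * (muq z * partialy f z) by ring.
by rewrite ii; field.
Qed.

Lemma qp1_y (t : R -> R) g : qp1 g -> qp1 (fun z => (t (complex.Im z))%:C * g z).
Proof. by move=> qg z; rewrite qg ReIm addr0; ring. Qed.
Definition wtC z : R[i] := (wt nu (ofC z))%:C.

(** The weight compensates the multiplier: products of two quasi-periodic
    functions with the weight are genuinely periodic in the abscissa. *)
Lemma wtC_qp z : muq z * (muq z)^*%C * wtC (z + 1) = wtC z.
Proof.
have E1 : complex.Re (2 * 'i%C * (pi * alpha)%:C : R[i]) = 0.
  have -> : 2 * 'i%C * (pi * alpha)%:C = (2 * (pi * alpha))%:C * 'i%C :> R[i].
    by rewrite [(2 * _)%:C]rmorphM rmorph_nat; ring.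
  by rewrite mulCi.
have E2 : complex.Re (nu%:C * (z + 2^-1)) = nu * (complex.Re z + 2^-1).
  have -> : (2^-1 : R[i]) = (2^-1 : R)%:C by rewrite fmorphV rmorph_nat.
  by rewrite ReM ReD !ReC ImC mul0r subr0.
rewrite mulcJ /muq sqcM !sqc_cexp E1 E2 /wtC /wt !ofCK -rmorphM -!expRD.
suff -> : 2 * 0 + 2 * (nu * (complex.Re z + 2^-1)) + - (nu * sqc (z + 1)) = - (nu * sqc z) by [].
by case: z {E2} => x y; rewrite /sqc /=; field.
Qed.

Lemma pder_wtC : pder (dirx R) wtC (fun z => (- (2 * nu * complex.Re z))%:C * wtC z) /\
  pder (diry R) wtC (fun z => (- (2 * nu * complex.Im z))%:C * wtC z).
Proof.
have D (c s : R) : is_derive s 1 (fun t : R => expR (- (nu * (t ^+ 2 + c))))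
    (- (2 * nu * s) * expR (- (nu * (s ^+ 2 + c)))).
  have d : is_derive s 1 (fun t : R => - (nu * (t ^+ 2 + c))) (- (2 * nu * s)).
    by apply: is_derive_eq; rewrite /GRing.scale /=; ring.
  by apply: is_derive_eq (is_derive1_comp (is_derive_expR _) d) _; rewrite mulrC.
have Ei : ipart wtC = fun=> 0 by apply/funext.
have Ei' (F : R[i] -> R) p : ipart (fun z => (- (2 * nu * F z))%:C * wtC z) p = 0.
  by rewrite ipartM [ipart wtC]Ei mulr0 add0r /ipart ImC mul0r.
have Er' (F : R[i] -> R) p : rpart (fun z => (- (2 * nu * F z))%:C * wtC z) p =
    - (2 * nu * F (toC p)) * wt nu p.
  by rewrite rpartM [ipart wtC]Ei mulr0 subr0 /rpart !ReC /wt ofCK.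
have Er : rpart wtC = wt nu by apply/funext => -[].
split=> p; rewrite Ei Ei' Er Er'; (split; last exact: is_derive_cst).
  case: p => x y.
  have E : (fun t : R => wt nu (t, y)) = (fun t : R => expR (- (nu * (t ^+ 2 + y ^+ 2)))).
    by apply/funext => t; rewrite /wt /sqc.
  have H : is_derive x 1 (fun t => wt nu (t, y)) (- (2 * nu * x) * wt nu (x, y)).
    by rewrite E; have := D (y ^+ 2) x; rewrite /wt /sqc.
  exact/(@is_derive_dirx _ (wt nu) (x, y)).
case: p => x y.
have E : (fun t : R => wt nu (x, t)) = (fun t : R => expR (- (nu * (t ^+ 2 + x ^+ 2)))).
  by apply/funext => t; rewrite /wt /sqc /= addrC.
have H : is_derive y 1 (fun t => wt nu (x, t)) (- (2 * nu * y) * wt nu (x, y)).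
  by rewrite E; have := D (x ^+ 2) y; rewrite /wt /sqc /= addrC.
exact/(@is_derive_diry _ (wt nu) (x, y)).
Qed.

Lemma cont_wtC : cont wtC.
Proof.
split=> p; last exact: cvg_cst.
have c1 : continuous (fun q : R * R => - (nu * (q.1 ^+ 2 + q.2 ^+ 2))).
  move=> q; apply: cvgN; apply: cvgM; first exact: cvg_cst.
  by apply: cvgD; apply: cvgM; try exact: cvg_fst; exact: cvg_snd.
apply: (@continuous_comp _ _ _ (fun q : R * R => - (nu * (q.1 ^+ 2 + q.2 ^+ 2))) expR).
  exact: c1.
exact: continuous_expR.
Qed.

Lemma cont_xy : cont (fun z => (complex.Re z)%:C) /\ cont (fun z => (complex.Im z)%:C).
Proof.
split; first by split=> p; [exact: cvg_fst|exact: cvg_cst].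
by split=> p; [exact: cvg_snd|exact: cvg_cst].
Qed.

Lemma C1_wtC : C1 wtC.
Proof.
have [x y] := pder_wtC; have [cx cy] := cont_xy.
have E (F : R[i] -> R) : (fun z => (- (2 * nu * F z))%:C * wtC z) =
    (fun z => (- (2 * nu))%:C * (F z)%:C * wtC z).
  by apply/funext => z; rewrite -mulNr rmorphM.
rewrite !E in x y.
by apply: (C1_intro cont_wtC x y); apply: contM; try exact: cont_wtC;
  apply: contM => //; exact: cont_cst.
Qed.

Lemma C1J f : C1 f -> C1 (fun z => (f z)^*%C).
Proof.
move=> [cf fx fy cfx cfy].
by apply: (C1_intro (contJ cf) (pderJ fx) (pderJ fy)); exact: contJ.
Qed.

Lemma ipsE f g : ips nu f g = fun z => f z * (g z)^*%C * wtC z.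
Proof. by []. Qed.

Lemma cont_ips f g : cont f -> cont g -> cont (ips nu f g).
Proof.
move=> cf cg; apply: contM; last exact: cont_wtC.
by apply: contM => //; exact: contJ.
Qed.

Lemma cont_opA f : C1 f -> cont (opA f).
Proof.
move=> [_ _ _ cx cy]; rewrite opA_C1; apply: contM; last exact: cont_cst.
by apply: contD => //; apply: contM => //; exact: cont_cst.
Qed.

Lemma cont_opAstar f : C1 f -> cont (opAstar nu f).
Proof.
move=> [cf hx hy cx cy].
have -> : opAstar nu f = fun z => (- 2^-1) * (partialx f z + (- 'i%C) * partialy f z) +
   nu%:C * ((complex.Re z)%:C + (- 'i%C) * (complex.Im z)%:C) * f z.
  apply/funext => z; rewrite /opAstar /d_dz.
  have -> : z^*%C = (complex.Re z)%:C + (- 'i%C) * (complex.Im z)%:C.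
    by apply: complex_ext; rewrite !ReIm ?(mulr0, mul0r, mulr1, subr0, addr0, add0r) ?oppr0; ring.
  by field.
have [rx ry] := cont_xy.
apply: contD.
  apply: contM; first exact: cont_cst.
  by apply: contD => //; apply: contM => //; exact: cont_cst.
apply: contM => //; apply: contM; first exact: cont_cst.
by apply: contD => //; apply: contM => //; exact: cont_cst.
Qed.

(** Formal adjointness of the two operators, on a rectangle of the strip on
    whose horizontal sides one of the functions vanishes: the vertical sides
    cancel by quasi-periodicity. *)
Lemma adjoint_rect (r : R) f G : 0 < r -> C1 f -> C1 G -> qp1 f -> qp1 G ->
  (forall x : R, f (x +i* r) * (G (x +i* r))^*%C = 0 /\
                 f (x +i* (- r)) * (G (x +i* (- r)))^*%C = 0) ->
  cint (rect r) (ips nu (opA f) G) = cint (rect r) (ips nu f (opAstar nu G)).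
Proof.
move=> r0 Cf CG qf qG vr.
have Cw := C1M (C1M Cf (C1J CG)) C1_wtC.
have [cw wx wy cwx cwy] := Cw.
have [cf fx fy cfx cfy] := Cf; have [cG Gx Gy cGx cGy] := CG.
set w := (fun z => _) in cw wx wy cwx cwy.
have wr (x : R) : w (x +i* r) = w (x +i* - r).
  by have [h1 h2] := vr x; rewrite /w h1 h2 !mul0r.
have wp (y : R) : w (1 +i* y) = w (0 +i* y).
  have -> : 1 +i* y = (0 +i* y) + 1 by apply: complex_ext; rewrite !ReIm /= ?add0r ?addr0.
  by rewrite /w qf qG JM -[in RHS]wtC_qp; ring.
have X0 := cint_rect_dx0 r wx cwx wp.
have Y0 := cint_rect_dy0 r0 wy cwy wr.
have [tx ty] := pder_wtC.
have PX := pder_partialx (pderM (pderM fx (pderJ Gx)) tx).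
have PY := pder_partialy (pderM (pderM fy (pderJ Gy)) ty).
have E : ips nu (opA f) G =1 (fun z => 2^-1 * partialx w z +
   ('i%C / 2 * partialy w z + ips nu f (opAstar nu G) z)).
  move=> z; rewrite PX PY !ipsE opA_C1 /opAstar /d_dz.
  rewrite JD JN Jhalf JD JN !JM conjcK JC Ji.
  have Ez : z = (complex.Re z)%:C + 'i%C * (complex.Im z)%:C by exact: complexE.
  rewrite [X in nu%:C * X * _]Ez !rmorphN !rmorphM /= rmorph_nat.
  by field.
rewrite (eq_cint _ E).
have iA := cintegrable_rect r (cont_ips cf (cont_opAstar CG)).
have ix := cintegrable_rect r cwx; have iy := cintegrable_rect r cwy.
have mr := measurable_rect r.
rewrite cint_lin// ?X0; last first.
  apply: cintegrable_rect; apply: contD; first by apply: contM => //; exact: cont_cst.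
  exact: (cont_ips cf (cont_opAstar CG)).
by rewrite cint_lin// Y0 !mulr0 !add0r.
Qed.

Lemma cint_conj D h : mu2.-integrable D (EFin \o ipart h) -> measurable (D : set (T * T)) ->
  cint D (fun z => (h z)^*%C) = (cint D h)^*%C.
Proof.
move=> ih mD; rewrite /cint rpartJ ipartJ /=; congr (_ +i* _).
rewrite -mulN1r -RintegralZl//.
by apply: eq_Rintegral => p _; rewrite mulN1r.
Qed.

Lemma ipsJ f g : ips nu f g = fun z => (ips nu g f z)^*%C.
Proof.
by apply/funext => z; rewrite /ips !JM conjcK JC; ring.
Qed.

Lemma adjoint_rect2 (r : R) f G : 0 < r -> C1 f -> C1 G -> qp1 f -> qp1 G ->
  (forall x : R, G (x +i* r) = 0 /\ G (x +i* (- r)) = 0) ->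
  cint (rect r) (ips nu (opAstar nu f) G) = cint (rect r) (ips nu f (opA G)).
Proof.
move=> r0 Cf CG qf qG vr; rewrite ipsJ [in RHS]ipsJ.
have [cf _ _ _ _] := Cf; have [cG _ _ _ _] := CG.
rewrite !cint_conj; try exact: measurable_rect.
- by congr (_^*%C); apply/esym; apply: adjoint_rect => // x; have [-> ->] := vr x; rewrite !mul0r.
- by apply: (proj2 (cintegrable_rect r _)); apply: cont_ips => //; exact: cont_opA.
- by apply: (proj2 (cintegrable_rect r _)); apply: cont_ips => //; exact: cont_opAstar.
Qed.

End Adjoint.

(** * Orthogonality of eigenfunctions *)

Section Orthogonality.
Context {R : realType}.
Local Notation mu2 := (@lebesgue2 R).
Local Notation S := (@strip R).
Local Notation T := (measurableTypeR R).
Variables (nu alpha : R).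
Hypothesis nu_gt0 : 0 < nu.
Implicit Types (f g h : R[i] -> R[i]) (z : R[i]) (u : R * R -> R).

(** Truncation to growing rectangles, with multipliers of the ordinate that
    are bounded there and converge pointwise to a constant. *)
Lemma cut_cvg u (t : nat -> R -> R) (M k : R) :
  mu2.-integrable S (EFin \o u) -> (forall n, measurable_fun setT (t n)) ->
  (forall n y, `|y| <= n.+1%:R -> `|t n y| <= M) ->
  (forall y, (fun n => t n y) @ \oo --> k) ->
  (fun n => \int[mu2]_(p in rect n.+1%:R) (t n p.2 * u p)) @ \oo -->
    k * \int[mu2]_(p in S) u p.
Proof.
move=> iu mt tM tk.
have mS := @strip_measurable R.
have mu_ : measurable_fun S u by apply/measurable_EFinP; case/integrableP : iu.
pose B n : set (T * T) := setT `*` `[- n.+1%:R, n.+1%:R]%classic.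
have mB n : measurable (B n) by apply: measurableX => //; exact: measurable_itv.
have rE n : rect n.+1%:R = S `&` B n.
  by apply/seteqP; split => [p [? ?]|p [[? ?] [? ?]]]; split.
pose F n : R * R -> R := (fun p => t n p.2 * u p) \_ (B n).
have mF n : measurable_fun S (EFin \o F n).
  apply/measurable_EFinP; apply/(measurable_restrict _ (mB n) mS).
  apply: measurable_funS mS _ _ => //.
  apply: measurable_funM => //; apply: measurable_funTS.
  exact: measurable_snd_comp.
have FM n p : `|F n p| <= `|M| * `|u p|.
  rewrite /F patchE; case: ifPn => [/set_mem[_ /=]|_]; last by rewrite normr0 mulr_ge0.
  rewrite in_itv/= -ler_norml => pn; rewrite normrM ler_wpM2r//.
  by rewrite (le_trans (tM _ _ pn))// ler_norm.
have Fk p : (fun n => F n p) @ \oo --> k * u p.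
  have : (fun n => t n p.2 * u p) @ \oo --> k * u p by apply: cvgM; [exact: tk|exact: cvg_cst].
  apply: cvg_trans; apply: near_eq_cvg; near=> n.
  rewrite /F patchE mem_set//; split => //=; rewrite in_itv/= -ler_norml.
  apply: (@le_trans _ _ n%:R); last by rewrite ler_nat.
  by near: n; exact: nbhs_infty_ger.
have iM : mu2.-integrable S (fun p => (`|M|)%:E * `|(u p)%:E|)%E.
  by apply: integrableZl => //; exact: integrable_abse.
have C : {ae mu2, forall p : R * R, S p ->
    (fun n => (EFin \o F n) p) @ \oo --> ((k * u p)%:E : \bar R)}.
  by apply: aeW => p _; apply: cvg_EFin; [exact: nearW|exact: Fk].
have D : {ae mu2, forall (p : R * R) (n : nat), S p ->
    (`|(EFin \o F n) p| <= (`|M|)%:E * `|(u p)%:E|)%E}.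
  by apply: aeW => p n _; rewrite /= lee_fin.
have mk : measurable_fun S (fun p => (k * u p)%:E).
  by apply/measurable_EFinP; exact: measurable_funM.
have [ik _ H] := @dominated_convergence _ _ _ mu2 S mS (fun n => EFin \o F n) _ _ mF mk C iM D.
have ikf : (\int[mu2]_(p in S) (k * u p)%:E)%E \is a fin_num.
  exact: integrable_fin_num.
rewrite -RintegralZl//.
have E : (fun n => \int[mu2]_(p in rect n.+1%:R) (t n p.2 * u p)) =
    fine \o (fun n => \int[mu2]_(p in S) (EFin \o F n) p)%E.
  by apply/funext => n; rewrite rE Rintegral_mkcondr.
rewrite E; apply: fine_cvg; rewrite fineK//.
Unshelve. all: by end_near. Qed.

Definition ccvg (w : nat -> R[i]) (l : R[i]) :=
  (fun n => complex.Re (w n)) @ \oo --> complex.Re l /\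
  (fun n => complex.Im (w n)) @ \oo --> complex.Im l.

Lemma ccvg_unique w l l' : ccvg w l -> ccvg w l' -> l = l'.
Proof.
move=> [r i] [r' i']; apply: complex_ext.
  by rewrite -(cvg_lim _ r)// -(cvg_lim _ r').
by rewrite -(cvg_lim _ i)// -(cvg_lim _ i').
Qed.

Lemma ccvg_cst l : ccvg (fun=> l) l.
Proof. by split; exact: cvg_cst. Qed.

Lemma ccvgD w w' l l' : ccvg w l -> ccvg w' l' -> ccvg (fun n => w n + w' n) (l + l').
Proof.
move=> [r i] [r' i']; split; rewrite ReIm.
  by under eq_fun do rewrite ReD; exact: cvgD.
by under eq_fun do rewrite ImD; exact: cvgD.
Qed.

Lemma eq_ccvg w w' l : w =1 w' -> ccvg w' l -> ccvg w l.
Proof. by move=> /funext ->. Qed.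

Lemma ccvgZ (c : R[i]) w l : ccvg w l -> ccvg (fun n => c * w n) (c * l).
Proof.
move=> [r i]; split; rewrite ReIm.
  by under eq_fun do rewrite ReM; apply: cvgB; apply: cvgM => //; exact: cvg_cst.
by under eq_fun do rewrite ImM; apply: cvgD; apply: cvgM => //; exact: cvg_cst.
Qed.

Lemma cut_ccvg f g (t : nat -> R -> R) (M k : R) : L2s nu f -> L2s nu g ->
  (forall n, measurable_fun setT (t n)) ->
  (forall n y, `|y| <= n.+1%:R -> `|t n y| <= M) ->
  (forall y, (fun n => t n y) @ \oo --> k) ->
  ccvg (fun n => cint (rect n.+1%:R) (fun z => (t n (complex.Im z))%:C * ips nu f g z))
    (k%:C * inner nu f g).
Proof.
move=> Lf Lg mt tM tk; have [i1 i2] := ips_integrable Lf Lg.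
have c1 := cut_cvg i1 mt tM tk; have c2 := cut_cvg i2 mt tM tk.
have E1 n : rpart (fun z => (t n (complex.Im z))%:C * ips nu f g z) =
    fun p => t n p.2 * rpart (ips nu f g) p.
  rewrite rpartM; apply/funext => p.
  by transitivity (t n p.2 * rpart (ips nu f g) p - 0 * ipart (ips nu f g) p);
    rewrite ?mul0r ?subr0.
have E2 n : ipart (fun z => (t n (complex.Im z))%:C * ips nu f g z) =
    fun p => t n p.2 * ipart (ips nu f g) p.
  rewrite ipartM; apply/funext => p.
  by transitivity (t n p.2 * ipart (ips nu f g) p + 0 * rpart (ips nu f g) p);
    rewrite ?mul0r ?addr0.
rewrite innerE; split.
  rewrite [X in _ --> X](_ : _ = k * \int[mu2]_(p in S) rpart (ips nu f g) p); last first.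
    by rewrite ReM ReC ImC mul0r subr0.
  by apply: cvg_trans c1; apply: near_eq_cvg; apply: nearW => n; rewrite /cint E1.
rewrite [X in _ --> X](_ : _ = k * \int[mu2]_(p in S) ipart (ips nu f g) p); last first.
  by rewrite ImM ReC ImC mul0r addr0.
by apply: cvg_trans c2; apply: near_eq_cvg; apply: nearW => n; rewrite /cint E2.
Qed.

(** The cutoff and its first two derivatives; it vanishes to the second order
    at both ends of the interval of radius n + 1. *)
Definition chi (n : nat) (y : R) : R := (1 - (y / n.+1%:R) ^+ 2) ^+ 2.
Definition chi1 (n : nat) (y : R) : R :=
  - (4 / n.+1%:R) * (y / n.+1%:R) * (1 - (y / n.+1%:R) ^+ 2).
Definition chi2 (n : nat) (y : R) : R :=
  - (4 / n.+1%:R ^+ 2) * (1 - 3 * (y / n.+1%:R) ^+ 2).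

Lemma is_derive_chi n (y : R) : is_derive y 1 (chi n) (chi1 n y).
Proof.
apply: is_derive_eq; rewrite /chi1 /GRing.scale /=; field.
by rewrite addrC natr1 pnatr_eq0.
Qed.
Lemma is_derive_chi1 n (y : R) : is_derive y 1 (chi1 n) (chi2 n y).
Proof.
apply: is_derive_eq; rewrite /chi2 /GRing.scale /=; field.
by rewrite addrC natr1 pnatr_eq0.
Qed.

Lemma continuous_chi1 n : continuous (chi1 n).
Proof.
by move=> y; apply/differentiable_continuous/derivable1_diffP; have [] := is_derive_chi1 n y.
Qed.
Lemma continuous_chi n : continuous (chi n).
Proof.
by move=> y; apply/differentiable_continuous/derivable1_diffP; have [] := is_derive_chi n y.
Qed.
Lemma continuous_chi2 n : continuous (chi2 n).
Proof.
move=> y; apply: cvgM; first exact: cvg_cst.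
apply: cvgB; first exact: cvg_cst.
apply: cvgM; first exact: cvg_cst.
by apply: cvgM; apply: cvgM; try exact: cvg_cst; exact: cvg_id.
Qed.

Lemma chi_end n : [/\ chi n n.+1%:R = 0, chi n (- n.+1%:R) = 0,
  chi1 n n.+1%:R = 0 & chi1 n (- n.+1%:R) = 0].
Proof.
have n0 : n.+1%:R != 0 :> R by rewrite pnatr_eq0.
by rewrite /chi /chi1 mulNr sqrrN divff// expr1n subrr expr0n !mulr0.
Qed.

Lemma chi_bound n (y : R) : `|y| <= n.+1%:R ->
  [/\ `|chi n y| <= 1, `|chi1 n y| <= 4 & `|chi2 n y| <= 8].
Proof.
move=> yn; set x := y / n.+1%:R.
have n1 : 1 <= n.+1%:R :> R by rewrite ler1n.
have n0 : 0 < n.+1%:R :> R by rewrite ltr0n.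
have x1 : `|x| <= 1 by rewrite normrM normfV (ger0_norm (ltW n0)) ler_pdivrMr// mul1r.
have x2 : 0 <= x ^+ 2 <= 1.
  by rewrite sqr_ge0 -real_normK ?num_real// expr_le1.
have [x20 x21] := andP x2.
have i1 : n.+1%:R^-1 <= 1 :> R by rewrite invf_le1.
have i0 : 0 <= n.+1%:R^-1 :> R by rewrite invr_ge0 ltW.
have q1 : `|1 - x ^+ 2| <= 1 by rewrite ger0_norm; lra.
split.
- by rewrite /chi -/x normrX expr_le1.
- rewrite /chi1 -/x; move: (x) (n.+1%:R^-1) x1 q1 i1 i0 => v w v1 w1 q1 q0.
  rewrite !normrM normrN normrM (ger0_norm q0) (ger0_norm (_ : 0 <= 4))//.
  rewrite -!mulrA ler_piMr// mulr_ile1 ?mulr_ge0//.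
  by rewrite mulr_ile1.
- rewrite /chi2 -/x normrM normrN normrM normfV normrX (ger0_norm (ltW n0)) (ger0_norm (_ : 0 <= 4))//.
  have : n.+1%:R ^- 2 <= 1 :> R by rewrite invf_le1 ?exprn_gt0// exprn_ege1.
  have e0 : 0 <= n.+1%:R ^- 2 :> R by rewrite invr_ge0 exprn_ge0// ltW.
  move=> e1; have : `|1 - 3 * x ^+ 2| <= 2 by rewrite ler_norml; apply/andP; split; lra.
  move=> e2; rewrite -mulrA (_ : 8 = 4 * 2); last by ring.
  rewrite ler_wpM2l// (_ : 2 = 1 * 2); last by ring.
  by apply: ler_pM.
Qed.

Lemma chi_cvg (y : R) : [/\ (fun n => chi n y) @ \oo --> (1 : R),
  (fun n => chi1 n y) @ \oo --> (0 : R) & (fun n => chi2 n y) @ \oo --> (0 : R)].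
Proof.
have h : (fun n => n.+1%:R^-1 : R) @ \oo --> (0 : R) by exact: cvg_harmonic.
have hc (c : R) : (fun n => c / n.+1%:R) @ \oo --> (0 : R).
  by rewrite -[X in _ --> X](mulr0 c); apply: cvgM => //; exact: cvg_cst.
have h2 : (fun n => 1 - (y / n.+1%:R) ^+ 2) @ \oo --> (1 : R).
  rewrite -[X in _ --> X](subr0 1); apply: cvgB; first exact: cvg_cst.
  by rewrite -[X in _ --> X](mulr0 0); apply: cvgM; exact: hc.
split.
- by rewrite -[X in _ --> X](mulr1 1); apply: cvgM.
- rewrite -[X in _ --> X](mul0r 1); apply: cvgM => //.
  rewrite -[X in _ --> X](mulr0 (- 0)); apply: cvgM; last exact: hc.
  by apply: cvgN; exact: hc.
- rewrite -[X in _ --> X](mul0r (1 - 3 * 0)); apply: cvgM.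
    rewrite -[X in _ --> X]oppr0; apply: cvgN.
    rewrite -[X in _ --> X](mulr0 0) (_ : (fun n => _) = (fun n => (4 / n.+1%:R) * (1 / n.+1%:R))).
      by apply: cvgM; exact: hc.
    by apply/funext => n; field; rewrite addrC natr1 pnatr_eq0.
  apply: cvgB; first exact: cvg_cst.
  apply: cvgM; first exact: cvg_cst.
  by rewrite -[X in _ --> X](mulr0 0); apply: cvgM; exact: hc.
Qed.

Lemma cut_chi f g : L2s nu f -> L2s nu g ->
  [/\ ccvg (fun n => cint (rect n.+1%:R) (fun z => (chi n (complex.Im z))%:C * ips nu f g z))
        (inner nu f g),
      ccvg (fun n => cint (rect n.+1%:R) (fun z => (chi1 n (complex.Im z))%:C * ips nu f g z)) 0 &
      ccvg (fun n => cint (rect n.+1%:R) (fun z => (chi2 n (complex.Im z))%:C * ips nu f g z)) 0].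
Proof.
move=> Lf Lg; split.
- rewrite -[X in ccvg _ X]mul1r; apply: (cut_ccvg (M := 1)) => //.
  + by move=> n; apply: continuous_measurable_fun; exact: continuous_chi.
  + by move=> n y /chi_bound[].
  + by move=> y; have [] := chi_cvg y.
- rewrite -[X in ccvg _ X](mul0r (inner nu f g)); apply: (cut_ccvg (M := 4)) => //.
  + by move=> n; apply: continuous_measurable_fun; exact: continuous_chi1.
  + by move=> n y /chi_bound[].
  + by move=> y; have [] := chi_cvg y.
- rewrite -[X in ccvg _ X](mul0r (inner nu f g)); apply: (cut_ccvg (M := 8)) => //.
  + by move=> n; apply: continuous_measurable_fun; exact: continuous_chi2.
  + by move=> n y /chi_bound[].
  + by move=> y; have [] := chi_cvg y.
Qed.

Lemma C1_chi n g : C1 g -> C1 (fun z => (chi n (complex.Im z))%:C * g z).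
Proof.
move=> Cg; apply: C1M => //; apply: (C1_y (is_derive_chi n)); exact: continuous_chi1.
Qed.
Lemma C1_chi1 n g : C1 g -> C1 (fun z => (chi1 n (complex.Im z))%:C * g z).
Proof.
move=> Cg; apply: C1M => //; apply: (C1_y (is_derive_chi1 n)); exact: continuous_chi2.
Qed.

Lemma ips_y (t : R -> R) (f g : R[i] -> R[i]) :
  ips nu f (fun z => (t (complex.Im z))%:C * g z) =
  fun z => (t (complex.Im z))%:C * ips nu f g z.
Proof. by apply/funext => z; rewrite /ips JM JC; ring. Qed.

Lemma ips_lin (c : R[i]) f g h : ips nu f (fun z => g z + c * h z) =
  fun z => c^*%C * ips nu f h z + ips nu f g z.
Proof. by apply/funext => z; rewrite /ips JD JM; ring. Qed.

(** The cutoff tends to 1 and its derivative to 0, so that the boundary terms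
    of the truncated identity disappear in the limit. *)
Lemma adjoint_inner f g : C1 f -> C1 g -> qp1 nu alpha f -> qp1 nu alpha g ->
  L2s nu f -> L2s nu g -> L2s nu (opA f) -> L2s nu (opAstar nu g) ->
  inner nu (opA f) g = inner nu f (opAstar nu g).
Proof.
move=> Cf Cg qf qg Lf Lg LAf LAg.
have [cA _ _] := cut_chi LAf Lg; have [cB _ _] := cut_chi Lf LAg.
have [_ cC _] := cut_chi Lf Lg.
apply: ccvg_unique cA _.
have [cf _ _ _ _] := Cf; have [cg _ _ _ _] := Cg.
have E n : cint (rect n.+1%:R) (fun z => (chi n (complex.Im z))%:C * ips nu (opA f) g z) =
    (- ('i%C / 2)) * cint (rect n.+1%:R) (fun z => (chi1 n (complex.Im z))%:C * ips nu f g z)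
    + cint (rect n.+1%:R) (fun z => (chi n (complex.Im z))%:C * ips nu f (opAstar nu g) z).
  rewrite -!ips_y (@adjoint_rect _ nu alpha)//; last 3 first.
  - exact: C1_chi.
  - exact: qp1_y.
  - by move=> x /=; have [-> -> _ _] := chi_end n; rewrite !mul0r rmorph0 !mulr0.
  rewrite (opAstar_y _ (is_derive_chi n) Cg) ips_lin Jhalf Ji mulNr.
  rewrite cint_lin//; first exact: measurable_rect.
    by apply: cintegrable_rect; apply: cont_ips => //; have [] := C1_chi1 n Cg.
  apply: cintegrable_rect; apply: cont_ips => //; apply: contM; last exact: cont_opAstar.
  by apply: cont_y; exact: continuous_chi.
rewrite (funext E) -[X in ccvg _ X]add0r -[X in X + _](mulr0 (- ('i%C / 2))).
by apply: ccvgD => //; exact: ccvgZ.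
Qed.

(** A square integrable eigenfunction is orthogonal to the eigenfunctions of
    another eigenvalue. Nothing is known about the growth of the derivatives
    of f: both operators are moved to the other side, with a cutoff. *)
Lemma eigen_orthogonal f g (lam l : R[i]) : smooth f -> smooth g ->
  qp1 nu alpha f -> qp1 nu alpha g -> L2s nu f -> L2s nu g ->
  L2s nu (opA g) -> L2s nu (opAstar nu g) ->
  (forall z, landau nu f z = lam * f z) -> (forall z, landau nu g z = l * g z) ->
  (lam - l^*%C) * inner nu f g = 0.
Proof.
move=> sf sg qf qg Lf Lg LA LAs ef eg.
have Cf := C1_smooth sf; have Cg := C1_smooth sg.
have CAf := C1_smooth (opA_smooth sf); have CAg := C1_smooth (opA_smooth sg).
have [cg _ _] := cut_chi Lf Lg; have [_ cg1 _] := cut_chi Lf LA.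
have [_ cg2 _] := cut_chi Lf LAs; have [_ _ cg3] := cut_chi Lf Lg.
have [cf _ _ _ _] := Cf.
set k : R[i] := - ('i%C / 2).
have E n : lam * cint (rect n.+1%:R) (fun z => (chi n (complex.Im z))%:C * ips nu f g z) =
   k * cint (rect n.+1%:R) (fun z => (chi1 n (complex.Im z))%:C * ips nu f (opA g) z) +
   (k * cint (rect n.+1%:R) (fun z => (chi1 n (complex.Im z))%:C * ips nu f (opAstar nu g) z) +
   (k * (k * cint (rect n.+1%:R) (fun z => (chi2 n (complex.Im z))%:C * ips nu f g z)) +
   l^*%C * cint (rect n.+1%:R) (fun z => (chi n (complex.Im z))%:C * ips nu f g z))).
  have mr := measurable_rect (n.+1%:R : R).
  have n0 : 0 < n.+1%:R :> R by rewrite ltr0n.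
  have [e1 e2 e3 e4] := chi_end n.
  pose G z := (chi n (complex.Im z))%:C * g z.
  have CG : C1 G by exact: C1_chi.
  have qG : qp1 nu alpha G by exact: qp1_y.
  have AG : opA G = fun z => (chi n (complex.Im z))%:C * opA g z +
      'i%C / 2 * ((chi1 n (complex.Im z))%:C * g z) := opA_y (is_derive_chi n) Cg.
  have c1 : C1 (fun z => (chi n (complex.Im z))%:C * opA g z) by exact: C1_chi.
  have c2 : C1 (fun z => (chi1 n (complex.Im z))%:C * g z) by exact: C1_chi1.
  have c3 : C1 (fun z => 'i%C / 2 * ((chi1 n (complex.Im z))%:C * g z)).
    by apply: C1M; [exact: C1_cst|exact: c2].
  have CAG : C1 (opA G) by rewrite AG; exact: C1D.
  have qAG : qp1 nu alpha (opA G) by exact: qp1_opA.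
  have AAG : opAstar nu (opA G) = fun z =>
     ((chi n (complex.Im z))%:C * (l * g z) +
       'i%C / 2 * ((chi1 n (complex.Im z))%:C * opA g z)) +
      'i%C / 2 * ((chi1 n (complex.Im z))%:C * opAstar nu g z +
         'i%C / 2 * ((chi2 n (complex.Im z))%:C * g z)).
    rewrite AG (opAstarD _ c1 c3) (opAstarZ _ _ c2).
    rewrite (opAstar_y _ (is_derive_chi n) CAg) (opAstar_y _ (is_derive_chi1 n) Cg).
    apply/funext => z; congr (_ + _ + _); congr (_ * _); exact: eg.
  have H1 : cint (rect n.+1%:R) (ips nu (opAstar nu (opA f)) G) =
      cint (rect n.+1%:R) (ips nu f (opAstar nu (opA G))).
    rewrite (@adjoint_rect2 _ nu alpha)//; [|exact: qp1_opA|]; last first.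
      by move=> x; rewrite /G /= e1 e2 !mul0r.
    rewrite (@adjoint_rect _ nu alpha)// => x.
    by rewrite AG /= e1 e2 e3 e4 !mul0r mulr0 addr0 rmorph0 !mulr0.
  have ci h : C1 h -> cintegrable (rect n.+1%:R) (ips nu f h).
    by move=> [ch _ _ _ _]; apply: cintegrable_rect; exact: cont_ips.
  have ciy (t : R -> R) h : cont h -> continuous t ->
      cintegrable (rect n.+1%:R) (fun z => (t (complex.Im z))%:C * ips nu f h z).
    move=> ch ct; apply: cintegrable_rect; apply: contM; last exact: cont_ips.
    exact: cont_y.
  have L : lam * cint (rect n.+1%:R) (fun z => (chi n (complex.Im z))%:C * ips nu f g z) =
     cint (rect n.+1%:R) (ips nu (opAstar nu (opA f)) G).
    have cZ (h : R[i] -> R[i]) : cintegrable (rect n.+1%:R) h ->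
        lam * cint (rect n.+1%:R) h = cint (rect n.+1%:R) (fun z => lam * h z + 0).
      move=> ih; rewrite cint_lin ?cint0 ?addr0//.
      by apply: cintegrable_rect; exact: cont_cst.
    rewrite cZ; last by apply: ciy; [have [] := Cg|exact: continuous_chi].
    by apply: eq_cint => z; rewrite /ips /G -[opAstar nu (opA f) z]/(landau nu f z) ef JM JC; ring.
  rewrite L H1 AAG.
  have contg : cont g by have [] := Cg.
  have contA : cont (opA g) by exact: cont_opA.
  have contAs : cont (opAstar nu g) by exact: cont_opAstar.
  have i1 := ciy (chi1 n) _ contA (@continuous_chi1 n).
  have i2 := ciy (chi1 n) _ contAs (@continuous_chi1 n).
  have i3 := ciy (chi2 n) _ contg (@continuous_chi2 n).
  have i4 := ciy (chi n) _ contg (@continuous_chi n).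
  have z0 : cintegrable (rect n.+1%:R) (fun=> 0 : R[i]).
    by apply: cintegrable_rect; exact: cont_cst.
  have j4 := cintegrable_lin l^*%C mr i4 z0.
  have j3 := cintegrable_lin (k * k) mr i3 j4; have j2 := cintegrable_lin k mr i2 j3.
  rewrite (_ : ips nu f _ = fun z => k * ((chi1 n (complex.Im z))%:C * ips nu f (opA g) z) +
     (k * ((chi1 n (complex.Im z))%:C * ips nu f (opAstar nu g) z) +
     (k * k * ((chi2 n (complex.Im z))%:C * ips nu f g z) +
      (l^*%C * ((chi n (complex.Im z))%:C * ips nu f g z) + 0)))).
    by rewrite !cint_lin// cint0 addr0 mulrA.
  apply/funext => z; rewrite /ips /k; move: (opA g z) (opAstar nu g z) (g z) (f z) => x1 x2 x3 x4.
  move: (chi n _) (chi1 n _) (chi2 n _) (wt nu _) => y1 y2 y3 y4.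
  rewrite !(JD, Jhalf, JM, JC, Ji); ring.
have C1' := ccvgZ lam cg.
have C2 : ccvg (fun n => lam * cint (rect n.+1%:R) (fun z => (chi n (complex.Im z))%:C * ips nu f g z))
   (k * 0 + (k * 0 + (k * (k * 0) + l^*%C * inner nu f g))).
  exact: (eq_ccvg E (ccvgD (ccvgZ k cg1) (ccvgD (ccvgZ k cg2)
    (ccvgD (ccvgZ k (ccvgZ k cg3)) (ccvgZ l^*%C cg))))).
have := ccvg_unique C1' C2; rewrite !mulr0 !add0r mulrBl => ->.
by rewrite subrr.
Qed.

End Orthogonality.

(** * Orthonormality *)

Section Orthonormality.
Context {R : realType}.
Local Notation nc := (@Normc.normc R).
Variables (nu alpha : R).
Hypothesis nu_gt0 : 0 < nu.
Implicit Types (c : nat -> R[i]) (f g : R[i] -> R[i]) (z : R[i]).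
Local Notation e := (e nu alpha).
Local Notation synth := (synth nu alpha).
Local Notation kap := (kap alpha).

Lemma L2s_bound f (C L c : R) : 0 < c -> measurable_plane f ->
  (forall p, sqw nu f p <= C * expR (L * `|p.2| - c * p.2 ^+ 2)) -> L2s nu f.
Proof.
move=> c0 mf fb; split => //.
have /integrableP[mb ib] := strip_y_integrable (integrable_gauss C L c0).
rewrite norm2E; apply: le_lt_trans ib; apply: ge0_le_integral => //.
- exact: strip_measurable.
- by move=> p _; rewrite lee_fin sqw_ge0.
- exact: measurable_sqwE.
- by apply: measurableT_comp.
- by move=> p _; rewrite /= lee_fin (le_trans (fb p))// ler_norm.
Qed.

Lemma e_smooth m j : smooth (e m j).
Proof. rewrite e_synth; exact: (synth_smooth _ nu_gt0 m (delta_bound j)). Qed.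
Lemma e_quasi m j z : quasi_periodic_at alpha nu (e m j) z.
Proof. rewrite e_synth; exact: (synth_quasi _ nu_gt0 m z (delta_bound j)). Qed.
Lemma e_qp1 m j : qp1 nu alpha (e m j).
Proof. by apply: quasi_qp1 => z; exact: e_quasi. Qed.
Lemma cont_smooth f : smooth f -> cont f.
Proof. by move=> /(_ 0%N). Qed.
Lemma smooth_measurable f : smooth f -> measurable_plane f.
Proof. by move=> /cont_smooth/cont_measurable_plane. Qed.

Lemma e_L2s m j : L2s nu (e m j).
Proof.
have [C [L [_ H]]] := sqw_e_bound alpha nu_gt0 m j.
exact: (L2s_bound nu_gt0 (smooth_measurable (e_smooth m j)) H).
Qed.

(** The weighted squared modulus is the density of a normal law in the ordinate. *)
Lemma nrm_e0 j : nrm nu (e 0 j) = 1.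
Proof.
set a := Num.sqrt (2 * nu); set b := Num.sqrt (2 / nu) * pi.
have a0 : 0 < a by rewrite sqrtr_gt0 mulr_gt0.
have a2 : a ^+ 2 = 2 * nu := sqr_hscale nu_gt0.
pose s : R := (2 * Num.sqrt nu)^-1.
have sn0 : 0 < Num.sqrt nu by rewrite sqrtr_gt0.
have s0 : s != 0 by rewrite invr_eq0 mulf_neq0// gt_eqF.
have s2 : s ^+ 2 = (4 * nu)^-1.
  by rewrite /s exprVn exprMn sqr_sqrtr ?ltW// -natrX.
have E p : sqw nu (e 0 j) p = normal_pdf (- (b * kap j / a)) s p.2.
  rewrite sqw_e// /hermite_cst /= fact0 expr0 mulr1 sqrtr1 invr1 expr1n mul1r mulr1.
  rewrite normal_pdfE// /normal_peak /normal_fun s2; congr (_ * _).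
    transitivity (Num.sqrt (((4 * nu)^-1 * pi *+ 2)^-1)).
      congr (Num.sqrt _); rewrite mulr2n; move: (pi_gt0 R); move: (pi) => q q0; field.
      by rewrite !gt_eqF.
    by rewrite sqrtrV// mulrn_wge0// mulr_ge0 ?pi_ge0// invr_ge0 mulr_ge0// ltW.
  congr expR; rewrite /xi -/a -/b mulr2n.
  have -> : a * p.2 + b * kap j = a * (p.2 - - (b * kap j / a)).
    by field; rewrite gt_eqF.
  rewrite exprMn a2; move: (p.2 - _) => q.
  have -> : (4 * nu)^-1 + (4 * nu)^-1 = (2 * nu)^-1 by field; rewrite gt_eqF.
  by rewrite invrK; ring.
rewrite /nrm norm2E; under eq_integral => p _ do rewrite E.
rewrite (ge0_strip_y (measurable_normal_pdf _ _)); last exact: normal_pdf_ge0.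
by rewrite integral_normal_pdf.
Qed.

Lemma hermite_cst_gt0 m : 0 < hermite_cst m :> R.
Proof. by rewrite invr_gt0 sqrtr_gt0 mulr_gt0// ?exprn_gt0// ltr0n fact_gt0. Qed.

Lemma hermite_cst_S m : hermite_cst m = hermite_cst m.+1 * Num.sqrt (2 * m.+1%:R) :> R.
Proof.
have h : Num.sqrt (2 ^+ m.+1 * (m.+1)`!%:R) =
   Num.sqrt (2 ^+ m * m`!%:R) * Num.sqrt (2 * m.+1%:R) :> R.
  rewrite -sqrtrM; last by rewrite mulr_ge0// exprn_ge0.
  by congr Num.sqrt; rewrite exprS factS natrM; ring.
by rewrite /hermite_cst h invfM -mulrA mulVf ?mulr1// gt_eqF// sqrtr_gt0 mulr_gt0.
Qed.

Definition ladder_cst m : R := Num.sqrt (nu * m.+1%:R).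

Lemma ladder_cst_gt0 m : 0 < ladder_cst m.
Proof. by rewrite sqrtr_gt0 mulr_gt0// ltr0n. Qed.

Lemma ladder_cst_up m : Num.sqrt (2 * nu) / 2 * hermite_cst m = ladder_cst m * hermite_cst m.+1.
Proof.
rewrite hermite_cst_S /ladder_cst !sqrtrM// ?ltW//.
have : Num.sqrt 2 ^+ 2 = 2 :> R by rewrite sqr_sqrtr.
move: (Num.sqrt 2) (Num.sqrt nu) (hermite_cst _) (Num.sqrt m.+1%:R) => x y u v x2.
have -> : x * y / 2 * (u * (x * v)) = x ^+ 2 / 2 * (y * v * u) by ring.
by rewrite x2 mulfV// mul1r.
Qed.

Lemma ladder_cst_down m : Num.sqrt (2 * nu) * m.+1%:R * hermite_cst m.+1 = ladder_cst m * hermite_cst m.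
Proof.
rewrite [in RHS]hermite_cst_S /ladder_cst !sqrtrM// ?ltW//.
have h : Num.sqrt m.+1%:R ^+ 2 = m.+1%:R :> R by rewrite sqr_sqrtr.
rewrite -[X in _ * X * _]h; ring.
Qed.

(** The two ladder relations take this symmetric form because of the normalizing
    constants: both operators act with the same factor. *)
Lemma opA_lad m c (M : R) : (forall j, nc (c j) <= M) ->
  opA (synth m.+1 c) = fun z => 'i%C * (ladder_cst m)%:C * synth m c z.
Proof.
move=> Hc; rewrite (opA_synth alpha nu_gt0 m.+1 Hc); apply/funext => z.
rewrite !synthE; move: (Z _ _ _ _ _) => w.
have := congr1 (fun x : R => x%:C : R[i]) (ladder_cst_down m).
rewrite !(rmorphM (real_complex R)) /= => h.
transitivity ('i%C * ((Num.sqrt (2 * nu))%:C * (m.+1%:R)%:C * (hermite_cst m.+1)%:C) * w).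
  by ring.
by rewrite h; ring.
Qed.

Lemma opA_lad0 c (M : R) : (forall j, nc (c j) <= M) ->
  opA (synth 0 c) = fun=> 0.
Proof.
move=> Hc; rewrite (opA_synth alpha nu_gt0 0 Hc); apply/funext => z.
by rewrite mulr0 rmorph0 mulr0 mul0r.
Qed.

Lemma opAstar_lad m c (M : R) : (forall j, nc (c j) <= M) ->
  opAstar nu (synth m c) = fun z => - 'i%C * (ladder_cst m)%:C * synth m.+1 c z.
Proof.
move=> Hc; rewrite (opAstar_synth alpha nu_gt0 m Hc); apply/funext => z.
rewrite !synthE; move: (Z _ _ _ _ _) => w.
have := congr1 (fun x : R => x%:C : R[i]) (ladder_cst_up m).
rewrite /= [in LHS](rmorphM (real_complex R)) [in RHS](rmorphM (real_complex R)) /= => h.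
transitivity (- 'i%C * ((Num.sqrt (2 * nu) / 2)%:C * (hermite_cst m)%:C) * w); first by ring.
by rewrite h; ring.
Qed.

Lemma opA_e m j : L2s nu (opA (e m j)).
Proof.
rewrite e_synth; case: m => [|m].
  by rewrite (opA_lad0 (delta_bound j)); exact: L2s0.
by rewrite (opA_lad m (delta_bound j)) -e_synth; apply: L2sZ; exact: e_L2s.
Qed.

Lemma opAstar_e m j : L2s nu (opAstar nu (e m j)).
Proof.
by rewrite e_synth (opAstar_lad m (delta_bound j)) -e_synth; apply: L2sZ; exact: e_L2s.
Qed.

Lemma landau_e m j z : landau nu (e m j) z = nu%:C * m%:R * e m j z.
Proof. by rewrite e_synth (landau_synth alpha nu_gt0 m z (delta_bound j)). Qed.

(** Moving one ladder operator across the inner product: the norms and the inner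
    products of all levels reduce to those of the lowest one. *)
Lemma inner_ladder m j i : inner nu (e m.+1 j) (e m.+1 i) = inner nu (e m j) (e m i).
Proof.
have Ce k l : C1 (e k l) by apply: C1_smooth; exact: e_smooth.
have := adjoint_inner (Ce m.+1 j) (Ce m i) (@e_qp1 _ _) (@e_qp1 _ _)
  (e_L2s _ _) (e_L2s _ _) (opA_e _ _) (opAstar_e _ _).
rewrite {1}e_synth (opA_lad m (delta_bound j)) -e_synth innerZl; try exact: e_L2s.
rewrite [X in inner nu _ (opAstar nu X)]e_synth (opAstar_lad m (delta_bound i)) -e_synth.
rewrite innerZr; try exact: e_L2s.
rewrite JM JN Ji JC opprK => h; apply/esym; apply: mulfI h.
apply: mulf_neq0; first by rewrite -nc_eq0 nc_i oner_eq0.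
by rewrite -nc_eq0 ncC normr_eq0 gt_eqF ?ladder_cst_gt0.
Qed.

Lemma e_pderx j : pder (dirx R) (e 0 j)
  (fun z => (nu%:C * z + freq kap j) * e 0 j z).
Proof.
rewrite e_synth; have Hd := rapid_gauss alpha nu_gt0 (delta_bound j).
have [hx _] := Z_pder nu (kapB alpha) 0 Hd.
have -> : (fun z => (nu%:C * z + freq kap j) * synth 0 (fun i => (i == j)%:R) z) =
  fun z => (hermite_cst 0)%:C * (nu%:C * z * Z kap nu 0 (fun i => (i == j)%:R * (psi_cst nu alpha i)%:C) z
   + Z kap nu 0 (shift2 kap (fun i => (i == j)%:R * (psi_cst nu alpha i)%:C)) z).
  apply/funext => z; rewrite synthE.
  have -> : shift2 kap (fun i => (i == j)%:R * (psi_cst nu alpha i)%:C) =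
      fun i => freq kap j * ((i == j)%:R * (psi_cst nu alpha i)%:C).
    by apply/funext => i; rewrite /shift2; case: eqP => [->//|_]; rewrite !(mul0r, mulr0).
  by rewrite /Z (WZ nu (kapB alpha))//; ring.
exact: pderZ.
Qed.

(** Different frequencies are orthogonal already on each horizontal segment:
    the product is a derivative of a periodic function. *)
Lemma e0_orthogonal i j : i != j -> inner nu (e 0 i) (e 0 j) = 0.
Proof.
move=> ij; set w := ips nu (e 0 i) (e 0 j).
pose c : R[i] := freq kap i + (freq kap j)^*%C.
have c0 : c != 0.
  have -> : c = (2 * pi * (kap i - kap j))%:C * 'i%C.
    rewrite /c /freq JM JC Ji (mulrBr (2 * pi)) rmorphB /=; ring.
  rewrite mulf_neq0//; last by rewrite -nc_eq0 nc_i oner_eq0.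
  by rewrite -nc_eq0 ncC normr_eq0 !mulf_neq0 ?subr_eq0 ?kap_eq// gt_eqF ?pi_gt0.
have cw : cont w by apply: cont_ips; apply: cont_smooth; exact: e_smooth.
have dw : pder (dirx R) (fun z => c^-1 * w z) w.
  have [tx _] := @pder_wtC R nu.
  have := pderZ c^-1 (pderM (pderM (e_pderx i) (pderJ (e_pderx j))) tx).
  apply: pder_eq => z; first by rewrite /w ipsE.
  rewrite /w ipsE -[RHS]mul1r -(mulVf c0); move: (e 0 i z) (e 0 j z) (wtC nu z) => x y t.
  have -> : (- (2 * nu * complex.Re z))%:C = - (nu%:C * (z + z^*%C)).
    apply: complex_ext; rewrite !ReIm; ring.
  by rewrite /c !(JM, JD) !JC; ring.
have wp (y : R) : w (1 +i* y) = w (0 +i* y).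
  have -> : 1 +i* y = (0 +i* y) + 1 by apply: complex_ext; rewrite !ReIm /= ?add0r ?addr0.
  by rewrite /w ipsE (e_qp1 0 i) (e_qp1 0 j) JM -[in RHS](@wtC_qp _ _ alpha); ring.
have L : ccvg (fun n => cint (rect n.+1%:R) (fun z => (1 : R)%:C * w z)) (1%:C * inner nu (e 0 i) (e 0 j)).
  apply: (@cut_ccvg _ nu _ _ (fun _ _ => 1) 1 1) => //; try exact: e_L2s.
  - by move=> n y _; rewrite normr1.
  - by move=> y; exact: cvg_cst.
rewrite mul1r in L; apply: ccvg_unique L _.
rewrite (_ : (fun n => _) = fun=> 0); first exact: ccvg_cst.
apply/funext => n; rewrite (eq_cint _ (fun z => mul1r (w z))).
by apply: (cint_rect_dx0 _ dw cw) => y; rewrite wp.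
Qed.

(** Different levels are orthogonal as eigenspaces, different frequencies in the
    lowest level by integration along horizontal segments. *)
Theorem e_orthonormal m k i j :
  inner nu (e m i) (e k j) = ((m == k) && (i == j))%:R.
Proof.
have [<-|mk] := eqVneq m k; last first.
  have kJ : (k%:R : R[i])^*%C = k%:R by apply: complex_ext; rewrite !ReIm ?Im_nat ?oppr0.
  have := eigen_orthogonal (e_smooth m i) (e_smooth k j) (@e_qp1 _ _) (@e_qp1 _ _)
    (e_L2s _ _) (e_L2s _ _) (opA_e _ _) (opAstar_e _ _) (landau_e _ _) (landau_e _ _).
  rewrite JM JC kJ -mulrBr => /eqP; rewrite mulf_eq0 => /orP[|/eqP//].
  rewrite mulf_eq0 subr_eq0 eqr_nat (negbTE mk) orbF -nc_eq0 ncC normr_eq0.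
  by rewrite gt_eqF.
elim: m => [|m ih]; last by rewrite inner_ladder.
have [<-|ij] := eqVneq i j; last by rewrite e0_orthogonal.
by rewrite inner_nrm ?nrm_e0//; exact: e_L2s.
Qed.

End Orthonormality.

(** * The closed span and its bounded multipliers *)

Section Density.
Context {R : realType}.
Local Notation nc := (@Normc.normc R).
Local Notation mu2 := (@lebesgue2 R).
Local Notation S := (@strip R).
Variables (nu alpha : R).
Hypothesis nu_gt0 : 0 < nu.
Implicit Types (f g : R[i] -> R[i]) (z : R[i]) (r : R[i] -> R).
Local Notation e := (e nu alpha).
Local Notation kap := (kap alpha).

Lemma eq_ler (x y : R) : x = y -> x <= y. Proof. by move->. Qed.

Inductive Span : (R[i] -> R[i]) -> Prop :=
| Span0 : Span (fun=> 0)
| Span_e (a : R[i]) m j g : Span g -> Span (fun z => a * e m j z + g z).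

(** The norm closure of the span, as a predicate. Density of the span means that
    it contains all square integrable functions. *)
Definition span_closure f : Prop := L2s nu f /\ forall eps : R, 0 < eps ->
  exists2 g, Span g & nrm nu (fun z => f z - g z) < eps.

Lemma Span_L2s f : Span f -> L2s nu f.
Proof.
elim => [|a m j g _ Lg]; first exact: L2s0.
by apply: L2sD => //; apply: L2sZ; exact: e_L2s.
Qed.

Lemma Span_lin (a : R[i]) f g : Span f -> Span g -> Span (fun z => a * f z + g z).
Proof.
move=> Sf Sg; elim: Sf => [|b m j h _ ih].
  by under [X in Span X]funext => z do rewrite mulr0 add0r.
have -> : (fun z => a * (b * e m j z + h z) + g z) =
    fun z => a * b * e m j z + (a * h z + g z) by apply/funext => z; ring.
exact: Span_e.
Qed.

Lemma span_closure_span f : Span f -> span_closure f.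
Proof.
move=> Sf; split; first exact: Span_L2s.
move=> eps e0; exists f => //.
under [X in nrm nu X]funext => z do rewrite subrr.
by rewrite /nrm norm2E integral0_eq// => p _; rewrite /sqw sqc0 mul0r.
Qed.

Lemma span_closure_closed f : L2s nu f ->
  (forall eps : R, 0 < eps -> exists2 g, span_closure g & nrm nu (fun z => f z - g z) < eps) ->
  span_closure f.
Proof.
move=> Lf H; split => // eps e0.
have e4 : 0 < eps / 4 by rewrite divr_gt0.
have [g [Lg /(_ _ e4)[h Sh gh]] fg] := H _ e4.
exists h => //; apply: le_lt_trans (nrm_triangle Lf Lg (Span_L2s Sh)) _; lra.
Qed.

Lemma span_closure_lin (a : R[i]) f g : span_closure f -> span_closure g -> span_closure (fun z => a * f z + g z).
Proof.
move=> [Lf Af] [Lg Ag]; have Lfg : L2s nu (fun z => a * f z + g z).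
  by apply: L2sD => //; exact: L2sZ.
split => // eps e0; have q0 : 0 < sqc a + 1 by rewrite ltr_wpDl// sqc_ge0.
have e1 : 0 < eps / (4 * (sqc a + 1)) by rewrite divr_gt0// mulr_gt0.
have e4 : 0 < eps / 4 by rewrite divr_gt0.
have [f' Sf' ff] := Af _ e1; have [g' Sg' gg] := Ag _ e4.
exists (fun z => a * f' z + g' z); first exact: Span_lin.
have -> : (fun z => a * f z + g z - (a * f' z + g' z)) =
   fun z => a * (f z - f' z) + (g z - g' z) by apply/funext => z; ring.
have Lf' := L2sB Lf (Span_L2s Sf'); have Lg' := L2sB Lg (Span_L2s Sg').
apply: le_lt_trans (nrmD_le (L2sZ a Lf') Lg') _; rewrite nrmZ//.
have : sqc a * nrm nu (fun z => f z - f' z) <= (sqc a + 1) * (eps / (4 * (sqc a + 1))).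
  by apply: ler_pM; rewrite ?sqc_ge0 ?nrm_ge0 ?(ltW ff)// lerDl.
have -> : (sqc a + 1) * (eps / (4 * (sqc a + 1))) = eps / 4 by field; rewrite gt_eqF.
by move=> h; lra.
Qed.

Lemma span_closure_0 : span_closure (fun=> 0). Proof. exact/span_closure_span/Span0. Qed.

Lemma span_closure_dominated (F : nat -> R[i] -> R[i]) f (B : R * R -> R) :
  (forall n, span_closure (F n)) -> L2s nu f -> mu2.-integrable S (EFin \o B) ->
  (forall p, S p -> (fun n => sqw nu (fun z => F n z - f z) p) @ \oo --> 0) ->
  (forall n p, S p -> sqw nu (fun z => F n z - f z) p <= B p) -> span_closure f.
Proof.
move=> AF Lf iB cF FB; apply: span_closure_closed => // eps e0.
have mF n : measurable_plane (F n) by have [[]] := AF n.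
have [n nF] := nrm_dominated mF (proj1 Lf) iB cF FB e0; exists (F n) => //.
rewrite nrmB_sym -lte_fin -nrmE//; apply: L2sB => //; exact: (proj1 (AF n)).
Qed.

(** The Hermite recurrence makes the span invariant under multiplication by
    the ordinate. *)
Lemma e_y m j : exists b1 b2 b3 : R[i], forall z, (complex.Im z)%:C * e m j z =
  b1 * e m.+1 j z + (b2 * e m.-1 j z + b3 * e m j z).
Proof.
set a := Num.sqrt (2 * nu); set b := Num.sqrt (2 / nu) * pi.
have a0 : a != 0 by rewrite gt_eqF// sqrtr_gt0 mulr_gt0.
have c0 k : hermite_cst k != 0 :> R by rewrite gt_eqF// hermite_cst_gt0.
exists (hermite_cst m / (2 * a * hermite_cst m.+1))%:C, (m%:R * hermite_cst m / (a * hermite_cst m.-1))%:C, (- (b * kap j / a))%:C.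
move=> z; rewrite !eE -/a -/b.
set x := a * complex.Im z + b * kap j; set G := gaussC nu z; set g := psi_cst nu alpha j.
have -> : complex.Im z = (x - b * kap j) / a by rewrite /x; field.
have := hpS m x; move: (hp m.+1 x) (hp m x) (hp m.-1 x) => h1 h2 h3 h.
have E : (x - b * kap j) / a * hermite_cst m * h2 =
    hermite_cst m / (2 * a * hermite_cst m.+1) * (hermite_cst m.+1 * h1) +
    (m%:R * hermite_cst m / (a * hermite_cst m.-1) * (hermite_cst m.-1 * h3) + - (b * kap j / a) * (hermite_cst m * h2)).
  by rewrite h; field; rewrite !c0 a0.
move: E; set t := (x - b * kap j) / a; set b1 := hermite_cst m / (2 * a * hermite_cst m.+1).
set b2 := m%:R * hermite_cst m / (a * hermite_cst m.-1); set b3 := - (b * kap j / a).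
move: t b1 b2 b3 (hermite_cst m) (hermite_cst m.+1) (hermite_cst m.-1) => t b1 b2 b3 k2 k1 k3.
move: (wave kap j z) => w E.
transitivity ((t * k2 * h2)%:C * (G * (g%:C * w))).
  by rewrite !(rmorphM (real_complex R)) /=; ring.
by rewrite E !(rmorphD (real_complex R), rmorphM (real_complex R)) /=; ring.
Qed.

Lemma Span_y f : Span f -> Span (fun z => (complex.Im z)%:C * f z).
Proof.
elim => [|a m j g _ ih].
  by under [X in Span X]funext => z do rewrite mulr0; exact: Span0.
have [b1 [b2 [b3 E]]] := e_y m j.
have -> : (fun z => (complex.Im z)%:C * (a * e m j z + g z)) = fun z =>
    a * b1 * e m.+1 j z + (a * b2 * e m.-1 j z +
      (a * b3 * e m j z + (complex.Im z)%:C * g z)).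
  apply/funext => z; rewrite mulrDr mulrCA E; ring.
by do 3 apply: Span_e.
Qed.

Lemma Span_binomial (w : R[i]) n f : Span f ->
  Span (fun z => (1 + w * (complex.Im z)%:C) ^+ n * f z).
Proof.
move=> Sf; elim: n => [|n ih].
  by under [X in Span X]funext => z do rewrite expr0 mul1r.
have -> : (fun z => (1 + w * (complex.Im z)%:C) ^+ n.+1 * f z) = fun z =>
    w * ((complex.Im z)%:C * ((1 + w * (complex.Im z)%:C) ^+ n * f z)) +
    (1 + w * (complex.Im z)%:C) ^+ n * f z.
  by apply/funext => z; rewrite exprS; ring.
by apply: Span_lin => //; exact: Span_y.
Qed.

Lemma nc_expn_sub (x y : R[i]) (M : R) n : nc x <= M -> nc y <= M ->
  nc (x ^+ n.+1 - y ^+ n.+1) <= n.+1%:R * M ^+ n * nc (x - y).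
Proof.
move=> xM yM; have M0 : 0 <= M by exact: le_trans (nc_ge0 _) xM.
elim: n => [|n ih]; first by rewrite !expr1 expr0 !mul1r.
have -> : x ^+ n.+2 - y ^+ n.+2 = x * (x ^+ n.+1 - y ^+ n.+1) + (x - y) * y ^+ n.+1.
  by rewrite [x ^+ n.+2]exprS [y ^+ n.+2]exprS; ring.
apply: le_trans (ncD _ _) _; rewrite !ncM ncX.
have h1 : nc x * nc (x ^+ n.+1 - y ^+ n.+1) <= M * (n.+1%:R * M ^+ n * nc (x - y)).
  by apply: ler_pM => //; exact: nc_ge0.
have h2 : nc (x - y) * nc y ^+ n.+1 <= nc (x - y) * M ^+ n.+1.
  by apply: ler_wpM2l; rewrite ?nc_ge0// lerXn2r ?nnegrE ?nc_ge0.
apply: le_trans (lerD h1 h2) _.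
rewrite (_ : n.+2%:R = n.+1%:R + 1 :> R); last by rewrite natr1.
by rewrite [M ^+ n.+1]exprS; apply: eq_ler; ring.
Qed.

Lemma nc_euler_le (s : R[i]) n : nc ((1 + s / n.+1%:R) ^+ n.+1) <= expR (nc s).
Proof.
rewrite ncX; have n0 : 0 < n.+1%:R :> R by rewrite ltr0n.
have h : nc (1 + s / n.+1%:R) <= expR (nc s / n.+1%:R).
  apply: le_trans (ncD _ _) _; rewrite nc1 ncM.
  have -> : nc (n.+1%:R^-1) = n.+1%:R^-1.
    have -> : (n.+1%:R^-1 : R[i]) = (n.+1%:R^-1)%:C by rewrite fmorphV rmorph_nat.
    by rewrite ncC ger0_norm// invr_ge0 ltW.
  exact: expR_ge1Dx.
apply: (@le_trans _ _ (expR (nc s / n.+1%:R) ^+ n.+1)).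
  by rewrite lerXn2r ?nnegrE ?nc_ge0// expR_ge0.
rewrite -expRM_natl; apply: eq_ler; congr expR; field; rewrite addrC natr1 gt_eqF//.
Qed.

(** Euler's limit for the complex exponential, with a rate that depends on the
    modulus only. It replaces power series: the approximants are iterated
    multiplications by affine functions of the ordinate. *)
Lemma nc_euler (s : R[i]) n : nc ((1 + s / n.+1%:R) ^+ n.+1 - cexp s) <=
  3 * nc s ^+ 2 * expR (2 * nc s) / n.+1%:R.
Proof.
have n0 : 0 < n.+1%:R :> R by rewrite ltr0n.
have n1 : 1 <= n.+1%:R :> R by rewrite ler1n.
have nV : nc (n.+1%:R^-1) = n.+1%:R^-1.
  have -> : (n.+1%:R^-1 : R[i]) = (n.+1%:R^-1)%:C by rewrite fmorphV rmorph_nat.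
  by rewrite ncC ger0_norm// invr_ge0 ltW.
set t := s / n.+1%:R; have nt : nc t = nc s / n.+1%:R by rewrite /t ncM nV.
have -> : cexp s = cexp t ^+ n.+1.
  have cX k : cexp (k%:R * t) = cexp t ^+ k.
    elim: k => [|k ih]; first by rewrite mul0r cexp0 expr0.
    by rewrite -natr1 mulrDl mul1r cexpD ih exprSr.
  by rewrite -cX /t mulrC divfK// pnatr_eq0.
have t1 : nc (1 + t) <= expR (nc t).
  by apply: le_trans (ncD _ _) _; rewrite nc1 expR_ge1Dx.
have t2 : nc (cexp t) <= expR (nc t).
  by rewrite nc_cexp ler_expR (le_trans (ler_norm _))// Re_le_nc.
have := nc_expn_sub n t1 t2; move/le_trans; apply.
have r1 : nc (1 + t - cexp t) <= 3 * nc t ^+ 2 * expR (nc t).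
  have aux (x y : R[i]) : - (1 + x - y) = y - 1 - x by ring.
  rewrite -ncN aux.
  apply: le_trans (cexp_rem _) _; rewrite ler_wpM2l ?mulr_ge0 ?exprn_ge0 ?nc_ge0//.
  by rewrite ler_expR Re_le_nc.
apply: le_trans (ler_wpM2l _ r1) _.
  by rewrite mulr_ge0 ?exprn_ge0 ?expR_ge0// ltW.
have -> : n.+1%:R * expR (nc t) ^+ n * (3 * nc t ^+ 2 * expR (nc t)) =
    3 * nc s ^+ 2 * expR (nc s) / n.+1%:R.
  have -> : expR (nc s) = expR (nc t) ^+ n.+1.
    rewrite -expRM_natl nt; congr expR; rewrite mulrC divfK// gt_eqF//.
  rewrite [expR (nc t) ^+ n.+1]exprS nt; move: (nc s) => x; move: (expR _) => B.
  by field; rewrite addrC natr1 gt_eqF.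
rewrite ler_wpM2r ?invr_ge0 ?(ltW n0)// ler_wpM2l ?mulr_ge0 ?exprn_ge0 ?nc_ge0//.
by rewrite ler_expR; have := nc_ge0 s; lra.
Qed.

Lemma harmonic_cvg0 (c : R) : (fun n => c / n.+1%:R) @ \oo --> (0 : R).
Proof.
rewrite -[X in _ --> X](mulr0 c); apply: cvgM; first exact: cvg_cst.
exact: cvg_harmonic.
Qed.

Lemma sqc_nc z : sqc z = nc z ^+ 2. Proof. by rewrite normc_sqr. Qed.

Lemma sqwM f g p : sqw nu (fun z => f z * g z) p = sqc (f (toC p)) * sqw nu g p.
Proof. by rewrite /sqw sqcM mulrA. Qed.

Lemma continuous_scale (h : R -> R) (a : R) : continuous h -> continuous (fun t => h (a * t)).
Proof. by move=> ch t; apply: continuous_comp; [exact: mulrl_continuous|exact: ch]. Qed.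

Lemma cont_expy (w : R[i]) : cont (fun z => cexp (w * (complex.Im z)%:C)).
Proof.
have -> : (fun z => cexp (w * (complex.Im z)%:C)) = fun z =>
    (expR (complex.Re w * complex.Im z))%:C * ((cos (complex.Im w * complex.Im z))%:C +
     'i%C * (sin (complex.Im w * complex.Im z))%:C).
  apply/funext => z.
  have -> : w * (complex.Im z)%:C = (complex.Re w * complex.Im z) +i* (complex.Im w * complex.Im z).
    by case: w => wr wi; apply: complex_ext; rewrite /=; ring.
  rewrite /cexp /=; congr (_ * _).
  by apply: complex_ext; rewrite !ReIm /= ?(mul0r, mulr0, mul1r, subr0, addr0, add0r).
have cy (h : R -> R) (a : R) : continuous h -> cont (fun z => (h (a * complex.Im z))%:C).
  by move=> ch; apply: (@cont_y _ (fun t => h (a * t))); exact: continuous_scale.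
apply: contM; first by apply: cy; exact: continuous_expR.
apply: contD; first by apply: cy; exact: continuous_cos.
by apply: contM; [exact: cont_cst|apply: cy; exact: continuous_sin].
Qed.

(** The Gaussian decay of the basis functions dominates all Euler approximants. *)
Lemma span_closure_expy (w : R[i]) j : span_closure (fun z => cexp (w * (complex.Im z)%:C) * e 0 j z).
Proof.
have [C [L [C0 HC]]] := sqw_e_bound alpha nu_gt0 0 j.
pose E n z := (1 + w * (complex.Im z)%:C / n.+1%:R) ^+ n.+1.
have wy z : nc (w * (complex.Im z)%:C) = nc w * `|complex.Im z| by rewrite ncM ncC.
have bnd p : (2 * expR (nc w * `|p.2|)) ^+ 2 * sqw nu (e 0 j) p <=
    (4 * C) * expR ((2 * nc w + L) * `|p.2| - nu * p.2 ^+ 2).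
  apply: (@le_trans _ _ ((2 * expR (nc w * `|p.2|)) ^+ 2 * (C * expR (L * `|p.2| - nu * p.2 ^+ 2)))).
    by rewrite ler_wpM2l ?sqr_ge0.
  rewrite exprMn -expRM_natl.
  have -> : (2 * nc w + L) * `|p.2| - nu * p.2 ^+ 2 =
     2 * (nc w * `|p.2|) + (L * `|p.2| - nu * p.2 ^+ 2) by ring.
  by rewrite [X in _ <= _ * X]expRD; move: (expR _) (expR _) => x y; apply: eq_ler; ring.
have M : measurable_plane (fun z => cexp (w * (complex.Im z)%:C) * e 0 j z).
  apply: measurable_planeM; last exact: smooth_measurable (e_smooth alpha nu_gt0 0 j).
  by apply: cont_measurable_plane; exact: cont_expy.
have LM : L2s nu (fun z => cexp (w * (complex.Im z)%:C) * e 0 j z).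
  apply: (L2s_bound nu_gt0 M) => p; apply: le_trans (bnd p).
  rewrite sqwM ler_wpM2r ?sqw_ge0// sqc_nc lerXn2r ?nnegrE ?nc_ge0 ?mulr_ge0 ?expR_ge0//.
  rewrite nc_cexp -(wy (toC p)); have := Re_le_nc (w * (p.2)%:C); have := expR_ge0 (nc (w * (p.2)%:C)).
  move=> h1 h2; apply: (@le_trans _ _ (expR (nc (w * (p.2)%:C)))); last by rewrite /= in h1 *; lra.
  by rewrite ler_expR (le_trans (ler_norm _)).
apply: (@span_closure_dominated (fun n z => E n z * e 0 j z) _
    (fun p => 4 * C * expR ((2 * nc w + L) * `|p.2| - nu * p.2 ^+ 2)) _ LM).
- move=> n; apply: span_closure_span; rewrite /E.
  have -> : (fun z => (1 + w * (complex.Im z)%:C / n.+1%:R) ^+ n.+1 * e 0 j z) =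
      fun z => (1 + (w / n.+1%:R) * (complex.Im z)%:C) ^+ n.+1 * e 0 j z.
    by apply/funext => z; rewrite mulrAC.
  apply: Span_binomial; have := Span_e 1 0 j Span0.
  by under [X in Span X -> _]funext => z do rewrite mul1r addr0.
- exact: (strip_y_integrable (integrable_gauss _ _ nu_gt0)).
- move=> p _; set s := w * (p.2)%:C.
  have sE n : sqw nu (fun z => E n z * e 0 j z - cexp (w * (complex.Im z)%:C) * e 0 j z) p =
      nc ((1 + s / n.+1%:R) ^+ n.+1 - cexp s) ^+ 2 * sqw nu (e 0 j) p.
    by rewrite -sqc_nc /sqw -mulrBl sqcM mulrA.
  rewrite (funext sE) -[X in _ --> X](mul0r (sqw nu (e 0 j) p)); apply: cvgM; last exact: cvg_cst.
  rewrite -[X in _ --> X](mulr0 0).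
  have : (fun n => nc ((1 + s / n.+1%:R) ^+ n.+1 - cexp s)) @ \oo --> (0 : R).
    apply: (@squeeze_cvgr _ _ _ _ (fun=> 0) (fun n => 3 * nc s ^+ 2 * expR (2 * nc s) / n.+1%:R)).
    - by apply: nearW => n; rewrite nc_ge0 nc_euler.
    - exact: cvg_cst.
    - exact: harmonic_cvg0.
  by move=> h; apply: cvgM.
- move=> n p _; apply: le_trans (bnd p).
  rewrite (_ : sqw nu _ p = sqw nu (fun z => (E n z - cexp (w * (complex.Im z)%:C)) * e 0 j z) p); last first.
    by rewrite /sqw -mulrBl.
  rewrite sqwM ler_wpM2r ?sqw_ge0// sqc_nc lerXn2r ?nnegrE ?nc_ge0 ?mulr_ge0 ?expR_ge0//.
  apply: le_trans (ncB _ _) _; rewrite -(wy (toC p)) mulr_natl mulr2n; apply: lerD.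
    exact: nc_euler_le.
  by rewrite nc_cexp ler_expR (le_trans (ler_norm _))// Re_le_nc.
Qed.

(** A fixed nowhere vanishing element of the span; multiplying it by bounded
    functions will produce everything. *)
Local Notation G := (e 0 0).
Definition planar_char (n : int) (t : R) z : R[i] :=
  cexp ((2 * pi * n%:~R * complex.Re z + t * complex.Im z)%:C * 'i%C).

Lemma lowest_cst_neq0 j : (hermite_cst 0 * psi_cst nu alpha j)%:C != 0 :> R[i].
Proof.
rewrite -nc_eq0 ncC normr_eq0 mulf_neq0 ?gt_eqF ?hermite_cst_gt0//.
by rewrite mulr_gt0 ?expR_gt0// powR_gt0// divr_gt0 ?pi_gt0// mulr_gt0.
Qed.

Lemma G_E z : G z = (hermite_cst 0 * psi_cst nu alpha 0)%:C * (gaussC nu z * wave kap 0 z).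
Proof.
rewrite eE [hp 0 _]/= (rmorph1 (real_complex R)) mulr1; move: (psi_cst _ _ _) (gaussC _ _) (wave _ _ _) => k x y.
by rewrite (rmorphM (real_complex R)) /=; ring.
Qed.

Lemma G_neq0 z : G z != 0.
Proof.
rewrite G_E; apply: mulf_neq0; first exact: lowest_cst_neq0.
by apply: mulf_neq0; exact: cexp_neq0.
Qed.

(** A change of frequency multiplies a basis function by a character times a real
    exponential of the ordinate; the latter is undone by an exponential factor. *)
Lemma planar_char_G n t : exists w c : R[i], exists j : nat,
  (fun z => planar_char n t z * G z) = fun z => c * (cexp (w * (complex.Im z)%:C) * e 0 j z).
Proof.
set j := zi n.
exists ((2 * pi * n%:~R)%:C + t%:C * 'i%C).
exists ((hermite_cst 0 * psi_cst nu alpha 0)%:C / (hermite_cst 0 * psi_cst nu alpha j)%:C), j.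
apply/funext => z; rewrite G_E eE /=.
have -> : wave kap j z = wave kap 0 z * cexp ((2 * pi * n%:~R)%:C * 'i%C * z).
  rewrite /wave -cexpD; congr cexp; rewrite /freq !kapE ziK /=.
  by rewrite add0r mulrDr rmorphD /=; ring.
have -> : planar_char n t z = cexp (((2 * pi * n%:~R)%:C + t%:C * 'i%C) * (complex.Im z)%:C) *
    cexp ((2 * pi * n%:~R)%:C * 'i%C * z).
  rewrite -cexpD; congr cexp; apply: complex_ext;
    rewrite !ReIm ?(mul0r, mulr0, subr0, addr0, add0r, sub0r, mulr1); ring.
have := lowest_cst_neq0 j; rewrite (rmorphM _ (hermite_cst 0) (psi_cst nu alpha j)) /=.
move: (cexp (_ * (complex.Im z)%:C)) (cexp (_ * z)) (gaussC nu z) (wave _ _ _) (_ * _)%:C => x1 x2 x3 x4 k.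
by rewrite mulf_eq0 negb_or => /andP[h1 h2]; field; rewrite h1 h2.
Qed.

Lemma span_closure_chr n t : span_closure (fun z => planar_char n t z * G z).
Proof.
have [w [c [j ->]]] := planar_char_G n t.
under [X in span_closure X]funext => z do rewrite -[_ * _]addr0.
by apply: span_closure_lin; [exact: span_closure_expy|exact: span_closure_0].
Qed.

Lemma planar_char_M n k t s z : planar_char (n + k) (t + s) z = planar_char n t z * planar_char k s z.
Proof. by rewrite /planar_char -cexpD; congr cexp; rewrite -mulrDl -rmorphD intrD /=; congr (_%:C * _); ring. Qed.

Lemma planar_char_0 z : planar_char 0 0 z = 1.
Proof. by rewrite /planar_char mulr0 !mul0r addr0 mul0r cexp0. Qed.

Lemma sqc_chr n t z : sqc (planar_char n t z) = 1.
Proof. by rewrite sqc_cexp !ReIm mulr0 mul0r subr0 mulr0 expR0. Qed.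

Lemma cexp_i (x : R) : cexp (x%:C * 'i%C) = (cos x)%:C + 'i%C * (sin x)%:C.
Proof.
rewrite mulCi /cexp /= expR0 mul1r.
by apply: complex_ext; rewrite !ReIm /= ?(mul0r, mulr0, mul1r, subr0, addr0, add0r).
Qed.

Lemma planar_char_cos_sin n t z (x := 2 * pi * n%:~R * complex.Re z + t * complex.Im z) :
  planar_char n t z = (cos x)%:C + 'i%C * (sin x)%:C.
Proof. exact: cexp_i. Qed.

Lemma measurable_chr n t : measurable_plane (planar_char n t).
Proof.
have [cx cy] := @cont_xy R.
have cl : continuous (fun p : R * R => 2 * pi * n%:~R * p.1 + t * p.2).
  move=> p; apply: cvgD; apply: cvgM; try exact: cvg_cst.
    exact: cvg_fst.
  exact: cvg_snd.
have ml : measurable_fun setT (fun p : R * R => 2 * pi * n%:~R * p.1 + t * p.2).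
  exact: continuous_measurable2.
rewrite (funext (planar_char_cos_sin n t)); apply: measurable_planeD.
  apply: (measurable_plane_real (u := fun p => cos (2 * pi * n%:~R * p.1 + t * p.2))).
  apply: continuous_measurable2 => p; apply: continuous_comp; [exact: cl|exact: continuous_cos].
apply: measurable_planeM; first exact: measurable_plane_cst.
apply: (measurable_plane_real (u := fun p => sin (2 * pi * n%:~R * p.1 + t * p.2))).
apply: continuous_measurable2 => p; apply: continuous_comp; [exact: cl|exact: continuous_sin].
Qed.

Definition bounded_plane f := measurable_plane f /\ exists M : R, forall z, sqc (f z) <= M.

Lemma bounded_plane_cst (a : R[i]) : bounded_plane (fun=> a).
Proof. by split; [exact: measurable_plane_cst|exists (sqc a)]. Qed.

Lemma bounded_plane_M f g : bounded_plane f -> bounded_plane g -> bounded_plane (fun z => f z * g z).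
Proof.
move=> [mf [M Mf]] [mg [N Ng]]; split; first exact: measurable_planeM.
by exists (M * N) => z; rewrite sqcM ler_pM ?sqc_ge0.
Qed.

Lemma bounded_plane_D f g : bounded_plane f -> bounded_plane g -> bounded_plane (fun z => f z + g z).
Proof.
move=> [mf [M Mf]] [mg [N Ng]]; split; first exact: measurable_planeD.
exists (2 * M + 2 * N) => z; apply: le_trans (sqcD_le _ _) _.
by rewrite lerD// ler_pM2l.
Qed.

Lemma bounded_plane_chr n t : bounded_plane (planar_char n t).
Proof. by split; [exact: measurable_chr|exists 1 => z; rewrite sqc_chr]. Qed.

Lemma bounded_plane_L2s f : bounded_plane f -> L2s nu (fun z => f z * G z).
Proof.
move=> [mf [M Mf]]; have LG := e_L2s alpha nu_gt0 0 0.
split; first by apply: measurable_planeM => //; exact: (proj1 LG).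
have [mG _] := LG.
apply: (@le_lt_trans _ _ (norm2 nu (fun z => (Num.sqrt M)%:C * G z)%R)); last first.
  by have [] := L2sZ (Num.sqrt M)%:C LG.
apply: norm2_le; first exact: measurable_planeM.
  by apply: measurable_planeM => //; exact: measurable_plane_cst.
move=> p _; rewrite (sqwM f) (sqwM (fun=> (Num.sqrt M)%:C)) ler_wpM2r ?sqw_ge0// sqcC sqr_sqrtr//.
exact: le_trans (sqc_ge0 _) (Mf 0).
Qed.

(** The products with all characters are required so that the characters
    themselves are multipliers of the class [good]; the multipliers of any class
    form an algebra, and dominated limits stay in this one. *)
Definition good f := bounded_plane f /\ forall n t, span_closure (fun z => f z * planar_char n t z * G z).
Definition multiplier f := bounded_plane f /\ forall u, good u -> good (fun z => f z * u z).

Lemma good1 : good (fun=> 1).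
Proof.
split; first exact: bounded_plane_cst.
move=> n t; under [X in span_closure X]funext => z do rewrite mul1r; exact: span_closure_chr.
Qed.

Lemma goodD (a : R[i]) f g : good f -> good g -> good (fun z => a * f z + g z).
Proof.
move=> [bf Af] [bg Ag]; split; first by apply: bounded_plane_D => //; apply: bounded_plane_M => //; exact: bounded_plane_cst.
move=> n t; have -> : (fun z => (a * f z + g z) * planar_char n t z * G z) =
    fun z => a * (f z * planar_char n t z * G z) + g z * planar_char n t z * G z.
  by apply/funext => z; ring.
exact: span_closure_lin.
Qed.

Lemma good_lim (F : nat -> R[i] -> R[i]) f (M : R) : (forall n, good (F n)) -> bounded_plane f ->
  (forall n z, sqc (F n z) <= M) ->
  (forall p, S p -> (fun n => sqc (F n (toC p) - f (toC p))) @ \oo --> (0 : R)) -> good f.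
Proof.
move=> gF bf FM cF; split => // n t; have [_ [N fN]] := bf.
have bft : bounded_plane (fun z => f z * planar_char n t z) by apply: bounded_plane_M => //; exact: bounded_plane_chr.
have H k p : sqw nu (fun z => F k z * planar_char n t z * G z - f z * planar_char n t z * G z) p =
    sqc (F k (toC p) - f (toC p)) * sqw nu G p.
  by rewrite /sqw -!mulrBl sqcM (sqcM _ (planar_char n t _)) sqc_chr mulr1 mulrA.
apply: (@span_closure_dominated (fun k z => F k z * planar_char n t z * G z) _
  (fun p => (2 * M + 2 * N) * sqw nu G p)).
- by move=> k; have [] := gF k.
- exact: bounded_plane_L2s.
- have := L2s_integrable (e_L2s alpha nu_gt0 0 0) => iG.
  exact: (integrableZl (@strip_measurable R) (2 * M + 2 * N) iG).
- move=> p Sp; rewrite (funext (fun k => H k p)) -[X in _ --> X](mul0r (sqw nu G p)).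
  by apply: cvgM; [exact: cF|exact: cvg_cst].
- move=> k p Sp; rewrite H ler_wpM2r ?sqw_ge0//.
  apply: le_trans (sqcD_le _ _) _; rewrite sqcN.
  by rewrite lerD// ler_pM2l.
Qed.

Lemma multiplier_chr n t : multiplier (planar_char n t).
Proof.
split; first exact: bounded_plane_chr.
move=> u [bu Au]; split; first by apply: bounded_plane_M => //; exact: bounded_plane_chr.
move=> k s; have := Au (n + k) (t + s).
under [X in span_closure X -> _]funext => z do rewrite planar_char_M.
by under [X in _ -> span_closure X]funext => z do rewrite [planar_char n t z * u z]mulrC -[u z * _ * _]mulrA.
Qed.

Lemma multiplier_M f g : multiplier f -> multiplier g -> multiplier (fun z => f z * g z).
Proof.
move=> [bf Mf] [bg Mg]; split; first exact: bounded_plane_M.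
move=> u gu; under [X in good X]funext => z do rewrite -mulrA.
by apply: Mf; exact: Mg.
Qed.

Lemma multiplier_D (a : R[i]) f g : multiplier f -> multiplier g -> multiplier (fun z => a * f z + g z).
Proof.
move=> [bf Mf] [bg Mg]; split; first by apply: bounded_plane_D => //; apply: bounded_plane_M => //; exact: bounded_plane_cst.
move=> u gu; have -> : (fun z => (a * f z + g z) * u z) =
    fun z => a * (f z * u z) + g z * u z by apply/funext => z; ring.
by apply: goodD; [exact: Mf|exact: Mg].
Qed.

Lemma multiplier_lim (F : nat -> R[i] -> R[i]) f (M : R) : (forall n, multiplier (F n)) -> bounded_plane f ->
  (forall n z, sqc (F n z) <= M) ->
  (forall p, S p -> (fun n => sqc (F n (toC p) - f (toC p))) @ \oo --> (0 : R)) -> multiplier f.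
Proof.
move=> mF bf FM cF; split => // u gu; have [bu _] := gu; have [_ [N uN]] := bu.
apply: (@good_lim (fun n z => F n z * u z) _ (M * N)).
- by move=> n; have [_ ] := mF n; apply.
- exact: bounded_plane_M.
- by move=> n z; rewrite sqcM ler_pM ?sqc_ge0.
- move=> p Sp; rewrite -[X in _ --> X](mul0r (sqc (u (toC p)))).
  under eq_fun do rewrite -mulrBl sqcM.
  by apply: cvgM; [exact: cF|exact: cvg_cst].
Qed.

Lemma multiplier_cst (a : R[i]) : multiplier (fun=> a).
Proof.
have h : multiplier (fun=> 0).
  split; first exact: bounded_plane_cst.
  move=> u gu; have := goodD (-1) gu gu.
  by under [X in good X -> _]funext => z do rewrite mulN1r addNr -(mul0r (u z)).
have := multiplier_D a (multiplier_chr 0 0) h.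
by under [X in multiplier X -> _]funext => z do rewrite planar_char_0 mulr1 addr0.
Qed.

Lemma multiplier_App f : multiplier f -> span_closure (fun z => f z * G z).
Proof.
move=> [_ Mf]; have [_ /(_ 0 0)] := Mf _ good1.
by under [X in span_closure X -> _]funext => z do rewrite planar_char_0 !mulr1.
Qed.

End Density.

(** * Indicator functions as multipliers *)

Section Completeness.
Context {R : realType}.
Local Notation S := (@strip R).
Local Notation T := (measurableTypeR R).
Variables (nu alpha : R).
Hypothesis nu_gt0 : 0 < nu.
Implicit Types (f g : R[i] -> R[i]) (z : R[i]) (u v : R * R -> R).
Local Notation multiplier := (multiplier nu alpha).
Local Notation span_closure := (span_closure nu alpha).

Definition real_multiplier u := multiplier (fun z => (u (ofC z))%:C).

Lemma real_multiplier_measurable u : real_multiplier u -> measurable_fun setT u.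
Proof.
move=> [[[m _] _] _]; have -> // : u = rpart (fun z => (u (ofC z))%:C).
by apply/funext => p; rewrite /rpart toCK.
Qed.

Lemma real_multiplier_cst (a : R) : real_multiplier (fun=> a). Proof. exact: multiplier_cst. Qed.
Lemma real_multiplier_M u v : real_multiplier u -> real_multiplier v -> real_multiplier (fun p => u p * v p).
Proof.
move=> Mu Mv; rewrite /real_multiplier; under [X in multiplier X]funext => z do rewrite rmorphM.
exact: multiplier_M.
Qed.
Lemma real_multiplier_D (a : R) u v : real_multiplier u -> real_multiplier v -> real_multiplier (fun p => a * u p + v p).
Proof.
move=> Mu Mv; rewrite /real_multiplier; under [X in multiplier X]funext => z do rewrite rmorphD rmorphM.
exact: multiplier_D.
Qed.

Lemma real_multiplier_limS (F : nat -> R * R -> R) u (M : R) : (forall n, real_multiplier (F n)) ->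
  measurable_fun setT u -> (forall p, `|u p| <= M) -> (forall n p, `|F n p| <= M) ->
  (forall p, S p -> (fun n => F n p) @ \oo --> u p) -> real_multiplier u.
Proof.
move=> MF mu_ uM FM cF.
have M0 : 0 <= M by exact: le_trans (normr_ge0 (u (0, 0))) (uM _).
have sq (x : R) : `|x| <= M -> sqc x%:C <= M ^+ 2.
  by move=> h; rewrite sqcC -real_normK ?num_real// lerXn2r.
apply: (multiplier_lim nu_gt0 (F := fun n z => (F n (ofC z))%:C) (M := M ^+ 2)) => //.
- by split; [exact: measurable_plane_real|exists (M ^+ 2) => z; exact: sq].
- by move=> n z; exact: sq.
- move=> p Sp; rewrite toCK.
  have -> : (fun n => sqc ((F n p)%:C - (u p)%:C)) = fun n => (F n p - u p) ^+ 2.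
    by apply/funext => n; rewrite -rmorphB sqcC.
  have c0 : (fun n => F n p - u p) @ \oo --> (0 : R).
    by rewrite -[X in _ --> X](subrr (u p)); apply: cvgB; [exact: cF|exact: cvg_cst].
  by rewrite -[X in _ --> X](mulr0 0); apply: cvgM.
Qed.

Lemma real_multiplier_lim (F : nat -> R * R -> R) u (M : R) : (forall n, real_multiplier (F n)) ->
  (forall n p, `|F n p| <= M) -> (forall p, (fun n => F n p) @ \oo --> u p) -> real_multiplier u.
Proof.
move=> MF FM cF; apply: (real_multiplier_limS MF _ _ FM) => //.
  by apply: (measurable_fun_cvg (h := F)) => [n|p _]; [exact: real_multiplier_measurable|exact: cF].
move=> p; have cn : (fun n => `|F n p|) @ \oo --> `|u p| by exact: cvg_norm.
by apply: (cvgr_to_le cn); apply: nearW => n.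
Qed.

Lemma real_multiplier_cos (n : int) (t phi : R) :
  real_multiplier (fun p => cos (2 * pi * n%:~R * p.1 + t * p.2 + phi)).
Proof.
have H1 := multiplier_chr nu alpha n t; have H2 := multiplier_chr nu alpha (- n) (- t).
have := multiplier_D nu_gt0 (cexp (phi%:C * 'i%C) / 2) H1
  (multiplier_D nu_gt0 (cexp ((- phi)%:C * 'i%C) / 2) H2 (multiplier_cst alpha nu_gt0 0)).
rewrite /real_multiplier; congr (multiplier _); apply/funext => z; rewrite !planar_char_cos_sin !cexp_i /=.
set x := 2 * pi * n%:~R * complex.Re z + t * complex.Im z.
have -> : 2 * pi * (- n)%:~R * complex.Re z + - t * complex.Im z = - x.
  by rewrite /x rmorphN; ring.
move: (x) => y; rewrite !cosN !sinN cosD; move: (cos y) (sin y) (cos phi) (sin phi) => c s C D.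
rewrite rmorphB !(rmorphM (real_complex R)) !(rmorphN (real_complex R)) /=.
transitivity (C%:C * c%:C + 'i%C * 'i%C * D%:C * s%:C); first by field.
by rewrite ii; ring.
Qed.

(** Newton's iteration for the sign: odd, and contracting towards 1 on the
    positive half of the unit interval. *)
Definition sgstep (x : R) : R := x * (3 - x ^+ 2) / 2.

Lemma sgstep_pos (x : R) : 0 < x <= 1 ->
  x <= sgstep x <= 1 /\ 1 - sgstep x <= (1 - x) * (1 - x / 2).
Proof.
move=> /andP[x0 x1]; have y0 : 0 <= 1 - x by rewrite subr_ge0.
have x00 := ltW x0; have h0 : 0 <= 2^-1 :> R by [].
rewrite /sgstep; split; last first.
  rewrite -subr_ge0; have -> : (1 - x) * (1 - x / 2) - (1 - x * (3 - x ^+ 2) / 2) =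
     (1 - x) * x ^+ 2 / 2 by field.
  by rewrite !mulr_ge0.
apply/andP; split; rewrite -subr_ge0.
  have -> : x * (3 - x ^+ 2) / 2 - x = x * (1 - x) * (1 + x) / 2 by field.
  by rewrite !mulr_ge0// addr_ge0.
have -> : 1 - x * (3 - x ^+ 2) / 2 = (1 - x) ^+ 2 * (2 + x) / 2 by field.
by rewrite !mulr_ge0 ?sqr_ge0// addr_ge0.
Qed.

Lemma sgstepN (x : R) : sgstep (- x) = - sgstep x.
Proof. by rewrite /sgstep sqrrN; ring. Qed.

Lemma iter_sgstep_pos (x : R) n : 0 < x <= 1 ->
  x <= iter n sgstep x <= 1 /\ 1 - iter n sgstep x <= (1 - x / 2) ^+ n.
Proof.
move=> /andP[x0 x1]; elim: n => [|n [/andP[h1 h2] h3]] /=.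
  by rewrite lexx x1 expr0 gerBl ltW.
have [|/andP[k1 k2] k3] := @sgstep_pos (iter n sgstep x).
  by rewrite h2 (lt_le_trans x0).
rewrite k2 (le_trans h1 k1); split => //; apply: le_trans k3 _.
rewrite exprSr; apply: ler_pM => //; lra.
Qed.

Lemma iter_sgstepN (x : R) n : iter n sgstep (- x) = - iter n sgstep x.
Proof. by elim: n => //= n ->; rewrite sgstepN. Qed.

Lemma iter_sgstep_cvg (x : R) : `|x| <= 1 ->
  (fun n => iter n sgstep x) @ \oo --> Num.sg x.
Proof.
have P (y : R) : 0 < y <= 1 -> (fun n => iter n sgstep y) @ \oo --> (1 : R).
  move=> hy; have /andP[y0 y1] := hy.
  apply: (@squeeze_cvgr _ _ _ _ (fun n => 1 - (1 - y / 2) ^+ n) (fun=> 1)).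
  - apply: nearW => n; have [/andP[_ ->] h] := iter_sgstep_pos n hy.
    by rewrite andbT; lra.
  - rewrite -[X in _ --> X](subr0 1); apply: cvgB; first exact: cvg_cst.
    by apply: cvg_expr; rewrite ger0_norm; lra.
  - exact: cvg_cst.
rewrite ler_norml => /andP[x1 x2]; have [x0|x0|<-] := ltgtP 0 x.
- by rewrite gtr0_sg//; apply: P; rewrite x0.
- rewrite ltr0_sg//; have -> : (fun n => iter n sgstep x) = fun n => - iter n sgstep (- x).
    by apply/funext => n; rewrite iter_sgstepN opprK.
  by apply: cvgN; apply: P; lra.
- rewrite sgr0 (_ : (fun n => _) = fun=> 0); first exact: cvg_cst.
  by apply/funext; elim => //= n ->; rewrite /sgstep !mul0r.
Qed.

Lemma iter_sgstep_le1 (x : R) n : `|x| <= 1 -> `|iter n sgstep x| <= 1.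
Proof.
have P (y : R) : 0 < y <= 1 -> `|iter n sgstep y| <= 1.
  move=> hy; have [/andP[h1 h2] _] := iter_sgstep_pos n hy.
  by rewrite ger0_norm// (le_trans _ h1)// ltW//; case/andP : hy.
rewrite ler_norml => /andP[x1 x2]; have [x0|x0|<-] := ltgtP 0 x.
- by apply: P; rewrite x0.
- by rewrite -normrN -iter_sgstepN; apply: P; lra.
- suff -> : forall k, iter k sgstep 0 = 0 by rewrite normr0.
  by elim => //= m ->; rewrite /sgstep !mul0r.
Qed.

(** The sign is a bounded limit of odd polynomials in the multiplier. *)
Lemma real_multiplier_gt0 u : real_multiplier u -> (forall p, `|u p| <= 1) -> real_multiplier (fun p => (0 < u p)%R%:R).
Proof.
move=> Mu u1.
have Ms : real_multiplier (fun p => Num.sg (u p)).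
  apply: (@real_multiplier_lim (fun n p => iter n sgstep (u p)) _ 1).
  - elim => [|n ih]; first exact: Mu.
    have -> : (fun p => iter n.+1 sgstep (u p)) =
        fun p => iter n sgstep (u p) * ((- 2^-1) * (iter n sgstep (u p) * iter n sgstep (u p)) + 3 / 2).
      by apply/funext => p; rewrite iterS /sgstep expr2; field.
    by apply: real_multiplier_M; [exact: ih|apply: real_multiplier_D; [exact: (real_multiplier_M ih ih)|exact: real_multiplier_cst]].
  - by move=> n p; exact: iter_sgstep_le1.
  - by move=> p; exact: iter_sgstep_cvg.
have := real_multiplier_D 2^-1 (real_multiplier_M Ms Ms) (real_multiplier_D 2^-1 Ms (real_multiplier_cst 0)).
congr real_multiplier; apply/funext => p; case: (ltgtP 0 (u p)) => [h|h|<-].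
- by rewrite gtr0_sg//=; field.
- by rewrite ltr0_sg//=; field.
- by rewrite sgr0 !mulr0 !addr0.
Qed.

(** The open strip: periodic functions do not separate the two sides of the
    closed one. *)
Definition ostrip : set (R * R) := [set p | 0 < p.1 < 1].
Definition multiplier_set (E : set (R * R)) := measurable (E : set (T * T)) /\ real_multiplier \1_(E `&` ostrip).


Lemma ostrip_measurable : measurable (ostrip : set (T * T)).
Proof.
have -> : ostrip = `]0, 1[%classic `*` setT.
  by apply/seteqP; split => p; rewrite /ostrip /= in_itv/=; [|case].
by apply: measurableX => //; exact: measurable_itv.
Qed.

Lemma indic_le1 (E : set (R * R)) p : `|\1_E p| <= 1 :> R.
Proof. by rewrite indicE; case: (_ \in _); rewrite ?normr1 ?normr0. Qed.

Lemma indic_ge0 (E : set (R * R)) p : 0 <= \1_E p :> R.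
Proof. by rewrite indicE. Qed.

Lemma indic1 (E : set (R * R)) p : E p -> \1_E p = 1 :> R.
Proof. by move=> h; rewrite indicE mem_set. Qed.
Lemma indic0E (E : set (R * R)) p : ~ E p -> \1_E p = 0 :> R.
Proof. by move=> h; rewrite indicE memNset. Qed.

Lemma real_multiplier_eqS u v : real_multiplier u -> measurable_fun setT v -> (forall p, `|u p| <= 1) ->
  (forall p, `|v p| <= 1) -> (forall p, S p -> u p = v p) -> real_multiplier v.
Proof.
move=> Mu mv u1 v1 uv; apply: (real_multiplier_limS (F := fun=> u) (M := 1)) => // p Sp.
by rewrite (uv p Sp); exact: cvg_cst.
Qed.

Lemma real_multiplier_indicS (E : set (R * R)) u : measurable (E : set (T * T)) -> real_multiplier u ->
  (forall p, `|u p| <= 1) -> (forall p, S p -> 0 < u p <-> E p) -> real_multiplier \1_E.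
Proof.
move=> mE Mu u1 uE; apply: (real_multiplier_eqS (real_multiplier_gt0 Mu u1)).
- exact: measurable_indic.
- by move=> p; case: ltP; rewrite ?normr1 ?normr0.
- by move=> p; exact: indic_le1.
- move=> p Sp; have [h|h] := ltP 0 (u p); first by rewrite indic1//; exact/uE.
  by rewrite indic0E// => /(uE p Sp); rewrite ltNge h.
Qed.

Lemma S01 p : S p -> 0 <= p.1 <= 1.
Proof. by move=> [/= h _]; move: h; rewrite in_itv. Qed.

Lemma multiplier_set_x (c : R) : multiplier_set [set p | c < p.1].
Proof.
split.
  have -> : [set p : R * R | c < p.1] = `]c, +oo[%classic `*` setT.
    by apply/seteqP; split => p /=; rewrite in_itv/= andbT; [|case].
  by apply: measurableX => //; exact: measurable_itv.
set E := _ `&` ostrip.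
have mE : measurable (E : set (T * T)).
  apply: measurableI; last exact: ostrip_measurable.
  have -> : [set p : R * R | c < p.1] = `]c, +oo[%classic `*` setT.
    by apply/seteqP; split => p /=; rewrite in_itv/= andbT; [|case].
  by apply: measurableX => //; exact: measurable_itv.
have [c1|c1] := leP 1 c.
  apply: (real_multiplier_eqS (real_multiplier_cst 0)) => //; try by move=> p; rewrite normr0.
  - by move=> p; exact: indic_le1.
  - by move=> p _; rewrite indic0E// => -[/= h /andP[_ h2]]; lra.
(* the product of two sines is a periodic cosine up to a constant; on the open
   strip the first factor is positive and the second has the sign of x - k *)
pose k := Num.max c 0; have k0 : 0 <= k by rewrite le_max lexx orbT.
have k1 : k < 1 by rewrite gt_max c1 ltr01.
pose u (p : R * R) : R := sin (pi * p.1) * sin (pi * (p.1 - k)).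
have Mu : real_multiplier u.
  have -> : u = fun p => (- 2^-1) * cos (2 * pi * 1%:~R * p.1 + 0 * p.2 + - (pi * k)) + cos (pi * k) / 2.
    apply/funext => p; rewrite /u.
    have -> : 2 * pi * 1%:~R * p.1 + 0 * p.2 + - (pi * k) = pi * p.1 + pi * (p.1 - k) by ring.
    have -> : pi * k = pi * p.1 - pi * (p.1 - k) by ring.
    by rewrite cosB cosD; field.
  by apply: real_multiplier_D; [exact: real_multiplier_cos|exact: real_multiplier_cst].
apply: (real_multiplier_indicS mE Mu).
  by move=> p; rewrite normrM mulr_ile1// ler_norml ?sin_le1 ?sin_geN1.
move=> p /S01/andP[x0 x1]; have pi0 := pi_gt0 R; rewrite /u; split.
  move=> h; have x0' : 0 < p.1.
    by rewrite lt_neqAle x0 andbT; apply/eqP => q; move: h; rewrite -q mulr0 sin0 mul0r ltxx.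
  have x1' : p.1 < 1.
    by rewrite lt_neqAle x1 andbT; apply/eqP => q; move: h; rewrite q mulr1 sinpi mul0r ltxx.
  have s0 : 0 < sin (pi * p.1) by apply: sin_gt0_pi; rewrite mulr_gt0//= gtr_pMr.
  move: h; rewrite pmulr_rgt0// => h; split => /=; last by rewrite /ostrip /= x0'.
  rewrite ltNge; apply/negP => h1.
  have : 0 <= sin (pi * (k - p.1)).
    apply: sin_ge0_pi; rewrite mulr_ge0 ?(ltW pi0)//= ?subr_ge0 ?le_max ?h1//.
    by rewrite ger_pMr//; lra.
  by rewrite -opprB mulrN sinN oppr_ge0 leNgt h.
move=> [/= h /andP[x0' x1']]; apply: mulr_gt0; apply: sin_gt0_pi.
  by rewrite mulr_gt0//= gtr_pMr.
have kp : k < p.1 by rewrite gt_max h.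
by rewrite mulr_gt0 ?subr_gt0//= gtr_pMr//; lra.
Qed.

(** The sign of a sine of large period is, in the limit, the sign of its argument. *)
Lemma multiplier_set_y (c : R) : multiplier_set [set p | c < p.2].
Proof.
have mE : measurable ([set p | c < p.2] : set (T * T)).
  have -> : [set p : R * R | c < p.2] = setT `*` `]c, +oo[%classic.
    by apply/seteqP; split => p /=; rewrite in_itv/= andbT; [|case].
  by apply: measurableX => //; exact: measurable_itv.
split => //.
have MU : real_multiplier \1_ostrip.
  have [_] := multiplier_set_x (-1); congr (real_multiplier (\1_ _)).
  by apply/seteqP; split => p; [case|move=> /[dup]/andP[h _] h1; split => //=; lra].
suff ME : real_multiplier \1_[set p | c < p.2].
  have := real_multiplier_M ME MU; congr real_multiplier; apply/funext => p.
  by rewrite indicI.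
pose s n (p : R * R) : R := sin ((p.2 - c) / n.+1%:R).
have s1 n p : `|s n p| <= 1 by rewrite ler_norml sin_le1 sin_geN1.
have Ms n : real_multiplier (s n).
  have := real_multiplier_cos 0 (n.+1%:R^-1) (- (c / n.+1%:R) - pi / 2).
  congr real_multiplier; apply/funext => p; rewrite /s mulr0 mul0r add0r addrA.
  by rewrite cosBpihalf mulrBl [_^-1 * _]mulrC.
apply: (@real_multiplier_lim (fun n p => (0 < s n p)%R%:R) _ 1).
- by move=> n; exact: real_multiplier_gt0.
- by move=> n p; case: ltP; rewrite ?normr1 ?normr0.
- move=> p; have pi0 := pi_gt0 R.
  have cv : (fun n => (p.2 - c) / n.+1%:R) @ \oo --> (0 : R) by exact: harmonic_cvg0.
  have near_pi : \forall n \near \oo, `|(p.2 - c) / n.+1%:R| < pi.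
    by move/cvgrPdist_lt : cv => /(_ _ pi0); apply: filterS => n; rewrite sub0r normrN.
  have [h|h] := ltP c p.2.
    rewrite indic1//; apply: cvg_near_cst; apply: filterS near_pi => n hn.
    have q0 : 0 < (p.2 - c) / n.+1%:R by rewrite divr_gt0// subr_gt0.
    by rewrite /s sin_gt0_pi// q0 -(gtr0_norm q0).
  rewrite indic0E; last by move=> /=; rewrite ltNge h.
  apply: cvg_near_cst; apply: filterS near_pi => n hn.
  have q0 : 0 <= - ((p.2 - c) / n.+1%:R) by rewrite -mulNr divr_ge0// opprB subr_ge0.
  rewrite /s ltNge -oppr_ge0 -sinN sin_ge0_pi// q0/=.
  by rewrite (le_trans (ler_norm _))// normrN ltW.
Qed.

Lemma multiplier_set_setT : multiplier_set setT.
Proof.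
split => //; have [_] := multiplier_set_x (-1); congr (real_multiplier (\1_ _)).
by apply/seteqP; split => p; [case|move=> -[_ /[dup]/andP[h _] h1]; split => //=; lra].
Qed.

Lemma multiplier_set_setC (E : set (R * R)) : multiplier_set E -> multiplier_set (setT `\` E).
Proof.
move=> [mE ME]; split; first by rewrite setTD; exact: measurableC.
have [_ MT] := multiplier_set_setT; have := real_multiplier_D (-1) ME MT; congr real_multiplier; apply/funext => p.
rewrite setTI setTD; have [h|h] := pselect (ostrip p); last first.
  by rewrite !indic0E ?mulr0 ?addr0//; case.
rewrite (indic1 h); have [k|k] := pselect (E p).
  by rewrite indic1// indic0E; [ring|case].
by rewrite indic0E ?indic1//; [ring|case].
Qed.

Lemma multiplier_set_setI (E F : set (R * R)) : multiplier_set E -> multiplier_set F -> multiplier_set (E `&` F).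
Proof.
move=> [mE ME] [mF MF]; split; first exact: measurableI.
have := real_multiplier_M ME MF; congr real_multiplier; apply/funext => p.
by rewrite -[LHS]/((\1_(E `&` ostrip) \* \1_(F `&` ostrip)) p) -indicI setIACA setIid.
Qed.

(** The complement of the union is the decreasing limit of finite products. *)
Lemma multiplier_set_bigcup (F : (set (R * R))^nat) : (forall n, multiplier_set (F n)) -> multiplier_set (\bigcup_n F n).
Proof.
move=> MF; split; first by apply: bigcup_measurable => n _; have [] := MF n.
have [_ MT] := multiplier_set_setT; rewrite setTI in MT.
pose g n p : R := \1_ostrip p * \prod_(i < n) (1 - \1_(F i `&` ostrip) p).
have g1 n p : 0 <= 1 - (\1_(F n `&` ostrip) p : R) <= 1.
  by rewrite indicE; case: (_ \in _); rewrite ?subrr ?subr0 lexx ler01.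
have Mg n : real_multiplier (g n).
  elim: n => [|n ih].
    by move: MT; congr real_multiplier; apply/funext => p; rewrite /g big_ord0 mulr1.
  have [_ Mn] := MF n; have := real_multiplier_M ih (real_multiplier_D (-1) Mn (real_multiplier_cst 1)).
  by congr real_multiplier; apply/funext => p; rewrite /g big_ord_recr /= mulrA mulN1r addrC.
have Mc : real_multiplier \1_(~` (\bigcup_n F n) `&` ostrip).
  apply: (@real_multiplier_lim g _ 1) => //.
    move=> n p; rewrite /g normrM mulr_ile1// ?indic_le1// normr_prod.
    suff /andP[] : 0 <= \prod_(i < n) `|1 - \1_(F i `&` ostrip) p : R| <= 1 by [].
    elim/big_ind : _ => [|x y /andP[x0 x1] /andP[y0 y1]|i _]; first by rewrite ler01 lexx.
      by rewrite mulr_ge0// mulr_ile1.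
    by have /andP[h1 h2] := g1 i p; rewrite ger0_norm ?h1.
  move=> p; have [h|h] := pselect (ostrip p); last first.
    rewrite indic0E; last by case.
    rewrite (_ : (fun n => _) = fun=> 0); first exact: cvg_cst.
    by apply/funext => n; rewrite /g indic0E ?mul0r.
  have [[i _ Fi]|k] := pselect ((\bigcup_n F n) p).
    rewrite indic0E; last by case => k _; apply: k; exists i.
    apply: cvg_near_cst; exists i.+1 => // n /= ni.
    rewrite /g (bigD1 (Ordinal ni))//= [\1_(F i `&` ostrip) p]indic1//.
    by rewrite subrr mul0r mulr0.
  rewrite indic1//; apply: cvg_near_cst; apply: nearW => n.
  rewrite /g indic1// big1 ?mulr1// => i _.
  by rewrite indic0E ?subr0// => -[Fi _]; apply: k; exists i.
have := real_multiplier_D (-1) Mc MT; congr real_multiplier; apply/funext => p.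
have [h|h] := pselect (ostrip p); last by rewrite !indic0E ?mulr0 ?addr0//; case.
rewrite (indic1 h); have [k|k] := pselect ((\bigcup_n F n) p).
  by rewrite (@indic0E (_ `&` _)) ?indic1//; [ring|case].
by rewrite indic1// indic0E; [ring|case].
Qed.

Lemma multiplier_set_0 : multiplier_set set0.
Proof. by have := multiplier_set_setC multiplier_set_setT; rewrite setDv. Qed.

(** Half-planes generate the Borel sets of the plane. *)
Lemma multiplier_set_measurable (E : set (R * R)) : measurable (E : set (T * T)) -> multiplier_set E.
Proof.
have Hx (A : set R) : measurable (A : set T) -> multiplier_set (A `*` setT).
  move=> mA; have : (@ocitv R).-sigma.-measurable A := mA.
  rewrite RGenOInfty.measurableE => {mA}; move: A.
  apply: (@smallest_sub _ _ _ [set A | multiplier_set (A `*` setT)]) => [|B [c ->]]; last first.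
    have := multiplier_set_x c; congr multiplier_set.
    by apply/seteqP; split => p /=; rewrite in_itv/= andbT; [|case].
  split; first by rewrite /= set0X; exact: multiplier_set_0.
    move=> B MB; have := multiplier_set_setC MB; congr multiplier_set.
    by apply/seteqP; split => p /=; [move=> [_ h]; split; [split=> // k; apply: h|]|
      move=> [[_ h] _]; split => // -[]].
  move=> F MF; have := multiplier_set_bigcup MF; congr multiplier_set.
  by apply/seteqP; split => p /=; [move=> [i _ [h _]]; split => //; exists i|
    move=> [[i _ h] _]; exists i].
have Hy (A : set R) : measurable (A : set T) -> multiplier_set (setT `*` A).
  move=> mA; have : (@ocitv R).-sigma.-measurable A := mA.
  rewrite RGenOInfty.measurableE => {mA}; move: A.
  apply: (@smallest_sub _ _ _ [set A | multiplier_set (setT `*` A)]) => [|B [c ->]]; last first.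
    have := multiplier_set_y c; congr multiplier_set.
    by apply/seteqP; split => p /=; rewrite in_itv/= andbT; [|case].
  split; first by rewrite /= setX0; exact: multiplier_set_0.
    move=> B MB; have := multiplier_set_setC MB; congr multiplier_set.
    by apply/seteqP; split => p /=; [move=> [_ h]; split => //; split=> // k; apply: h|
      move=> [_ [_ h]]; split => // -[]].
  move=> F MF; have := multiplier_set_bigcup MF; congr multiplier_set.
  by apply/seteqP; split => p /=; [move=> [i _ [_ h]]; split => //; exists i|
    move=> [_ [i _ h]]; exists i].
rewrite measurable_prod_measurableType; move: E; apply: (@smallest_sub _ _ _ multiplier_set).
  split; [exact: multiplier_set_0|exact: multiplier_set_setC|exact: multiplier_set_bigcup].
move=> _ [A mA [B mB <-]]; have := multiplier_set_setI (Hx A mA) (Hy B mB); congr multiplier_set.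
by apply/seteqP; split => p /=; [move=> [[h _] [_ k]]|move=> [h k]].
Qed.

End Completeness.

(** * Density of the span *)

Section DensityTheorem.
Context {R : realType}.
Local Notation mu2 := (@lebesgue2 R).
Local Notation mu := (@lebesgue_measure R).
Local Notation S := (@strip R).
Local Notation T := (measurableTypeR R).
Variables (nu alpha : R).
Hypothesis nu_gt0 : 0 < nu.
Implicit Types (f g : R[i] -> R[i]) (z : R[i]) (u v : R * R -> R).
Local Notation multiplier := (multiplier nu alpha).
Local Notation span_closure := (span_closure nu alpha).
Local Notation G := (e nu alpha 0 0).
Local Notation real_multiplier := (real_multiplier nu alpha).
Local Notation ostrip := (@ostrip R).

Lemma count_lt (t : R) (N : nat) : 0 <= t <= N%:R ->
  t <= \sum_(k < N) (k%:R < t)%R%:R <= t + 1.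
Proof.
elim: N => [|N ih] /andP[t0 tN].
  by rewrite big_ord0; apply/andP; split; lra.
rewrite big_ord_recr /=; have [h|h] := ltP N%:R t; last first.
  by rewrite addr0; apply: ih; rewrite t0.
rewrite (eq_bigr (fun=> 1)); last first.
  by move=> i _; rewrite (lt_trans _ h)// ltr_nat.
by rewrite sumr_const card_ord -[1%:R]/(1 : R) natr1 tN/= -natr1 lerD2r ltW.
Qed.

Lemma superlevel_measurable u (c : R) : measurable_fun setT u ->
  measurable ([set p | c < u p] : set (T * T)).
Proof.
move=> mu_; have -> : [set p | c < u p] = setT `&` u @^-1` `]c, +oo[%classic.
  by rewrite setTI; apply/seteqP; split => p /=; rewrite in_itv/= andbT.
by apply: mu_ => //; exact: measurable_itv.
Qed.

(** The layers where u exceeds the multiples of 1/N are multiplier sets, and 1/N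
    times their number differs from u by at most 1/N. *)
Lemma real_multiplier_unit u : measurable_fun setT u -> (forall p, 0 <= u p <= 1) ->
  real_multiplier (fun p => u p * \1_ostrip p).
Proof.
move=> mu_ u01.
pose F (N : nat) p : R := N.+1%:R^-1 *
   \sum_(k < N.+1) \1_([set q | k%:R / N.+1%:R < u q] `&` ostrip) p.
have N0 (N : nat) : 0 < N.+1%:R :> R by rewrite ltr0n.
apply: (@real_multiplier_lim _ _ _ nu_gt0 F _ 1).
- move=> N; rewrite /F.
  have H k : real_multiplier (fun p => \sum_(i < k) \1_([set q | i%:R / N.+1%:R < u q] `&` ostrip) p).
    elim: k => [|k ih].
      have := real_multiplier_cst alpha nu_gt0 0; congr real_multiplier; apply/funext => p; by rewrite big_ord0.
    have [_ h] := multiplier_set_measurable alpha nu_gt0 (superlevel_measurable (k%:R / N.+1%:R) mu_).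
    have := real_multiplier_D nu_gt0 1 h ih; congr real_multiplier; apply/funext => p.
    by rewrite big_ord_recr /= mul1r addrC.
  have := real_multiplier_D nu_gt0 N.+1%:R^-1 (H N.+1) (real_multiplier_cst alpha nu_gt0 0).
  by congr real_multiplier; apply/funext => p; rewrite addr0.
- move=> N p; rewrite /F ger0_norm; last first.
    by rewrite mulr_ge0 ?invr_ge0 ?(ltW (N0 N))// sumr_ge0.
  rewrite mulrC ler_pdivrMr// mul1r.
  apply: (@le_trans _ _ (\sum_(k < N.+1) 1)); last by rewrite sumr_const card_ord.
  by apply: ler_sum => i _; rewrite (le_trans (ler_norm _))// indic_le1.
- move=> p; have [h|h] := pselect (ostrip p); last first.
    rewrite indic0E// mulr0 (_ : (fun N => _) = fun=> 0); first exact: cvg_cst.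
    by apply/funext => N; rewrite /F big1 ?mulr0// => i _; rewrite indic0E// => -[].
  rewrite indic1// mulr1.
  have E N : u p <= F N p <= u p + 1 / N.+1%:R.
    have /andP[u0 u1] := u01 p.
    have /count_lt/andP[h1 h2] : 0 <= u p * N.+1%:R <= N.+1%:R.
      by rewrite mulr_ge0 ?(ltW (N0 N))//= ler_piMl// ltW.
    have EF : F N p = N.+1%:R^-1 * \sum_(k < N.+1) (k%:R < u p * N.+1%:R)%R%:R.
      rewrite /F; congr (_ * _); apply: eq_bigr => k _.
      rewrite -ltr_pdivrMr//; have [q|q] := ltP (k%:R / N.+1%:R) (u p).
        by rewrite indic1.
      by rewrite indic0E// => -[/=]; rewrite ltNge q.
    by rewrite EF mulrC ler_pdivlMr// h1/= ler_pdivrMr// mulrDl mul1r mulVf.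
  apply: (@squeeze_cvgr _ _ _ _ (fun=> u p) (fun N => u p + 1 / N.+1%:R)).
  + exact: nearW.
  + exact: cvg_cst.
  + rewrite -[X in _ --> X]addr0; apply: cvgD; [exact: cvg_cst|exact: harmonic_cvg0].
Qed.

Lemma real_multiplier_bounded u (M : R) : measurable_fun setT u -> (forall p, `|u p| <= M) ->
  real_multiplier (fun p => u p * \1_ostrip p).
Proof.
move=> mu_ uM; pose N := M + 1; have N0 : 0 < N.
  by have := le_trans (normr_ge0 _) (uM (0, 0)); rewrite /N; lra.
pose v p := (u p / N + 1) / 2.
have mv : measurable_fun setT v by apply: measurable_funM => //; apply: measurable_funD => //; apply: measurable_funM.
have v01 p : 0 <= v p <= 1.
  have : `|u p / N| <= 1.
    by rewrite normrM normfV (gtr0_norm N0) ler_pdivrMr// mul1r (le_trans (uM p))// lerDl.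
  by rewrite ler_norml /v => /andP[h1 h2]; lra.
have [_ MU] := multiplier_set_setT alpha nu_gt0; rewrite setTI in MU.
have := real_multiplier_D nu_gt0 (2 * N) (real_multiplier_unit mv v01) (real_multiplier_D nu_gt0 (- N) MU (real_multiplier_cst alpha nu_gt0 0)).
congr real_multiplier; apply/funext => p; rewrite /v; field.
by rewrite gt_eqF.
Qed.

Lemma multiplier_bounded f : bounded_plane f -> multiplier (fun z => f z * (\1_ostrip (ofC z))%:C).
Proof.
move=> [[m1 m2] [M fM]].
have b (x : R) : x ^+ 2 <= M -> `|x| <= M + 1.
  by rewrite -[x ^+ 2]real_normK ?num_real// => h; have := normr_ge0 x; nra.
have b1 p : `|rpart f p| <= M + 1.
  by apply: b; have := fM (toC p); rewrite /sqc /rpart; have := sqr_ge0 (complex.Im (f (toC p))); lra.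
have b2 p : `|ipart f p| <= M + 1.
  by apply: b; have := fM (toC p); rewrite /sqc /ipart; have := sqr_ge0 (complex.Re (f (toC p))); lra.
have := multiplier_D nu_gt0 'i%C (real_multiplier_bounded m2 b2) (real_multiplier_bounded m1 b1).
congr multiplier; apply/funext => z; rewrite /rpart /ipart ofCK.
rewrite !(rmorphM (real_complex R)) /= [in RHS](complexE (f z)); ring.
Qed.

Lemma ae_ostrip : {ae mu2, forall p, S p -> ostrip p}.
Proof.
have H (a : R) : mu2.-negligible ([set a] `*` setT).
  exists ([set a] `*` setT); split => //; first by apply: measurableX.
  have -> : mu2 ([set a] `*` setT) = (mu [set a] * mu setT)%E.
    by apply: product_measure1E => //; exact: measurable_set1.
  by rewrite lebesgue_measure_set1 mul0e.
apply: negligibleS (negligibleU (H 0) (H 1)) => p /= /not_implyP[/S01/andP[p0 p1]].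
move/negP; rewrite negb_and -!leNgt => /orP[h|h]; [left|right]; split => //.
  by apply/eqP; rewrite eq_le h p0.
by apply/eqP; rewrite eq_le h p1.
Qed.

(** The inverse is the conjugate divided by the squared modulus, and the latter
    division is a real power. *)
Lemma measurable_inverse f : measurable_plane f -> (forall z, f z != 0) ->
  measurable_plane (fun z => (f z)^-1).
Proof.
move=> mf f0; have -> : (fun z => (f z)^-1) =
    fun z => (f z)^*%C * ((sqc (f (toC (ofC z)))) `^ (-1))%:C.
  apply/funext => z; rewrite ofCK powR_inv1 ?sqc_ge0//.
  apply: (mulfI (f0 z)); rewrite mulfV// mulrA mulcJ -rmorphM mulfV//.
  by rewrite sqc_eq0.
apply: measurable_planeM; first exact: measurable_planeJ.
apply: (measurable_plane_real (u := fun p => (sqc (f (toC p))) `^ (-1))).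
apply: (measurableT_comp (measurable_powR (-1))); have [m1 m2] := mf.
by apply: measurable_funD; exact: measurable_funX.
Qed.

(** The quotient u of f by [e 0 0], which vanishes nowhere, is truncated where its
    squared modulus exceeds n; the truncations are bounded, hence multipliers. *)
Theorem span_closure_dense f : L2s nu f -> span_closure f.
Proof.
move=> Lf; have [mf _] := Lf; have LG := e_L2s alpha nu_gt0 0 0; have [mG _] := LG.
have G0 z : G z != 0 by exact: G_neq0.
pose u z := f z * (G z)^-1.
have fE z : f z = u z * G z by rewrite /u divfK.
have mu_ : measurable_plane u by apply: measurable_planeM => //; exact: measurable_inverse.
pose B (n : nat) : set (R * R) := [set p | sqc (u (toC p)) < n%:R].
have mB n : measurable (B n : set (T * T)).
  rewrite /B; have -> : [set p | sqc (u (toC p)) < n%:R] =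
     [set p | - n%:R < - sqc (u (toC p))] by apply/seteqP; split => p /=; rewrite ltrN2.
  apply: superlevel_measurable; apply: measurableT_comp => //; have [m1 m2] := mu_.
  by apply: measurable_funD; exact: measurable_funX.
pose un n z := u z * (\1_(B n) (ofC z))%:C.
have mind (E : set (R * R)) : measurable (E : set (T * T)) ->
    measurable_plane (fun z => (\1_E (ofC z))%:C : R[i]).
  by move=> mE; apply: measurable_plane_real; exact: measurable_indic.
have bun n : bounded_plane (un n).
  split; first by apply: measurable_planeM => //; exact: mind.
  exists n%:R => z; rewrite /un sqcM sqcC; have [h|h] := pselect (B n (ofC z)).
    by rewrite indic1// expr1n mulr1; move: h; rewrite /B /= ofCK => /ltW.
  by rewrite indic0E// expr0n mulr0.
pose f1 z := f z * (\1_ostrip (ofC z))%:C.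
have mf1 : measurable_plane f1.
  by apply: measurable_planeM => //; apply: mind; exact: ostrip_measurable.
have Lf1 : L2s nu f1.
  split => //; apply: le_lt_trans (proj2 Lf); apply: norm2_le => // p _.
  by rewrite /sqw sqcM sqcC ler_wpM2r ?wt_ge0// ler_piMr ?sqc_ge0// expr_le1 ?indic_ge0.
have A1 : span_closure f1.
  apply: (@span_closure_dominated _ _ _ nu_gt0 (fun n z => un n z * (\1_ostrip (ofC z))%:C * G z) _ (sqw nu f)) => //.
  - by move=> n; apply: multiplier_App => //; exact: multiplier_bounded.
  - exact: L2s_integrable.
  - move=> p Sp; apply: cvg_near_cst.
    have : \forall n \near \oo, B n p.
      near=> n; rewrite /B /=; near: n; exact: nbhs_infty_gtr.
    apply: filterS => n Bn.
    rewrite /sqw /un /f1 toCK [\1_(B n) p]indic1// mulr1 -mulrA [_ * G _]mulrC mulrA -fE.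
    by rewrite subrr sqc0 mul0r.
  - move=> n p Sp; rewrite /sqw ler_wpM2r ?wt_ge0//.
    rewrite /un /f1 toCK; have [h|h] := pselect (B n p).
      rewrite [\1_(B n) p]indic1// mulr1 -mulrA [_ * G _]mulrC mulrA -fE subrr sqc0.
      exact: sqc_ge0.
    by rewrite [\1_(B n) p]indic0E// mulr0 !mul0r sub0r sqcN sqcM sqcC ler_piMr ?sqc_ge0// expr_le1 ?indic_ge0.
apply: span_closure_closed => // eps eps0; exists f1 => //.
suff -> : nrm nu (fun z => f z - f1 z) = 0 by [].
rewrite /nrm norm2E (@ge0_ae_eq_integral _ _ _ mu2 S _ (cst 0%E)) ?integral0//.
- exact: strip_measurable.
- by apply: measurable_sqwE; exact: (proj1 (L2sB Lf Lf1)).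
- by move=> p _; rewrite lee_fin sqw_ge0.
- apply: (negligibleS _ ae_ostrip) => p /=; apply: contra_not => H /H h.
  by rewrite /sqw /f1 toCK indic1// mulr1 subrr sqc0 mul0r.
Unshelve. all: by end_near.
Qed.

End DensityTheorem.

(** * Expansion in Landau levels *)

Section Expansion.
Context {R : realType}.
Local Notation nc := (@Normc.normc R).
Local Notation mu2 := (@lebesgue2 R).
Local Notation S := (@strip R).
Variables (nu alpha : R).
Hypothesis nu_gt0 : 0 < nu.
Implicit Types (f g h : R[i] -> R[i]) (z : R[i]) (c : nat -> R[i]).
Local Notation e := (e nu alpha).
Local Notation synth := (synth nu alpha).
Local Notation Span := (Span nu alpha).

Lemma innerBr f g h : L2s nu f -> L2s nu g -> L2s nu h ->
  inner nu h (fun z => f z - g z) = inner nu h f - inner nu h g.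
Proof.
move=> Lf Lg Lh; rewrite -[LHS]conjcK -inner_conj//; last exact: L2sB.
by rewrite innerBl// JD JN (inner_conj Lh Lf) (inner_conj Lh Lg) !conjcK.
Qed.

Lemma best_approx h g : L2s nu h -> L2s nu g -> inner nu h g = 0 ->
  nrm nu h <= nrm nu (fun z => h z - g z).
Proof.
by move=> Lh Lg o; rewrite nrmB// o mulr0 subr0 lerDl nrm_ge0.
Qed.

Lemma orth_lin (a : R[i]) h f g : L2s nu h -> L2s nu f -> L2s nu g ->
  inner nu h f = 0 -> inner nu h g = 0 -> inner nu h (fun z => a * f z + g z) = 0.
Proof.
move=> Lh Lf Lg hf hg; have La := L2sZ a Lf; have Laf := L2sD La Lg.
rewrite -[LHS]conjcK -inner_conj// innerDl// innerZl//.
by rewrite (inner_conj Lh Lf) (inner_conj Lh Lg) hf hg conjc0 mulr0 addr0 conjc0.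
Qed.

(** An element of the span only involves finitely many levels. Orthogonality to
    these levels is what the best approximation argument uses, which allows the
    expansion to be summed over the frequencies first. *)
Lemma orth_span g : Span g -> exists N : nat, forall h, L2s nu h ->
  (forall m j, (m < N)%N -> inner nu h (e m j) = 0) -> inner nu h g = 0.
Proof.
elim => [|a m j k Sk [N ih]].
  by exists 0%N => h Lh _; rewrite -[LHS]conjcK -inner_conj ?inner0l ?conjc0//; exact: L2s0.
exists (maxn N m.+1) => h Lh ho.
apply: orth_lin => //; [exact: e_L2s|exact: Span_L2s Sk| |].
  by apply: ho; rewrite leq_max ltnSn orbT.
by apply: ih => // m' j' m'N; apply: ho; rewrite leq_max m'N.
Qed.

Lemma orth_sum h (I : Type) (s : seq I) (c : I -> R[i]) (F : I -> R[i] -> R[i]) :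
  L2s nu h -> (forall i, L2s nu (F i)) -> (forall i, inner nu h (F i) = 0) ->
  inner nu h (fun z => \sum_(i <- s) c i * F i z) = 0.
Proof.
move=> Lh LF hF; elim: s => [|i s ih].
  under [X in inner nu h X]funext => z do rewrite big_nil.
  by rewrite -[LHS]conjcK -inner_conj ?inner0l ?conjc0//; exact: L2s0.
under [X in inner nu h X]funext => z do rewrite big_cons.
by apply: orth_lin => //; apply: L2s_sum => j; exact: L2sZ.
Qed.

Definition coef f m j : R[i] := inner nu f (e m j).

Definition psum m c n z : R[i] := \sum_(j < n) c j * e m j z.

Lemma L2s_psum m c n : L2s nu (psum m c n).
Proof. by apply: L2s_sum => j; apply: L2sZ; exact: e_L2s. Qed.

Lemma inner_psum m c n k i : inner nu (psum m c n) (e k i) =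
  if (m == k) && (i < n)%N then c i else 0.
Proof.
rewrite inner_suml; [|by move=> j; apply: L2sZ; exact: e_L2s|exact: e_L2s].
have E (j : 'I_n) : inner nu (fun z => c j * e m j z) (e k i) = c j * ((m == k) && (j == i :> nat))%:R.
  by rewrite innerZl ?e_orthonormal//; exact: e_L2s.
under eq_bigr => j _ do rewrite E.
have [mk|mk] := eqVneq m k; last by rewrite big1// => j _; rewrite mulr0.
have [ni|ni] := ltnP i n.
  rewrite (bigD1 (Ordinal ni))//= eqxx mulr1 big1 ?addr0// => j.
  by rewrite -val_eqE /= => /negbTE ->; rewrite mulr0.
rewrite big1// => j _; rewrite ltn_eqF ?mulr0//.
by rewrite (leq_trans (ltn_ord j)).
Qed.

Lemma nrm_psum m c n : nrm nu (psum m c n) = \sum_(j < n) sqc (c j).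
Proof.
have L := L2s_psum m c n.
have : (nrm nu (psum m c n))%:C = (\sum_(j < n) sqc (c j))%:C.
  rewrite -inner_nrm// {1}/psum inner_suml//; last by move=> j; apply: L2sZ; exact: e_L2s.
  rewrite rmorph_sum; apply: eq_bigr => j _; rewrite innerZl//; last exact: e_L2s.
  rewrite inner_conj//; last exact: e_L2s.
  by rewrite inner_psum eqxx ltn_ord /= mulcJ.
by move/(congr1 (@complex.Re R)).
Qed.

Lemma psum_sub m c n k : (n <= k)%N ->
  (fun z => psum m c k z - psum m c n z) =
  psum m (fun j => if (j < n)%N then 0 else c j) k.
Proof.
move=> nk; apply/funext => z; rewrite /psum.
rewrite -!(big_mkord xpredT (fun j => c j * e m j z)).
rewrite -(big_mkord xpredT (fun j => (if (j < n)%N then 0 else c j) * e m j z)).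
rewrite (big_cat_nat (leq0n n) nk)//= [in RHS](big_cat_nat (leq0n n) nk)//=.
rewrite addrAC subrr add0r [X in _ = X + _]big_nat [X in _ = X + _]big1 ?add0r; last first.
  by move=> i /andP[_ ->]; rewrite mul0r.
by apply: eq_big_nat => i /andP[ni _]; rewrite ltnNge ni.
Qed.

Lemma bessel f m n : L2s nu f -> \sum_(j < n) sqc (coef f m j) <= nrm nu f.
Proof.
move=> Lf; set s := psum m (coef f m) n; have Ls := L2s_psum m (coef f m) n.
have fs : inner nu f s = (nrm nu s)%:C.
  rewrite -[LHS]conjcK -inner_conj// {1}/s /psum inner_suml//; last first.
    by move=> j; apply: L2sZ; exact: e_L2s.
  rewrite nrm_psum -[RHS]JC; congr (_^*%C); rewrite rmorph_sum; apply: eq_bigr => j _.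
  rewrite innerZl//; last exact: e_L2s.
  by rewrite inner_conj//; [rewrite mulcJ|exact: e_L2s].
by have := nrm_ge0 nu (fun z => f z - s z); rewrite nrmB// fs nrm_psum ReC; lra.
Qed.

Lemma sqc_le_nc (x : R[i]) (M : R) : sqc x <= M -> nc x <= M + 1.
Proof. by rewrite sqc_nc => h; have := nc_ge0 x; nra. Qed.

Definition l2 c (B : R) := forall n, \sum_(j < n) sqc (c j) <= B.

Lemma l2_bounded c B : l2 c B -> forall j, nc (c j) <= B + 1.
Proof.
move=> H j; apply: sqc_le_nc; apply: le_trans (H j.+1).
by rewrite big_ord_recr /= lerDr sumr_ge0// => i _; exact: sqc_ge0.
Qed.

Lemma synth_measurable m c B : l2 c B -> measurable_plane (synth m c).
Proof. by move=> /l2_bounded H; apply: smooth_measurable; exact: (synth_smooth alpha nu_gt0 m H). Qed.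

Lemma ReB (x y : R[i]) : complex.Re (x - y) = complex.Re x - complex.Re y.
Proof. by rewrite ReD ReN. Qed.
Lemma ImB (x y : R[i]) : complex.Im (x - y) = complex.Im x - complex.Im y.
Proof. by rewrite ImD ImN. Qed.

Lemma sqc_cvg (w : nat -> R[i]) (l : R[i]) :
  (fun n => complex.Re (w n)) @ \oo --> complex.Re l ->
  (fun n => complex.Im (w n)) @ \oo --> complex.Im l ->
  (fun n => sqc (w n)) @ \oo --> sqc l.
Proof. by move=> r i; apply: cvgD; apply: cvgM. Qed.

Lemma psum_cvg m c (M : R) z : (forall j, nc (c j) <= M) ->
  (fun k => complex.Re (psum m c k z)) @ \oo --> complex.Re (synth m c z) /\
  (fun k => complex.Im (psum m c k z)) @ \oo --> complex.Im (synth m c z).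
Proof.
move=> Hc; split; apply/cvgrPdist_le => eps e0.
  have [N HN] := synth_cvg alpha nu_gt0 m z Hc e0.
  exists N => // k /= Nk; apply: le_trans (HN k Nk); apply: le_trans (Re_le_nc _).
  by rewrite ReB.
have [N HN] := synth_cvg alpha nu_gt0 m z Hc e0.
exists N => // k /= Nk; apply: le_trans (HN k Nk); apply: le_trans (Im_le_nc _).
by rewrite ImB.
Qed.

(** Fatou's lemma bounds the distance to the partial sums by the tails. *)
Lemma synth_tail m c B n (b : R) : l2 c B ->
  (forall k, \sum_(n <= j < k + n) sqc (c j) <= b) ->
  (norm2 nu (fun z => synth m c z - psum m c n z)%R <= b%:E)%E.
Proof.
move=> H Hb; have Hc := l2_bounded H.
pose c' j := if (j < n)%N then 0 else c j.
pose D k z := psum m c (k + n) z - psum m c n z.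
have LD k : L2s nu (D k) by apply: L2sB; exact: L2s_psum.
have nD k : norm2 nu (D k) = (\sum_(n <= j < k + n) sqc (c j))%:E.
  rewrite (nrmE (LD k)) /D (psum_sub m c (leq_addl k n)) nrm_psum; congr (_%:E).
  rewrite -(big_mkord xpredT (fun j => sqc (if (j < n)%N then 0 else c j))).
  rewrite (big_cat_nat (leq0n n) (leq_addl k n))//= [X in X + _ = _]big_nat.
  rewrite [X in X + _ = _]big1 ?add0r; last by move=> i /andP[_ ->]; rewrite sqc0.
  by apply: eq_big_nat => i /andP[ni _]; rewrite ltnNge ni.
pose F k p := (sqw nu (D k) p)%:E.
have Fs p : limn_einf (F ^~ p) = (sqw nu (fun z => synth m c z - psum m c n z) p)%:E.
  have [r i] := psum_cvg m (toC p) Hc.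
  move: r i; rewrite -(cvg_shiftn n) -[X in _ -> X -> _](cvg_shiftn n) => r i.
  have Dc : (fun k => sqc (D k (toC p))) @ \oo --> sqc (synth m c (toC p) - psum m c n (toC p)).
    apply: sqc_cvg; rewrite ?ReB ?ImB.
      rewrite (_ : (fun k => _) = fun k => complex.Re (psum m c (k + n) (toC p)) - complex.Re (psum m c n (toC p))).
        by apply: cvgB; [exact: r|exact: cvg_cst].
      by apply/funext => k; rewrite ReB.
    rewrite (_ : (fun k => _) = fun k => complex.Im (psum m c (k + n) (toC p)) - complex.Im (psum m c n (toC p))).
      by apply: cvgB; [exact: i|exact: cvg_cst].
    by apply/funext => k; rewrite ImB.
  have FE : F ^~ p @ \oo --> (sqw nu (fun z => synth m c z - psum m c n z) p)%:E.
    apply: cvg_EFin; first exact: nearW.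
    by rewrite /comp /=; apply: cvgM; [exact: Dc|exact: cvg_cst].
  by rewrite is_cvg_limn_einfE; [exact/cvg_lim|apply/cvg_ex; eexists; exact: FE].
have := fatou mu2 (@strip_measurable R) (f := F)
  (fun k => measurable_sqwE nu (D := S) (proj1 (LD k))) (fun k p _ => sqw_ge0 _ _ _).
under eq_integral do rewrite Fs.
rewrite norm2E => /le_trans; apply.
have FI : (fun k => (\int[mu2]_(x in S) F k x)%E) = fun k => (\sum_(n <= j < k + n) sqc (c j))%:E.
  by apply/funext => k; rewrite -nD norm2E.
have ndF : {homo (fun k => (\sum_(n <= j < k + n) sqc (c j))%:E) : k l / (k <= l)%N >-> (k <= l)%E}.
  move=> k l kl; rewrite lee_fin (big_cat_nat (leq_addl k n) (_ : k + n <= l + n)%N) ?leq_add2r//=.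
  by rewrite lerDl sumr_ge0// => i _; exact: sqc_ge0.
have cF := ereal_nondecreasing_is_cvgn ndF.
rewrite FI is_cvg_limn_einfE//; apply: lime_le => //.
by apply: nearW => k; rewrite lee_fin.
Qed.

Lemma l2_tail c B : l2 c B -> forall eps : R, 0 < eps ->
  exists n0, forall n, (n0 <= n)%N -> forall k, \sum_(n <= j < k + n) sqc (c j) <= eps.
Proof.
move=> H eps e0; pose A n : R := \sum_(j < n) sqc (c j).
have ndA : {homo A : k l / (k <= l)%N >-> k <= l}.
  move=> k l kl; rewrite /A -!(big_mkord xpredT (fun j => sqc (c j))).
  by rewrite [leRHS](big_cat_nat (leq0n k) kl)//= lerDl sumr_ge0// => i _; exact: sqc_ge0.
have cA : cvgn A.
  by apply: nondecreasing_is_cvgn => //; exists B => _ [n _ <-]; exact: H.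
have /cvgrPdist_le/(_ _ e0)[n0 _ Hn] := cA.
exists n0 => n n0n k.
have -> : \sum_(n <= j < k + n) sqc (c j) = A (k + n)%N - A n.
  rewrite /A -!(big_mkord xpredT (fun j => sqc (c j))).
  by apply/esym/eqP; rewrite subr_eq addrC (big_cat_nat (leq0n n) (leq_addl k n)).
apply: le_trans (Hn _ n0n); apply: le_trans (ler_norm _).
by rewrite lerD2r; apply: nondecreasing_cvgn_le.
Qed.

(** Convergence in norm of a square summable superposition is deduced from the
    pointwise convergence of the series, without completeness of the space. *)
Lemma synth_approx m c B : l2 c B -> L2s nu (synth m c) /\ forall eps : R, 0 < eps ->
  exists n0, forall n, (n0 <= n)%N -> nrm nu (fun z => synth m c z - psum m c n z) <= eps.
Proof.
move=> H.
have K eps : 0 < eps -> exists n0, forall n, (n0 <= n)%N ->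
    (norm2 nu (fun z => synth m c z - psum m c n z)%R <= eps%:E)%E.
  move=> e0; have [n0 Hn0] := l2_tail H e0; exists n0 => n n0n.
  by apply: (synth_tail m H); exact: Hn0.
have L n (eps : R) : (norm2 nu (fun z => synth m c z - psum m c n z)%R <= eps%:E)%E ->
    L2s nu (fun z => synth m c z - psum m c n z).
  move=> h; split; last by apply: le_lt_trans h _; rewrite ltry.
  under [X in measurable_plane X]funext => z do rewrite -mulN1r.
  apply: measurable_planeD; first exact: synth_measurable H.
  by apply: measurable_planeM; [exact: measurable_plane_cst|exact: (proj1 (L2s_psum m c n))].
split.
  have [n0 /(_ n0 (leqnn _)) h] := K 1 ltr01.
  have -> : synth m c = fun z => (synth m c z - psum m c n0 z) + psum m c n0 z.
    by apply/funext => z; rewrite subrK.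
  by apply: L2sD; [exact: L h|exact: L2s_psum].
move=> eps e0; have [n0 Hn0] := K eps e0; exists n0 => n n0n.
by rewrite -lee_fin -nrmE; [exact: Hn0|exact: L (Hn0 n n0n)].
Qed.

Lemma inner_limit g h (a : R[i]) : L2s nu g -> L2s nu h ->
  (forall eps : R, 0 < eps -> exists s, [/\ L2s nu s, inner nu s h = a &
     nrm nu (fun z => g z - s z) <= eps]) -> inner nu g h = a.
Proof.
move=> Lg Lh H; apply/eqP; rewrite -subr_eq0 -sqc_eq0 eq_le sqc_ge0 andbT.
rewrite leNgt; apply/negP; set d := sqc _ => d0.
have k0 : 0 < nrm nu h + 1 by rewrite ltr_wpDl// nrm_ge0.
have e0 : 0 < d / (nrm nu h + 1) / 2 by rewrite !divr_gt0.
have [s [Ls sa gs]] := H _ e0.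
have : d <= nrm nu (fun z => g z - s z) * nrm nu h.
  by rewrite /d -sa -innerBl//; apply: cauchy_schwarz => //; exact: L2sB.
have : nrm nu (fun z => g z - s z) * nrm nu h <= d / (nrm nu h + 1) / 2 * (nrm nu h + 1).
  by apply: ler_pM; rewrite ?nrm_ge0// lerDl.
have -> : d / (nrm nu h + 1) / 2 * (nrm nu h + 1) = d / 2 by field; rewrite gt_eqF.
by move=> h1 h2; have := le_trans h2 h1; lra.
Qed.

Lemma coef_synth m c B k i : l2 c B ->
  inner nu (synth m c) (e k i) = if m == k then c i else 0.
Proof.
move=> H; have [Ls Hs] := synth_approx m H.
apply: inner_limit => //; first exact: e_L2s.
move=> eps e0; have [n0 Hn0] := Hs eps e0; exists (psum m c (maxn n0 i.+1)).
split; [exact: L2s_psum| |by apply: Hn0; rewrite leq_maxl].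
by rewrite inner_psum leq_max ltnSn orbT andbT.
Qed.

Lemma orth_synth h m c B : L2s nu h -> l2 c B -> (forall j, inner nu h (e m j) = 0) ->
  inner nu h (synth m c) = 0.
Proof.
move=> Lh H ho; have [Ls Hs] := synth_approx m H.
rewrite -[LHS]conjcK -inner_conj//; rewrite (@inner_limit _ _ 0) ?conjc0//.
move=> eps e0; have [n0 Hn0] := Hs eps e0; exists (psum m c n0).
split; [exact: L2s_psum| |exact: Hn0].
rewrite inner_conj//; last exact: L2s_psum.
by rewrite orth_sum ?conjc0// => j; exact: e_L2s.
Qed.

(** The component of f in the eigenspace of index m. *)
Definition proj m f := synth m (coef f m).

Lemma l2_coef f m : L2s nu f -> l2 (coef f m) (nrm nu f).
Proof. by move=> Lf n; exact: bessel. Qed.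

Lemma L2s_proj m f : L2s nu f -> L2s nu (proj m f).
Proof. by move=> Lf; have [] := synth_approx m (l2_coef m Lf). Qed.

Lemma coef_proj m f k i : L2s nu f -> coef (proj m f) k i = if m == k then coef f k i else 0.
Proof.
move=> Lf; rewrite /coef (coef_synth m k i (l2_coef m Lf)).
by have [<-|_] := eqVneq m k; reflexivity.
Qed.

Lemma synth_Espace m c B : l2 c B -> Espace alpha nu m%:R (synth m c).
Proof.
move=> H; have Hc := l2_bounded H; split.
- exact: (synth_smooth alpha nu_gt0 m Hc).
- by move=> z; exact: (synth_quasi alpha nu_gt0 m z Hc).
- by move=> z; rewrite (landau_synth alpha nu_gt0 m z Hc).
- by have [[]] := synth_approx m H.
Qed.

(** The sum of the first components is the best approximation in the first levels,
    hence at least as good as an approximation from the span. *)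
Theorem expansion f : L2s nu f -> forall eps : R, 0 < eps ->
  exists n0, forall n, (n0 <= n)%N ->
    nrm nu (fun z => f z - \sum_(m < n) proj m f z) < eps.
Proof.
move=> Lf eps e0; have [_ /(_ _ e0)[g Sg fg]] := span_closure_dense alpha nu_gt0 Lf.
have [n0 Hg] := orth_span Sg; exists n0 => n n0n; apply: le_lt_trans fg.
have Lp : L2s nu (fun z => \sum_(m < n) proj m f z) by apply: L2s_sum => m; exact: L2s_proj.
set h := fun z => _; have Lh : L2s nu h by exact: L2sB.
have Lg := Span_L2s nu_gt0 Sg.
have ho m j : (m < n)%N -> inner nu h (e m j) = 0.
  move=> mn; rewrite innerBl//; last exact: e_L2s.
  rewrite inner_suml; [|by move=> k; exact: L2s_proj|exact: e_L2s].
  under eq_bigr => k _ do rewrite -/(coef (proj k f) m j) coef_proj//.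
  rewrite (bigD1 (Ordinal mn))//= eqxx big1 ?addr0 ?subrr// => k.
  by rewrite -val_eqE /= => /negbTE ->.
have hp (m : 'I_n) : inner nu h (proj m f) = 0.
  by apply: (orth_synth Lh (l2_coef m Lf)) => j; exact: ho.
have -> : (fun z => f z - g z) = fun z => h z - (g z - \sum_(m < n) 1 * proj m f z).
  apply/funext => z; rewrite /h.
  have -> : \sum_(m < n) 1 * proj m f z = \sum_(m < n) proj m f z.
    by apply: eq_bigr => m _; exact: mul1r.
  by rewrite opprB addrA subrK.
have Lp1 : L2s nu (fun z => \sum_(m < n) 1 * proj m f z).
  by apply: L2s_sum => m; apply: L2sZ; exact: L2s_proj.
apply: best_approx => //; first exact: L2sB.
rewrite innerBr// Hg//; last by move=> m j mn; apply: ho; exact: leq_trans mn n0n.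
by rewrite orth_sum ?subrr// => m; exact: L2s_proj.
Qed.

Lemma coef0_nrm f : L2s nu f -> (forall m j, coef f m j = 0) -> nrm nu f = 0.
Proof.
move=> Lf H; apply/eqP; rewrite eq_le nrm_ge0 andbT leNgt; apply/negP => f0.
have [n0 /(_ n0 (leqnn _))] := expansion Lf f0.
have -> : (fun z => f z - \sum_(m < n0) proj m f z) = f; last by rewrite ltxx.
apply/funext => z; rewrite big1 ?subr0// => m _.
rewrite /proj (@synth_finite _ nu alpha m _ 0) ?big_ord0// => j _; exact: H.
Qed.

End Expansion.

(** * Null sets and translations *)

Section NullSets.
Context {R : realType}.
Local Notation mu2 := (@lebesgue2 R).
Local Notation mu := (@lebesgue_measure R).
Local Notation S := (@strip R).
Local Notation T := (measurableTypeR R).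
Variables (nu alpha : R).
Implicit Types (f g h : R[i] -> R[i]) (z : R[i]).

Definition qfac (m : int) z : R[i] := cexp (2 * 'i%C * (pi * alpha)%:C * m%:~R)
  * cexp (nu%:C * (z + m%:~R / 2) * m%:~R).

Lemma qfac_neq0 m z : qfac m z != 0.
Proof. by apply: mulf_neq0; exact: cexp_neq0. Qed.

(** Where a continuous function does not vanish, it does not vanish on a small
    rectangle, which an integer translation brings into the strip. *)
Lemma cont_null f : cont f -> (forall z, quasi_periodic_at alpha nu f z) ->
  norm2 nu f = 0%E -> forall z, f z = 0.
Proof.
move=> cf qf f0 z0; apply/eqP; apply/negPn/negP => fz0.
have [cr ci] := cf; set p0 := ofC z0.
pose u p := sqc (f (toC p)).
have cu : continuous u by move=> p; apply: cvgD; apply: cvgM; try exact: cr; exact: ci.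
have u0 : 0 < u p0 by rewrite /u ofCK sqc_gt0.
have [d d0 Hd] : exists2 d : R, 0 < d & forall x y, p0.1 < x < p0.1 + d ->
    p0.2 < y < p0.2 + d -> 0 < u (x, y).
  have /nbhs_ballP[d /= d0 Hd] : nbhs p0 [set p | 0 < u p].
    have /cvgrPdist_lt/(_ _ u0) := cu p0; apply: filterS => p /=.
    by rewrite ltr_norml => /andP[h1 h2]; lra.
  exists d => // x y /andP[x1 x2] /andP[y1 y2]; apply: Hd; split => /=.
    by rewrite /ball /= ltr_norml; apply/andP; split; lra.
  by rewrite /ball /= ltr_norml; apply/andP; split; lra.
pose n : int := Num.floor p0.1; have n1 : n%:~R <= p0.1 by exact: floor_le.
have n2 : p0.1 < n%:~R + 1 by rewrite -intrD1 floorD1_gt.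
pose k := Num.min d (n%:~R + 1 - p0.1).
have k0 : 0 < k by rewrite lt_min d0 subr_gt0.
have kd : k <= d by rewrite ge_min lexx.
have kn : k <= n%:~R + 1 - p0.1 by rewrite ge_min lexx orbT.
pose a := p0.1 - n%:~R.
pose B : set (T * T) := `]a, a + k[%classic `*` `]p0.2, p0.2 + k[%classic.
have mB : measurable B by apply: measurableX; exact: measurable_itv.
have NB : mu2.-negligible B.
  apply: negligibleS (norm2_eq0_ae (cont_measurable_plane cf) f0) => p [/=].
  rewrite !in_itv/= => /andP[x1 x2] /andP[y1 y2] H.
  have Sp : S p.
    by split => //=; rewrite in_itv/=; apply/andP; split; rewrite /a in x1 x2; lra.
  have := H Sp => fp.
  have : 0 < u (p.1 + n%:~R, p.2).
    by apply: Hd; rewrite /a /= in x1 x2 n1 n2 kn *; apply/andP; split; lra.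
  rewrite /u (_ : toC _ = toC p + n%:~R); last first.
    by apply: complex_ext; rewrite !ReIm /= ?addr0.
  by rewrite (qf (toC p) n) fp mulr0 sqc0 ltxx.
have : mu2 B = 0%E by apply/negligibleP.
have -> : mu2 B = (mu `]a, (a + k)%R[ * mu `]p0.2, (p0.2 + k)%R[)%E.
  by apply: product_measure1E; exact: measurable_itv.
rewrite !lebesgue_measure_itv /= !lte_fin !ltrDl k0 => /eqP.
by rewrite -!EFinB -EFinM eqe mulf_eq0 !(addrC _ k) !addrK orbb gt_eqF.
Qed.

Lemma lebesgue_shift (a : R) (A : set R) : measurable (A : set T) ->
  pushforward mu ((fun x => x + a) : T -> T) A = mu A.
Proof.
move=> mA; apply/esym/lebesgue_measure_unique => //=; first exact: measurable_funD.
move=> mf _ [[c d]] _ <-; rewrite /pushforward /=.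
have -> : (fun x : R => x + a) @^-1` [set` `]c, d]] = [set` `]c - a, d - a]].
  by apply/seteqP; split => x /=; rewrite !in_itv/= ltrBlDr lerBrDr.
rewrite !lebesgue_measure_itv/= !lte_fin ltrD2r.
by case: ifPn => // _; rewrite -!EFinB; congr (_%:E); ring.
Qed.

Lemma lebesgue2_shift (a : R) (A : set (R * R)) : measurable (A : set (T * T)) ->
  mu2 ((fun p => (p.1 + a, p.2)) @^-1` A) = mu2 A.
Proof.
move=> mA.
have mt : measurable_fun setT ((fun p => (p.1 + a, p.2)) : T * T -> T * T).
  by apply/measurable_fun_pairP; split => /=; [exact: measurable_funD|exact: measurable_snd].
apply/esym; have H := @product_measure_unique _ _ T T R mu mu
  (pushforward mu2 ((fun p => (p.1 + a, p.2)) : T * T -> T * T)).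
apply: H => // B C mB mC; rewrite /pushforward.
transitivity (mu2 (((fun x => x + a) : T -> T) @^-1` B `*` C)); first by [].
have mB' : measurable (((fun x => x + a) : T -> T) @^-1` B).
  by rewrite -[X in measurable X]setTI; apply: measurable_funD.
transitivity (mu (((fun x => x + a)%R : T -> T) @^-1` B) * mu C)%E; first exact: product_measure1E.
by congr (_ * _)%E; exact: lebesgue_shift.
Qed.

Lemma negligible_shift (a : R) (A : set (R * R)) : mu2.-negligible A ->
  mu2.-negligible ((fun p => (p.1 + a, p.2)) @^-1` A).
Proof.
move=> [N [mN N0 AN]]; exists ((fun p : R * R => (p.1 + a, p.2)) @^-1` N); split.
- have mt : measurable_fun setT ((fun p => (p.1 + a, p.2)) : T * T -> T * T).
    by apply/measurable_fun_pairP; split => /=; [exact: measurable_funD|exact: measurable_snd].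
  by rewrite -[X in measurable X]setTI; exact: mt.
- by rewrite lebesgue2_shift.
- by move=> p /AN.
Qed.

(** Countably many integer translates of the strip cover the plane, and
    translations preserve null sets. *)
Lemma ae_plane f g : {ae mu2, forall p, quasi_periodic_at alpha nu f (toC p)} ->
  {ae mu2, forall p, quasi_periodic_at alpha nu g (toC p)} ->
  {ae mu2, forall p, S p -> f (toC p) = g (toC p)} -> ae_eq_plane f g.
Proof.
move=> qf qg fg.
pose N (k : nat) := ((fun p : R * R => (p.1 + (iz k)%:~R, p.2)) @^-1`
   (~` [set p | S p -> f (toC p) = g (toC p)])).
have NN : mu2.-negligible (\bigcup_k N k).
  by apply: negligible_bigcup => k; exact: negligible_shift.
apply: negligibleS (negligibleU (negligibleU qf qg) NN) => p /= fgp.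
have [qfp|] := pselect (quasi_periodic_at alpha nu f (toC p)); last by left; left.
have [qgp|] := pselect (quasi_periodic_at alpha nu g (toC p)); last by left; right.
right; exists (zi (- Num.floor p.1)) => //; rewrite /N /= ziK => H; apply: fgp.
have E : toC (p.1 + (- Num.floor p.1)%:~R, p.2) = toC p + (- Num.floor p.1)%:~R.
  by apply: complex_ext; rewrite !ReIm /= ?addr0.
apply: (mulfI (qfac_neq0 (- Num.floor p.1) (toC p))).
rewrite /qfac -qfp -qgp -E; apply: H; split => //=.
rewrite in_itv/= rmorphN; have := floor_le p.1; have := floorD1_gt p.1.
by rewrite intrD1 => h1 h2; apply/andP; split; lra.
Qed.

End NullSets.

(** * Goursat's theorem *)

Section Goursat.
Context {R : realType}.
Local Notation nc := (@Normc.normc R).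
Local Notation mu := (@lebesgue_measure R).
Implicit Types (f g h : R[i] -> R[i]) (z : R[i]) (u v : R -> R[i]) (a b c d : R).

Definition ccont u := continuous (fun t => complex.Re (u t)) /\
  continuous (fun t => complex.Im (u t)).

Definition cI u a b : R[i] :=
  (\int[mu]_(t in `[a, b]) complex.Re (u t)) +i* (\int[mu]_(t in `[a, b]) complex.Im (u t)).

Lemma segment_integrable (w : R -> R) a b : continuous w ->
  mu.-integrable `[a, b] (EFin \o w).
Proof.
move=> cw; apply: continuous_compact_integrable; first exact: segment_compact.
exact: continuous_subspaceT.
Qed.

Lemma segment_split (w : R -> R) a c b : continuous w -> a <= c -> c <= b ->
  \int[mu]_(t in `[a, b]) w t = \int[mu]_(t in `[a, c]) w t + \int[mu]_(t in `[c, b]) w t.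
Proof.
move=> cw ac cb.
have := @Rintegral_itvB _ w (BLeft a) (BRight b) c (segment_integrable a b cw).
rewrite !bnd_simp => /(_ ac cb) H.
rewrite -(@Rintegral_itv_obnd_cbnd _ c); last first.
  apply: integrableS (segment_integrable c b cw) => //; try exact: measurable_itv.
  by move=> x /=; rewrite !in_itv/= => /andP[/ltW -> ->].
by rewrite -H addrC subrK.
Qed.

Lemma cI_split u a c b : ccont u -> a <= c -> c <= b -> cI u a b = cI u a c + cI u c b.
Proof.
by move=> [c1 c2] ac cb; apply: complex_ext; rewrite ReIm /=; exact: segment_split.
Qed.

Lemma segment_bound (w : R -> R) a b (M : R) : continuous w -> a <= b ->
  (forall t, a <= t <= b -> `|w t| <= M) -> `|\int[mu]_(t in `[a, b]) w t| <= M * (b - a).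
Proof.
move=> cw ab wM; apply: le_trans (le_normr_Rintegral _ (segment_integrable a b cw)) _ => //.
have -> : M * (b - a) = \int[mu]_(t in `[a, b]) M.
  rewrite Rintegral_cst//= lebesgue_measure_itv/= lte_fin.
  have [//|ba] := ltP a b.
  by have -> : a = b by [apply/eqP; rewrite eq_le ab ba]; rewrite subrr.
apply: le_Rintegral => //.
- by apply: segment_integrable => t; apply: continuous_comp; [exact: cw|exact: norm_continuous].
- by apply: segment_integrable => t; exact: cvg_cst.
Qed.

Lemma cI_bound u a b (M : R) : ccont u -> a <= b ->
  (forall t, a <= t <= b -> nc (u t) <= M) -> nc (cI u a b) <= 2 * M * (b - a).
Proof.
move=> [c1 c2] ab uM; apply: le_trans (nc_le_ReIm _) _ => /=.
rewrite -mulrA mulr_natl mulr2n; apply: lerD; apply: segment_bound => // t h.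
  exact: le_trans (Re_le_nc _) (uM t h).
exact: le_trans (Im_le_nc _) (uM t h).
Qed.

Lemma cI_lin u v (k : R[i]) a b : ccont u -> ccont v ->
  cI (fun t => k * u t + v t) a b = k * cI u a b + cI v a b.
Proof.
move=> [u1 u2] [v1 v2].
have I := fun w cw => @segment_integrable w a b cw.
have L (k1 k2 : R) (w1 w2 w3 : R -> R) : continuous w1 -> continuous w2 -> continuous w3 ->
    \int[mu]_(t in `[a, b]) (k1 * w1 t + k2 * w2 t + w3 t) =
    k1 * \int[mu]_(t in `[a, b]) w1 t + k2 * \int[mu]_(t in `[a, b]) w2 t +
    \int[mu]_(t in `[a, b]) w3 t.
  move=> h1 h2 h3.
  have c1 : continuous (fun t => k1 * w1 t) by move=> t; apply: cvgM; [exact: cvg_cst|exact: h1].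
  have c2 : continuous (fun t => k2 * w2 t) by move=> t; apply: cvgM; [exact: cvg_cst|exact: h2].
  rewrite RintegralD//; [|by apply: I => t; apply: cvgD; [exact: c1|exact: c2]|exact: I].
  by rewrite RintegralD//; [|exact: I|exact: I]; rewrite !RintegralZl//; exact: I.
apply: complex_ext; rewrite !ReIm /=.
  rewrite -mulNr -L//; apply: eq_Rintegral => t _; rewrite !ReIm; ring.
rewrite -L//; apply: eq_Rintegral => t _; rewrite !ReIm; ring.
Qed.

Definition hseg h c : R -> R[i] := fun t => h (t +i* c).
Definition vseg h a : R -> R[i] := fun t => h (a +i* t).

Lemma ccont_hseg h c : cont h -> ccont (hseg h c).
Proof.
move=> [h1 h2]; have cp : continuous (fun t : R => (t, c)).
  by move=> t; apply: (@cvg_pair _ _ _ (nbhs t) (nbhs t) (nbhs c) _ _ _ id (cst c)); [exact: cvg_id|exact: cvg_cst].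
split => t.
  exact: (continuous_comp (f := fun t : R => (t, c)) (g := rpart h) (cp t) (h1 _)).
exact: (continuous_comp (f := fun t : R => (t, c)) (g := ipart h) (cp t) (h2 _)).
Qed.

Lemma ccont_vseg h a : cont h -> ccont (vseg h a).
Proof.
move=> [h1 h2]; have cp : continuous (fun t : R => (a, t)).
  by move=> t; apply: (@cvg_pair _ _ _ (nbhs t) (nbhs a) (nbhs t) _ _ _ (cst a) id); [exact: cvg_cst|exact: cvg_id].
split => t.
  exact: (continuous_comp (f := fun t : R => (a, t)) (g := rpart h) (cp t) (h1 _)).
exact: (continuous_comp (f := fun t : R => (a, t)) (g := ipart h) (cp t) (h2 _)).
Qed.

Definition bdry h a b c d : R[i] :=
  cI (hseg h c) a b - cI (hseg h d) a b + 'i%C * cI (vseg h b) c d - 'i%C * cI (vseg h a) c d.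

Lemma bdry_lin h g (k : R[i]) a b c d : cont h -> cont g ->
  bdry (fun z => k * h z + g z) a b c d = k * bdry h a b c d + bdry g a b c d.
Proof.
move=> ch cg; rewrite /bdry.
have H y : cI (hseg (fun z => k * h z + g z) y) a b = k * cI (hseg h y) a b + cI (hseg g y) a b.
  by apply: cI_lin; exact: ccont_hseg.
have V x : cI (vseg (fun z => k * h z + g z) x) c d = k * cI (vseg h x) c d + cI (vseg g x) c d.
  by apply: cI_lin; exact: ccont_vseg.
by rewrite !H !V; ring.
Qed.

Lemma bdry_hsplit h a m b c d : cont h -> a <= m -> m <= b ->
  bdry h a b c d = bdry h a m c d + bdry h m b c d.
Proof.
move=> ch am mb; rewrite /bdry.
rewrite (cI_split (ccont_hseg c ch) am mb) (cI_split (ccont_hseg d ch) am mb); ring.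
Qed.

Lemma bdry_vsplit h a b c m d : cont h -> c <= m -> m <= d ->
  bdry h a b c d = bdry h a b c m + bdry h a b m d.
Proof.
move=> ch hermite_cst md; rewrite /bdry.
rewrite (cI_split (ccont_vseg a ch) hermite_cst md) (cI_split (ccont_vseg b ch) hermite_cst md); ring.
Qed.

Lemma bdry_bound h a b c d (M : R) : cont h -> a <= b -> c <= d ->
  (forall x y, a <= x <= b -> c <= y <= d -> nc (h (x +i* y)) <= M) ->
  nc (bdry h a b c d) <= 4 * M * ((b - a) + (d - c)).
Proof.
move=> ch ab cd hM.
have H y : c <= y <= d -> nc (cI (hseg h y) a b) <= 2 * M * (b - a).
  by move=> hy; apply: cI_bound (ccont_hseg y ch) ab _ => t ht; exact: hM.
have V x : a <= x <= b -> nc ('i%C * cI (vseg h x) c d) <= 2 * M * (d - c).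
  move=> hx; rewrite ncM nc_i mul1r.
  by apply: cI_bound (ccont_vseg x ch) cd _ => t ht; exact: hM.
have Hc := H c; have Hd := H d; have Va := V a; have Vb := V b.
rewrite !lexx ?ab ?cd /= in Hc Hd Va Vb.
rewrite /bdry; apply: le_trans (ncB _ _) _.
apply: (@le_trans _ _ ((2 * M * (b - a) + 2 * M * (b - a) + 2 * M * (d - c)) + 2 * M * (d - c))).
  apply: lerD; last exact: Va.
  apply: le_trans (ncD _ _) _; apply: lerD; last exact: Vb.
  by apply: le_trans (ncB _ _) _; apply: lerD; [exact: Hc|exact: Hd].
by rewrite le_eqVlt; apply/orP; left; apply/eqP; ring.
Qed.

Lemma cI_FTC u v a b : a <= b -> ccont u ->
  (forall t : R, is_derive t 1 (fun s => complex.Re (v s)) (complex.Re (u t))) ->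
  (forall t : R, is_derive t 1 (fun s => complex.Im (v s)) (complex.Im (u t))) ->
  cI u a b = v b - v a.
Proof.
move=> + [c1 c2] d1 d2; rewrite le_eqVlt => /predU1P[<-|ab].
  by rewrite subrr /cI !set_itv1 !Rintegral_set1.
by apply: complex_ext; rewrite ?ReB ?ImB /= /Rintegral; [rewrite (FTC_line ab d1 c1)|rewrite (FTC_line ab d2 c2)].
Qed.

(** The increments of the primitive along the four sides add up to zero. *)
Lemma bdry_primitive F h a b c d : cont h -> cdiff F h -> a <= b -> c <= d ->
  bdry h a b c d = 0.
Proof.
move=> ch dF ab cd; have dx := pderx_cdiff dF; have dy := pdery_cdiff dF.
have H y : cI (hseg h y) a b = F (b +i* y) - F (a +i* y).
  apply: (@cI_FTC _ (hseg F y)) => //; first exact: ccont_hseg.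
    by move=> t; have [/is_derive_dirx ? _] := dx (t, y).
  by move=> t; have [_ /is_derive_dirx ?] := dx (t, y).
have V x : 'i%C * cI (vseg h x) c d = F (x +i* d) - F (x +i* c).
  have <- : cI (vseg (fun z => 'i%C * h z) x) c d = 'i%C * cI (vseg h x) c d.
    have c0 : cont (fun=> 0 : R[i]) by exact: cont_cst.
    have := cI_lin 'i%C c d (ccont_vseg x ch) (ccont_vseg x c0).
    have -> : cI (vseg (fun=> 0) x) c d = 0.
      by rewrite /cI /vseg /= !Rintegral_cst//= mul0r.
    rewrite addr0 => <-; rewrite /cI /vseg; congr (_ +i* _);
      by apply: eq_Rintegral => t _; rewrite addr0.
  apply: (@cI_FTC _ (vseg F x)) => //.
  - by apply: ccont_vseg; apply: contM => //; exact: cont_cst.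
  - by move=> t; have [/is_derive_diry ? _] := dy (x, t).
  - by move=> t; have [_ /is_derive_diry ?] := dy (x, t).
by rewrite /bdry !H !V; ring.
Qed.

(** Complex differentiability, without control of the remainder beyond its order:
    this is all that the definition of an entire function provides. *)
Definition eps_differentiable h := forall z, exists l : R[i], forall eps : R, 0 < eps ->
  exists2 dl : R, 0 < dl & forall s, nc s < dl -> nc (h (z + s) - h z - s * l) <= eps * nc s.

Lemma eps_differentiable_cont h : eps_differentiable h -> cont h.
Proof.
move=> H.
have K p (eps : R) : 0 < eps -> \forall q \near p, nc (h (toC q) - h (toC p)) <= eps.
  move=> e0; have [l /(_ 1 ltr01)[dl dl0 Hl]] := H (toC p).
  have C0 : 0 < nc l + 1 by rewrite ltr_wpDl ?nc_ge0.
  pose d := Num.min dl (eps / (nc l + 1)).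
  have d0 : 0 < d by rewrite lt_min dl0 divr_gt0.
  have : \forall q \near p, ball p (d / 2) q by apply: nbhsx_ballx; rewrite divr_gt0.
  apply: filterS => q [q1 q2].
  have le2 : nc (toC q - toC p) < d.
    apply: le_lt_trans (nc_le_ReIm _) _; rewrite !ReIm /=.
    by move: q1 q2; rewrite /ball /= distrC (distrC p.2) => q1 q2; lra.
  set s := toC q - toC p in le2 *.
  have -> : h (toC q) = h (toC p + s) by congr h; rewrite /s addrC subrK.
  have -> : h (toC p + s) - h (toC p) = (h (toC p + s) - h (toC p) - s * l) + s * l by rewrite subrK.
  apply: le_trans (ncD _ _) _; rewrite ncM.
  have sl : nc s < dl by rewrite (lt_le_trans le2)// ge_min lexx.
  apply: (@le_trans _ _ ((nc l + 1) * nc s)).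
    by have := Hl s sl; move: (nc (_ - _)) (nc s) (nc l) => r1 r2 r3; lra.
  rewrite mulrC -ler_pdivlMr//; apply: le_trans (ltW le2) _.
  by rewrite ge_min lexx orbT.
split=> p; apply/cvgrPdist_le => eps e0; apply: filterS (K p eps e0) => q;
  apply: le_trans; rewrite distrC.
  by apply: le_trans (Re_le_nc _); rewrite ReB.
by apply: le_trans (Im_le_nc _); rewrite ImB.
Qed.

(** A primitive of an affine function. *)
Lemma cdiff_lin2 (k l z0 : R[i]) : cdiff (fun z => k * z + l / 2 * (z * z + (- 2 * z0) * z))
  (fun z => k + l * (z - z0)).
Proof.
move=> z; exists (nc (l / 2)) => s _.
have -> : k * (z + s) + l / 2 * ((z + s) * (z + s) + - 2 * z0 * (z + s)) -
   (k * z + l / 2 * (z * z + - 2 * z0 * z)) - s * (k + l * (z - z0)) = l / 2 * s ^+ 2.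
  by field.
by rewrite ncM ncX.
Qed.

Section Bisection.
Variables (h : R[i] -> R[i]) (a0 c0 w k : R).
Hypotheses (eh : eps_differentiable h) (w0 : 0 <= w) (k0 : 0 <= k).

Let ch := eps_differentiable_cont eh.
Let J n (p : R * R) := bdry h p.1 (p.1 + w / 2 ^+ n) p.2 (p.2 + k / 2 ^+ n).

Lemma half_pow (x : R) n : x / 2 ^+ n = x / 2 ^+ n.+1 + x / 2 ^+ n.+1.
Proof. by rewrite exprS; field; rewrite expf_neq0. Qed.

(** If all four quarters carried less than a quarter of the integral, the triangle
    inequality would fail. *)
Lemma quarter n p : exists q : R * R, [/\ q.1 = p.1 \/ q.1 = p.1 + w / 2 ^+ n.+1,
  q.2 = p.2 \/ q.2 = p.2 + k / 2 ^+ n.+1 & nc (J n p) <= 4 * nc (J n.+1 q)].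
Proof.
set W := w / 2 ^+ n.+1; set K := k / 2 ^+ n.+1.
have W0 : 0 <= W by rewrite divr_ge0// exprn_ge0.
have K0 : 0 <= K by rewrite divr_ge0// exprn_ge0.
have E : J n p = J n.+1 p + J n.+1 (p.1, p.2 + K) +
    (J n.+1 (p.1 + W, p.2) + J n.+1 (p.1 + W, p.2 + K)).
  rewrite /J /= (half_pow w) (half_pow k) -/W -/K (addrA _ W) (addrA _ K).
  have x1 : p.1 <= p.1 + W by rewrite lerDl.
  have x2 : p.1 + W <= p.1 + W + W by rewrite lerDl.
  have y1 : p.2 <= p.2 + K by rewrite lerDl.
  have y2 : p.2 + K <= p.2 + K + K by rewrite lerDl.
  rewrite (bdry_hsplit _ _ ch x1 x2) (bdry_vsplit _ _ ch y1 y2).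
  by rewrite (bdry_vsplit (p.1 + W) _ ch y1 y2).
have tri : nc (J n p) <= nc (J n.+1 p) + nc (J n.+1 (p.1, p.2 + K)) +
   (nc (J n.+1 (p.1 + W, p.2)) + nc (J n.+1 (p.1 + W, p.2 + K))).
  rewrite E; apply: le_trans (ncD _ _) _; apply: lerD; exact: ncD.
have [h1|h1] := leP (nc (J n p)) (4 * nc (J n.+1 p)).
  by exists p; split => //; left.
have [h2|h2] := leP (nc (J n p)) (4 * nc (J n.+1 (p.1, p.2 + K))).
  by exists (p.1, p.2 + K); split => //; [left|right].
have [h3|h3] := leP (nc (J n p)) (4 * nc (J n.+1 (p.1 + W, p.2))).
  by exists (p.1 + W, p.2); split => //; [right|left].
exists (p.1 + W, p.2 + K); split; [by right|by right|].
move: tri h1 h2 h3; move: (nc _) (nc _) (nc _) (nc _) (nc _) => r1 r2 r3 r4 r5; lra.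
Qed.

(** The boundary integral of a complex differentiable function vanishes: of
    nested quarters carrying a proportional share of it, the last ones lie in
    a neighbourhood of a point where the function is almost affine. *)
Lemma goursat0 : bdry h a0 (a0 + w) c0 (c0 + k) = 0.
Proof.
have [st Hst] := choice (fun np : nat * (R * R) => quarter np.1 np.2).
pose P := fix P n := if n is n'.+1 then st (n', P n') else (a0, c0).
have PS n : P n.+1 = st (n, P n) by [].
have JP n : nc (J 0 (a0, c0)) <= 4 ^+ n * nc (J n (P n)).
  elim: n => [|n ih]; first by rewrite expr0 mul1r.
  apply: le_trans ih _; rewrite exprSr -mulrA ler_wpM2l ?exprn_ge0//.
  by have [_ _] := Hst (n, P n).
have pos (x : R) n : 0 <= x -> 0 <= x / 2 ^+ n by move=> ?; rewrite divr_ge0// exprn_ge0.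
have limit (u : nat -> R) (x : R) : 0 <= x ->
    (forall n, u n.+1 = u n \/ u n.+1 = u n + x / 2 ^+ n.+1) ->
    exists l, forall n, u n <= l <= u n + x / 2 ^+ n.
  move=> x0 ux.
  have nd : nondecreasing_seq u.
    apply/nondecreasing_seqP => n; have := pos x n.+1 x0.
    by case: (ux n) => ->; lra.
  have ni : nonincreasing_seq (fun n => u n + x / 2 ^+ n).
    apply/nonincreasing_seqP => n; have := pos x n.+1 x0; rewrite [x / 2 ^+ n]half_pow.
    by case: (ux n) => ->; lra.
  have ub n m : u m <= u n + x / 2 ^+ n.
    have := nd _ _ (leq_maxr n m); have := ni _ _ (leq_maxl n m).
    by have := pos x (maxn n m) x0 => /= h1 h2 h3; lra.
  have cu : cvgn u.
    by apply: nondecreasing_is_cvgn => //; exists (u 0%N + x / 2 ^+ 0) => _ [m _ <-].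
  exists (limn u) => n; rewrite nondecreasing_cvgn_le//=.
  by apply: limr_le => //; exact: nearW.
have [x Hx] : exists l, forall n, (P n).1 <= l <= (P n).1 + w / 2 ^+ n.
  by apply: limit => // n; rewrite PS; have [] := Hst (n, P n).
have [y Hy] : exists l, forall n, (P n).2 <= l <= (P n).2 + k / 2 ^+ n.
  by apply: limit => // n; rewrite PS; have [_] := Hst (n, P n).
set z0 : R[i] := x +i* y; have [l Hl] := eh z0.
suff J0 : nc (J 0 (a0, c0)) = 0.
  by have /eqP := J0; rewrite nc_eq0 /J /= expr0 !divr1 => /eqP.
apply/eqP; rewrite eq_le nc_ge0 andbT leNgt; apply/negP => Jpos.
pose D := w + k; have D0 : 0 <= D by rewrite addr_ge0.
(* with this choice the final bound is half of the integral; D + 1 avoids a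
   division by 0 for a degenerate rectangle *)
pose eps := nc (J 0 (a0, c0)) / (8 * (D + 1) ^+ 2).
have D1 : 0 < D + 1 by rewrite ltr_wpDl.
have eps0 : 0 < eps by rewrite divr_gt0// mulr_gt0// exprn_gt0.
have [dl dl0 Hdl] := Hl eps eps0.
have [n nD] : exists n, D / 2 ^+ n < dl.
  have : (fun n => D * 2^-1 ^+ n) @ \oo --> (0 : R).
    rewrite -[X in _ --> X](mulr0 D); apply: cvgM; first exact: cvg_cst.
    by apply: cvg_expr; rewrite ger0_norm; lra.
  move/cvgrPdist_lt => /(_ _ dl0)[n _ /(_ n (leqnn n))] /=.
  rewrite sub0r normrN exprVn => h1; exists n.
  by rewrite (le_lt_trans (ler_norm _)).
have /andP[x1 x2] := Hx n; have /andP[y1 y2] := Hy n.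
pose A z := h z0 + l * (z - z0).
have dA := cdiff_lin2 (h z0) l z0.
have cA : cont A.
  apply: contD; first exact: cont_cst.
  apply: contM; first exact: cont_cst.
  by apply: contD; [exact: cont_cdiff cdiff_id|exact: cont_cst].
pose rest z := h z + (-1) * A z.
have cr : cont rest by apply: contD => //; apply: contM => //; exact: cont_cst.
have ab : (P n).1 <= (P n).1 + w / 2 ^+ n by rewrite lerDl pos.
have cd : (P n).2 <= (P n).2 + k / 2 ^+ n by rewrite lerDl pos.
have Jr : J n (P n) = bdry rest (P n).1 ((P n).1 + w / 2 ^+ n) (P n).2 ((P n).2 + k / 2 ^+ n).
  have := bdry_lin 1 (P n).1 ((P n).1 + w / 2 ^+ n) (P n).2 ((P n).2 + k / 2 ^+ n) cr cA.
  have -> : (fun z => 1 * rest z + A z) = h by apply/funext => z; rewrite /rest; ring.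
  by rewrite (bdry_primitive cA dA ab cd) mul1r addr0 => <-.
have small : nc (J n (P n)) <= 4 * (eps * (D / 2 ^+ n)) * (D / 2 ^+ n).
  rewrite Jr; have -> : D / 2 ^+ n = (P n).1 + w / 2 ^+ n - (P n).1 + ((P n).2 + k / 2 ^+ n - (P n).2).
    by rewrite /D mulrDl; ring.
  apply: bdry_bound => // x' y' /andP[hx1 hx2] /andP[hy1 hy2].
  set s : R[i] := (x' - x) +i* (y' - y).
  have zs : x' +i* y' = z0 + s by apply: complex_ext; rewrite ReIm /= addrC subrK.
  have ns : nc s <= D / 2 ^+ n.
    apply: le_trans (nc_le_ReIm _) _; rewrite /= /D mulrDl; apply: lerD; rewrite ler_norml;
      apply/andP; split; lra.
  have -> : rest (x' +i* y') = h (z0 + s) - h z0 - s * l by rewrite zs /rest /A; ring.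
  apply: le_trans (Hdl _ (le_lt_trans ns nD)) _; rewrite ler_pM2l//.
  apply: le_trans ns _; rewrite /D mulrDl; lra.
have : nc (J 0 (a0, c0)) <= 4 * eps * D ^+ 2.
  apply: le_trans (JP n) _; apply: le_trans (ler_wpM2l _ small) _; first by rewrite exprn_ge0.
  rewrite le_eqVlt; apply/orP; left; apply/eqP.
  have -> : (4 : R) = 2 * 2 by ring.
  rewrite exprMn; field; rewrite expf_neq0//.
have : 4 * eps * D ^+ 2 <= 4 * eps * (D + 1) ^+ 2.
  rewrite ler_pM2l; last by rewrite mulr_gt0.
  by rewrite lerXn2r ?nnegrE ?(ltW D1)// lerDl.
have -> : 4 * eps * (D + 1) ^+ 2 = nc (J 0 (a0, c0)) / 2 by rewrite /eps; field; rewrite gt_eqF.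
by move=> h1 h2; have := le_trans h2 h1; lra.
Qed.

End Bisection.

Lemma goursat h a b c d : eps_differentiable h -> a <= b -> c <= d -> bdry h a b c d = 0.
Proof.
move=> eh ab cd; have -> : b = a + (b - a) by ring.
have -> : d = c + (d - c) by ring.
by apply: goursat0; rewrite ?subr_ge0.
Qed.

End Goursat.

(** * Entire functions belong to the lowest level *)

Section Holomorphic.
Context {R : realType}.
Local Notation nc := (@Normc.normc R).
Local Notation mu2 := (@lebesgue2 R).
Local Notation mu := (@lebesgue_measure R).
Local Notation S := (@strip R).
Local Notation T := (measurableTypeR R).
Variables (nu alpha : R).
Hypothesis nu_gt0 : 0 < nu.
Implicit Types (f g h : R[i] -> R[i]) (z : R[i]) (c : nat -> R[i]).
Local Notation e := (e nu alpha).
Local Notation synth := (synth nu alpha).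
Local Notation kap := (kap alpha).
Local Notation coef := (coef nu alpha).

Lemma entire_eps_differentiable f : entire f -> eps_differentiable f.
Proof.
move=> ef z; have /cvg_ex[/= l fl] := ef z; exists l => eps eps0.
have epsC : (0 : R[i]) < eps%:C by rewrite ltcR.
move/cvgrPdist_le : fl => /(_ _ epsC) /nbhs_ballP[d /= d0 Hd].
have [di dr] : complex.Im d = 0 /\ 0 < complex.Re d.
  by move: d0; rewrite ltcE => /andP[/eqP].
have dd : d = (complex.Re d)%:C by apply: complex_ext.
have nE (x : R[i]) : `|x| = (nc x)%:C by [].
exists (complex.Re d) => // s sd.
have [->|s0] := eqVneq s 0.
  by rewrite addr0 subrr mul0r subrr nc0 mulr0.
have := Hd s; rewrite /ball /= sub0r normrN nE [in X in X -> _]dd ltcR => /(_ sd s0).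
rewrite nE lecR => H.
have -> : f (z + s) - f z - s * l = - (s * (l - s^-1 *: (f (s *: 1 + z) - f z))).
  rewrite /GRing.scale /= mulr1 [s + z]addrC; field. exact: s0.
by rewrite ncN ncM mulrC ler_wpM2r// nc_ge0.
Qed.

Lemma entireM f g : entire f -> entire g -> entire (fun z => f z * g z).
Proof. by move=> ef eg z; exact: (derivableM (ef z) (eg z)). Qed.

Lemma cdiff_cst (k : R[i]) : cdiff (fun=> k) (fun=> 0).
Proof. by move=> z; exists 0 => s _; rewrite subrr mulr0 subr0 nc0 mul0r. Qed.

(** A theta series with a single nonzero term. *)
Lemma entire_exp (k : R) : entire (fun z => cexp ((2 * pi * k)%:C * 'i%C * z)).
Proof.
have kB j : `|(fun _ : nat => k) j| <= j%:R + `|k| by rewrite lerDr.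
pose d (j : nat) : R[i] := (j == 0%N)%:R.
have rd : rapid d.
  move=> K; exists 1 => -[|j]; first by rewrite /d eqxx nc1 expr0 mulr1.
  by have -> : d j.+1 = 0 by []; rewrite nc0 mul0r.
have := entire_cdiff (cdiff_theta kB rd).
have -> // : theta (fun=> k) d = fun z => cexp ((2 * pi * k)%:C * 'i%C * z).
apply/funext => z; rewrite /theta (csum_finite (n := 1)); last first.
  by move=> [//|j] _; rewrite /d /= mul0r.
by rewrite big_ord1 /d eqxx mul1r.
Qed.

Lemma synth0_entire c (M : R) : (forall j, nc (c j) <= M) -> entire (synth 0 c).
Proof.
move=> Hc; have rd := rapid_gauss alpha nu_gt0 Hc.
have -> : synth 0 c = fun z => (hermite_cst 0)%:C * (gaussC nu z * theta kap (fun j => c j * (psi_cst nu alpha j)%:C) z).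
  by apply/funext => z; rewrite synthE /Z W0.
apply: entireM; first exact: entire_cdiff (cdiff_cst _).
apply: entireM; first exact: entire_cdiff (cdiff_gauss nu).
exact: entire_cdiff (cdiff_theta (kapB alpha) rd).
Qed.

Lemma quasi_lin (a : R[i]) f g z : quasi_periodic_at alpha nu f z ->
  quasi_periodic_at alpha nu g z -> quasi_periodic_at alpha nu (fun z => a * f z + g z) z.
Proof. by move=> qf qg m; rewrite qf qg; ring. Qed.

Lemma strip_eq (u v : R * R -> R) : mu2.-integrable S (EFin \o u) ->
  mu2.-integrable S (EFin \o v) ->
  (forall y, (\int[mu]_(x in `[0%R, 1%R]) (u (x, y))%:E =
    \int[mu]_(x in `[0%R, 1%R]) (v (x, y))%:E)%E) ->
  \int[mu2]_(p in S) u p = \int[mu2]_(p in S) v p.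
Proof.
move=> iu iv H.
have m1 : measurable (`[0, 1]%classic : set T) by exact: measurable_itv.
have [_ Hu] := fubini_rect m1 (@measurableT _ T) iu.
have [_ Hv] := fubini_rect m1 (@measurableT _ T) iv.
rewrite /Rintegral /strip Hu Hv; congr fine; apply: eq_integral => y _; exact: H.
Qed.

Lemma EFin_segment (w : R -> R) : continuous w ->
  (\int[mu]_(t in `[0%R, 1%R]) (w t)%:E = (\int[mu]_(t in `[0, 1]) w t)%:E)%E.
Proof.
move=> cw; rewrite /Rintegral fineK//.
by have := segment_integrable 0 1 cw; apply: integrable_fin_num; exact: measurable_itv.
Qed.

(** In Goursat's theorem for a rectangle whose width is the period, the
    integrals along the vertical sides cancel. *)
Lemma mean_const h : eps_differentiable h -> (forall z, h (z + 1) = h z) ->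
  forall y, cI (hseg h y) 0 1 = cI (hseg h 0) 0 1.
Proof.
move=> eh ph.
have V a b : cI (vseg h 1) a b = cI (vseg h 0) a b.
  have -> // : vseg h 1 = vseg h 0.
  apply/funext => t; rewrite /vseg.
  have -> : 1 +i* t = (0 +i* t) + 1 by apply: complex_ext; rewrite !ReIm /= ?add0r ?addr0.
  exact: ph.
have H a b : a <= b -> cI (hseg h a) 0 1 = cI (hseg h b) 0 1.
  move=> ab; have := goursat eh ler01 ab; rewrite /bdry V addrK.
  by move/eqP; rewrite subr_eq0 => /eqP.
by move=> y; case: (leP y 0) => [/H//|/ltW/H ->].
Qed.

(** Divided by the exponential of frequency kappa (j), an entire function of the
    space is periodic, so that its means over horizontal periods do not depend on
    the height: the coefficient is a multiple of that of [e 0 j], which is zero. *)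
Lemma entire_coef f m j : entire f -> (forall z, quasi_periodic_at alpha nu f z) ->
  L2s nu f -> coef f m.+1 j = 0.
Proof.
move=> ef qf Lf.
pose q z := cexp ((- nu / 2)%:C * z ^+ 2) * cexp ((2 * pi * - kap j)%:C * 'i%C * z).
pose E z := gaussC nu z * wave kap j z.
have Eq z : E z * q z = 1.
  rewrite /E /q /gaussC /wave /freq mulrACA -!cexpD.
  rewrite -[RHS]cexp0; congr cexp.
  rewrite mulNr mulrN !(rmorphN (real_complex R)) /=; ring.
pose h z := f z * q z.
have hE z : f z = h z * E z by rewrite /h -mulrA [q z * _]mulrC Eq mulr1.
have qq z : E z != 0.
  by apply: mulf_neq0; exact: cexp_neq0.
have eh : eps_differentiable h.
  have e1 := entire_cdiff (cdiff_gauss (- nu)); have e2 := @entire_exp (- kap j).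
  exact: (entire_eps_differentiable (entireM ef (entireM e1 e2))).
have Eqf z : E (z + 1) = qfac nu alpha 1 z * E z.
  by rewrite /E -[1]/(1%:~R) (gaussC_int nu z 1) (wave_int alpha j z 1) /qfac; ring.
have ph z : h (z + 1) = h z.
  apply: (mulIf (qq (z + 1))); rewrite -hE Eqf mulrCA -hE -[1]/(1%:~R).
  by rewrite (qf z 1).
have EJ z : complex.Re (E z * (E z)^*%C) = sqc (E z) by rewrite mulcJ.
pose k0 : R := hermite_cst 0 * psi_cst nu alpha j; pose km : R := hermite_cst m.+1 * psi_cst nu alpha j.
pose H y := hp m.+1 (Num.sqrt (2 * nu) * y + Num.sqrt (2 / nu) * pi * kap j).
have e0E z : e 0 j z = k0%:C * E z.
  rewrite eE /= /k0 /E (rmorphM (real_complex R) (hermite_cst 0)) /= (rmorph1 (real_complex R)).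
  by move: (gaussC _ _) (wave _ _ _) (psi_cst _ _ _)%:C => x1 x2 x3; ring.
have emE z : e m.+1 j z = (km * H (complex.Im z))%:C * E z.
  rewrite eE -/(H (complex.Im z)) /km /E.
  move: (gaussC _ _) (wave _ _ _) (psi_cst _ _ _) (H _) => x1 x2 x3 x4.
  by rewrite !(rmorphM (real_complex R)) /=; ring.
(* the basis functions are real multiples, depending on the ordinate only, of
   the same function E, whose weighted squared modulus depends on the ordinate
   only: f enters its coefficient through the means of h = f / E *)
pose r y := km * H y * (sqw nu (e 0 j) (0, y) / k0 ^+ 2).
have k00 : k0 != 0.
  by have := lowest_cst_neq0 alpha nu_gt0 j; rewrite -nc_eq0 ncC normr_eq0.
have rE p : sqc (E (toC p)) * wt nu p = sqw nu (e 0 j) (0, p.2) / k0 ^+ 2.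
  have -> : sqw nu (e 0 j) (0, p.2) = sqw nu (e 0 j) p by rewrite !sqw_e.
  rewrite /sqw e0E sqcM sqcC; field.
  exact: k00.
have ipsf p : ips nu f (e m.+1 j) (toC p) = (r p.2)%:C * h (toC p).
  rewrite /ips toCK emE hE JM JC.
  have -> : h (toC p) * E (toC p) * ((km * H (complex.Im (toC p)))%:C * (E (toC p))^*%C) * (wt nu p)%:C =
     h (toC p) * (km * H p.2)%:C * ((E (toC p) * (E (toC p))^*%C) * (wt nu p)%:C) by rewrite /=; ring.
  rewrite mulcJ -[(sqc _)%:C * _]rmorphM rE /r; move: (km * _) (_ / k0 ^+ 2) => x y.
  by rewrite (rmorphM (real_complex R)) /=; ring.
have ipse p : ips nu (e 0 j) (e m.+1 j) (toC p) = (r p.2)%:C * k0%:C.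
  rewrite /ips toCK emE e0E JM JC.
  have -> : k0%:C * E (toC p) * ((km * H (complex.Im (toC p)))%:C * (E (toC p))^*%C) * (wt nu p)%:C =
     k0%:C * (km * H p.2)%:C * ((E (toC p) * (E (toC p))^*%C) * (wt nu p)%:C) by rewrite /=; ring.
  rewrite mulcJ -[(sqc _)%:C * _]rmorphM rE /r; move: (km * _) (_ / k0 ^+ 2) => x y.
  by rewrite (rmorphM (real_complex R)) /=; ring.
have [I1 I2] := ips_integrable Lf (e_L2s alpha nu_gt0 m.+1 j).
have [J1 _] := ips_integrable (e_L2s alpha nu_gt0 0 j) (e_L2s alpha nu_gt0 m.+1 j).
have r0 : \int[mu2]_(p in S) rpart (ips nu (e 0 j) (e m.+1 j)) p = 0.
  have := e_orthonormal alpha nu_gt0 0 m.+1 j j; rewrite innerE /= => /(congr1 (@complex.Re R)) /=.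
  by [].
have MC := mean_const eh ph.
have mS := @strip_measurable R.
have [ch1 ch2] : cont h by exact: eps_differentiable_cont.
have main (w : R * R -> R) (u : R * R -> R) (l : R) : mu2.-integrable S (EFin \o w) ->
    (forall p, w p = r p.2 * u p) -> (forall y, continuous (fun x => u (x, y))) ->
    (forall y, \int[mu]_(x in `[0, 1]) u (x, y) = l) -> \int[mu2]_(p in S) w p = 0.
  move=> iw wE cu ul.
  have iv : mu2.-integrable S (EFin \o (fun p => l / k0 * rpart (ips nu (e 0 j) (e m.+1 j)) p)).
    by have := integrableZl mS (l / k0) J1.
  rewrite (strip_eq iw iv); first by rewrite RintegralZl// r0 mulr0.
  move=> y; under eq_integral do rewrite wE /=.
  under [RHS]eq_integral do rewrite /rpart ipse -rmorphM /=.
  have cr : continuous (fun x => r y * u (x, y)).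
    by move=> x; apply: cvgM; [exact: cvg_cst|exact: cu].
  have cl : continuous (fun _ : R => l / k0 * (r y * k0)) by move=> x; exact: cvg_cst.
  rewrite (EFin_segment cr) (EFin_segment cl); congr (_%:E).
  rewrite RintegralZl//; last exact: segment_integrable (cu y).
  rewrite ul Rintegral_cst//= mu01 /=; field.
  exact: k00.
have -> : coef f m.+1 j = inner nu f (e m.+1 j) by [].
rewrite innerE; apply: complex_ext => /=.
  apply: (main _ (rpart h) (complex.Re (cI (hseg h 0) 0 1)) I1).
  - by move=> p; rewrite /rpart ipsf ReM ReC ImC mul0r subr0.
  - by move=> y; have [] := ccont_hseg y (conj ch1 ch2).
  - by move=> y; rewrite -(MC y).
apply: (main _ (ipart h) (complex.Im (cI (hseg h 0) 0 1)) I2).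
- by move=> p; rewrite /ipart ipsf ImM ReC ImC mul0r addr0.
- by move=> y; have [] := ccont_hseg y (conj ch1 ch2).
- by move=> y; rewrite -(MC y).
Qed.

End Holomorphic.

(** * The spectral decomposition *)

Section Spectrum.
Context {R : realType}.
Variables (nu alpha : R).
Hypothesis nu_gt0 : 0 < nu.
Implicit Types (f g h : R[i] -> R[i]) (z : R[i]) (c : nat -> R[i]).
Local Notation e := (e nu alpha).
Local Notation synth := (synth nu alpha).
Local Notation coef := (coef nu alpha).
Local Notation proj := (proj nu alpha).
Local Notation Es m := (Espace alpha nu m%:R).
Local Notation L2 := (L2space alpha nu).

Lemma L2space_L2s f : L2 f -> L2s nu f.
Proof. by move=> [mf _ Hf]. Qed.

Lemma Espace_L2s (lam : R[i]) f : Espace alpha nu lam f -> L2s nu f.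
Proof. by move=> [sf _ _ Hf]; split => //; exact: smooth_measurable. Qed.

Lemma coef_lin (a : R[i]) f g m j : L2s nu f -> L2s nu g ->
  coef (fun z => a * f z + g z) m j = a * coef f m j + coef g m j.
Proof. by move=> Lf Lg; apply: inner_linear => //; exact: e_L2s. Qed.

(** Orthogonality against the basis functions, which are eigenfunctions with
    real eigenvalues. *)
Lemma Espace_coef (lam : R[i]) f m j : Espace alpha nu lam f -> lam != m%:R -> coef f m j = 0.
Proof.
move=> Ef lm; have Lf := Espace_L2s Ef; have [sf qf hf _] := Ef.
have := eigen_orthogonal sf (e_smooth alpha nu_gt0 m j) (quasi_qp1 qf)
  (@e_qp1 _ _ alpha nu_gt0 m j) Lf (e_L2s alpha nu_gt0 m j) (opA_e alpha nu_gt0 m j)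
  (opAstar_e alpha nu_gt0 m j) hf (landau_e alpha nu_gt0 m j).
have kJ : (m%:R : R[i])^*%C = m%:R by apply: complex_ext; rewrite !ReIm ?Im_nat ?oppr0.
rewrite JM JC kJ -mulrBr => /eqP; rewrite mulf_eq0 => /orP[|/eqP//].
rewrite mulf_eq0 subr_eq0 (negbTE lm) orbF -nc_eq0 ncC normr_eq0.
by rewrite gt_eqF.
Qed.

(** The difference of both sides has no coefficient, hence vanishes almost
    everywhere by the expansion, and everywhere by continuity. *)
Lemma synth_eq f m : cont f -> (forall z, quasi_periodic_at alpha nu f z) -> L2s nu f ->
  (forall k j, k != m -> coef f k j = 0) -> f = synth m (coef f m).
Proof.
move=> cf qf Lf H; have l2c := l2_coef alpha nu_gt0 m Lf; have Lp := L2s_proj alpha nu_gt0 m Lf.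
have [sp qp _ _] := synth_Espace alpha nu_gt0 m l2c.
pose d z := (-1) * synth m (coef f m) z + f z.
have Ld : L2s nu d by apply: L2sD => //; exact: L2sZ.
have d0 z : d z = 0.
  apply: (@cont_null _ nu alpha).
  - apply: contD => //; apply: contM; first exact: cont_cst.
    exact: cont_smooth.
  - by move=> w; apply: quasi_lin; [exact: qp|exact: qf].
  - rewrite (nrmE Ld) (coef0_nrm nu_gt0 (alpha := alpha) Ld)// => k j.
    rewrite coef_lin// coef_proj//; have [<-|mk] := eqVneq m k; first by rewrite mulN1r addNr.
    by rewrite mulr0 add0r H// eq_sym.
apply/funext => z; apply/eqP; rewrite -subr_eq0; apply/eqP.
by have := d0 z; rewrite /d mulN1r addrC.
Qed.

Lemma Espace_synth m f : Es m f -> f = synth m (coef f m).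
Proof.
move=> Ef; have Lf := Espace_L2s Ef; have [sf qf _ _] := Ef; apply: synth_eq => //.
  exact: cont_smooth.
by move=> k j km; apply: Espace_coef Ef _; rewrite eqr_nat eq_sym.
Qed.

Lemma Fspace_L2s f : Fspace alpha nu f -> L2s nu f.
Proof.
move=> [ef _ Hf]; split => //; apply: cont_measurable_plane.
by apply: eps_differentiable_cont; exact: entire_eps_differentiable.
Qed.

Lemma Fspace_synth f : Fspace alpha nu f -> f = synth 0 (coef f 0).
Proof.
move=> Ff; have Lf := Fspace_L2s Ff; have [ef qf _] := Ff; apply: synth_eq => //.
  by apply: eps_differentiable_cont; exact: entire_eps_differentiable.
by move=> [//|k] j _; exact: entire_coef.
Qed.

Lemma Espace0 : Espace alpha nu 0 = Fspace alpha nu.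
Proof.
apply/seteqP; split => f Hf.
  have Ef : Es 0 f by [].
  have [_ qf _ Nf] := Hf; split => //; rewrite (Espace_synth Ef).
  have l2c := l2_coef alpha nu_gt0 0 (Espace_L2s Ef).
  exact: (@synth0_entire _ _ alpha nu_gt0 _ _ (l2_bounded l2c)).
rewrite (Fspace_synth Hf); apply: (@synth_Espace _ _ _ nu_gt0 0).
exact: (l2_coef alpha nu_gt0 0 (Fspace_L2s Hf)).
Qed.

Lemma e_Espace m j : Es m (e m j).
Proof.
split; [exact: e_smooth|by move=> z; exact: e_quasi|by move=> z; rewrite landau_e|].
by have [] := e_L2s alpha nu_gt0 m j.
Qed.

(** An eigenfunction for any other eigenvalue has no coefficient at all. *)
Lemma eigenvalues (lam : R[i]) :
  nontrivial_space (Espace alpha nu lam) <-> exists m : nat, lam = m%:R.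
Proof.
split=> [[f Ef [z fz]]|[m ->]]; last first.
  exists (e m 0); first exact: e_Espace.
  apply: contrapT => H; have e0 : e m 0 = fun=> 0.
    by apply/funext => z; apply/eqP/negPn/negP => ez; apply: H; exists z.
  have := e_orthonormal alpha nu_gt0 m m 0 0; rewrite !eqxx {1}e0 inner0l.
    by move/esym/eqP; rewrite oner_eq0.
  exact: e_L2s.
apply: contrapT => H; have Lf := Espace_L2s Ef; have [sf qf _ _] := Ef.
have nf : nrm nu f = 0.
  apply: (coef0_nrm nu_gt0 (alpha := alpha) Lf) => m j; apply: (Espace_coef _ Ef).
  by apply/eqP => lm; apply: H; exists m.
have := cont_null (cont_smooth sf) qf; rewrite (nrmE Lf) nf => /(_ erefl z) f0.
by rewrite f0 eqxx in fz.
Qed.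

Lemma Espace_infinite m : infinite_dimensional (Es m).
Proof.
move=> k; exists (fun i => e m i); split => [i|c Hc i]; first exact: e_Espace.
have H : inner nu (fun z => \sum_(l < k) c l * e m l z) (e m i) = c i.
  rewrite inner_suml; [|by move=> l; apply: L2sZ; exact: e_L2s|exact: e_L2s].
  rewrite (bigD1 i)//= innerZl ?e_orthonormal// ?eqxx ?mulr1; try exact: e_L2s.
  rewrite big1 ?addr0// => l li.
  rewrite innerZl ?e_orthonormal//; try exact: e_L2s.
  by rewrite eqxx /= val_eqE (negbTE li) mulr0.
rewrite -H; under [X in inner nu X _]funext => z do rewrite Hc.
by rewrite inner0l//; exact: e_L2s.
Qed.

Lemma L2space_lin (a : R[i]) f g : L2 f -> L2 g -> L2 (fun z => a * f z + g z).
Proof.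
move=> Hf Hg; have [mf Nf] := L2sD (L2sZ a (L2space_L2s Hf)) (L2space_L2s Hg).
split => //; have [_ qf _] := Hf; have [_ qg _] := Hg.
apply: negligibleS (negligibleU qf qg) => p /= H.
have [qfp|] := pselect (quasi_periodic_at alpha nu f (toC p)); last by left.
have [qgp|] := pselect (quasi_periodic_at alpha nu g (toC p)); last by right.
by exfalso; apply: H; exact: quasi_lin.
Qed.

Lemma L2space_everywhere f : L2s nu f -> (forall z, quasi_periodic_at alpha nu f z) -> L2 f.
Proof. by move=> [mf Nf] qf; split => //; exact: aeW. Qed.

Lemma Espace_L2 (lam : R[i]) f : Espace alpha nu lam f -> L2 f.
Proof.
by move=> Ef; have [_ qf _ _] := Ef; apply: L2space_everywhere qf; exact: Espace_L2s Ef.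
Qed.

Lemma L2space0 : L2 (fun=> 0).
Proof.
apply: L2space_everywhere; first exact: L2s0.
by move=> z m; rewrite mulr0.
Qed.

Lemma opA_lin (a : R[i]) f g : smooth f -> smooth g ->
  opA (fun z => a * f z + g z) = fun z => a * opA f z + opA g z.
Proof.
move=> sf sg; have Cf := C1_smooth sf; have Cg := C1_smooth sg.
have Caf : C1 (fun z => a * f z) by apply: C1M; [exact: C1_cst|exact: Cf].
have [_ dx dy _ _] := smooth_pder sf.
by rewrite (opAD Caf Cg) (opA_scale a dx dy).
Qed.

Lemma Espace_lin (lam a : R[i]) f g : Espace alpha nu lam f -> Espace alpha nu lam g ->
  Espace alpha nu lam (fun z => a * f z + g z).
Proof.
move=> Ef Eg; have [sf qf hf _] := Ef; have [sg qg hg _] := Eg; split.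
- exact: smooth_lin.
- by move=> z; apply: quasi_lin.
- move=> z; rewrite /landau opA_lin//.
  have Cf := C1_smooth (opA_smooth sf); have Cg := C1_smooth (opA_smooth sg).
  have Caf : C1 (fun z => a * opA f z) by apply: C1M; [exact: C1_cst|exact: Cf].
  rewrite (opAstarD _ Caf Cg) (opAstarZ _ _ Cf).
  by rewrite -/(landau nu f z) -/(landau nu g z) hf hg; ring.
- by have [] := L2sD (L2sZ a (Espace_L2s Ef)) (Espace_L2s Eg).
Qed.

Lemma coef_limit f m j (b : R[i]) : L2s nu f ->
  (forall eps : R, 0 < eps -> exists g, [/\ L2s nu g, coef g m j = b &
     (norm2 nu (fun z => f z - g z)%R < eps%:E)%E]) -> coef f m j = b.
Proof.
move=> Lf H; apply: inner_limit => //; first exact: e_L2s.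
move=> eps e0; have [g [Lg cg fg]] := H eps e0; exists g; split => //.
by rewrite -lee_fin -nrmE; [exact: ltW|exact: L2sB].
Qed.

Lemma coef_other m k j f : Es m f -> k != m -> coef f k j = 0.
Proof. by move=> Ef km; apply: Espace_coef Ef _; rewrite eqr_nat eq_sym. Qed.

(** An element of the space whose other components vanish is, up to a null
    set, its own component, which is smooth. *)
Lemma Espace_closed m : closed_subspace alpha nu (Es m).
Proof.
split.
- by move=> f; exact: Espace_L2.
- have -> : (fun=> 0) = synth m (fun=> 0).
    by apply/funext => z; rewrite (@synth_finite _ nu alpha m _ 0) ?big_ord0.
  by apply: (@synth_Espace _ _ _ nu_gt0 m _ 0) => n; rewrite big1// => i _; rewrite sqc0.
- by move=> a f g; exact: Espace_lin.
- move=> f Hf H; have Lf := L2space_L2s Hf.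
  have Lp := L2s_proj alpha nu_gt0 m Lf.
  have Ep : Es m (proj m f) by apply: synth_Espace => //; exact: l2_coef Lf.
  have cf k j : k != m -> coef f k j = 0.
    move=> km; apply: coef_limit => // eps e0; have [g Eg fg] := H eps e0.
    by exists g; split; [exact: Espace_L2s Eg|exact: coef_other Eg km|].
  exists (proj m f) => //; have [_ qf _] := Hf; have [_ qp _] := Espace_L2 Ep.
  apply: (ae_plane qf qp).
  have Ld : L2s nu (fun z => (-1) * proj m f z + f z) by apply: L2sD => //; exact: L2sZ.
  have d0 : norm2 nu (fun z => (-1) * proj m f z + f z)%R = 0%E.
    rewrite (nrmE Ld) (coef0_nrm nu_gt0 (alpha := alpha) Ld)// => k j.
    rewrite coef_lin// coef_proj//; have [<-|mk] := eqVneq m k; first by rewrite mulN1r addNr.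
    by rewrite mulr0 add0r cf// eq_sym.
  have := norm2_eq0_ae (proj1 Ld) d0; apply: negligibleS => p /=; apply: contra_not => K Sp.
  by apply/eqP; rewrite -subr_eq0 addrC -mulN1r; apply/eqP; exact: K.
Qed.

Lemma Espace_orthogonal m k : m != k -> orthogonal_spaces nu (Es m) (Es k).
Proof.
move=> mk f g Ef Eg; rewrite (Espace_synth Eg).
apply: (orth_synth nu_gt0 (Espace_L2s Ef) (l2_coef alpha nu_gt0 k (Espace_L2s Eg))) => j.
by apply: coef_other Ef _; rewrite eq_sym.
Qed.

Lemma norm2_cvg0 (F : nat -> R[i] -> R[i]) : (forall n, L2s nu (F n)) ->
  (forall eps : R, 0 < eps -> exists n0, forall n, (n0 <= n)%N -> nrm nu (F n) < eps) ->
  (fun n => norm2 nu (F n)) @ \oo --> 0%E.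
Proof.
move=> LF H; have -> : (fun n => norm2 nu (F n)) = fun n => (nrm nu (F n))%:E.
  by apply/funext => n; rewrite nrmE.
apply: cvg_EFin; first exact: nearW.
apply/cvgrPdist_lt => eps e0; have [n0 Hn0] := H eps e0.
exists n0 => // n /= n0n; rewrite sub0r normrN ger0_norm ?nrm_ge0//; exact: Hn0.
Qed.

Lemma norm2_cvg0_lt (F : nat -> R[i] -> R[i]) (eps : R) : 0 < eps ->
  (fun n => norm2 nu (F n)) @ \oo --> 0%E -> exists n0, forall n, (n0 <= n)%N ->
  (norm2 nu (F n) < eps%:E)%E.
Proof.
move=> e0 /fine_cvgP[[n1 _ h1]] /cvgrPdist_lt/(_ _ e0)[n2 _ h2].
exists (maxn n1 n2) => n; rewrite geq_max => /andP[k1 k2].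
have := h2 n k2; rewrite /= sub0r normrN => k3.
rewrite -(fineK (h1 n k1)) lte_fin; exact: le_lt_trans (ler_norm _) k3.
Qed.

Theorem L2_decomposition : hilbert_decomposition alpha nu L2 (fun m => Es m).
Proof.
split; [exact: Espace_closed|exact: Espace_orthogonal|].
apply/seteqP; split => [f Hf|f []//]; split => //.
have Lf := L2space_L2s Hf; exists (fun m => proj m f).
  by move=> m; apply: synth_Espace => //; exact: l2_coef Lf.
apply: norm2_cvg0; last exact: expansion.
by move=> n; apply: L2sB => //; apply: L2s_sum => m; exact: L2s_proj.
Qed.

(** Coefficients are continuous for the norm, hence can be computed term by
    term; conversely, the expansion of a function of the right-hand side has no
    term of index 0. *)
Lemma upper_levels f : hilbert_sum alpha nu (fun m => Es m.+1) f <->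
  L2 f /\ forall j, coef f 0 j = 0.
Proof.
split=> [[Hf [g Eg gf]]|[Hf H]].
  have Lg m : L2s nu (g m) by exact: Espace_L2s (Eg m).
  split => // j; apply: coef_limit; first exact: L2space_L2s.
  move=> eps e0; have [n0 Hn0] := norm2_cvg0_lt e0 gf.
  exists (fun z => \sum_(m < n0) g m z); split; [exact: L2s_sum| |exact: Hn0].
  rewrite /coef inner_suml//; last exact: e_L2s.
  by rewrite big1// => m _; exact: (coef_other j (Eg m)).
have Lf := L2space_L2s Hf; split => //; exists (fun m => proj m.+1 f).
  by move=> m; apply: synth_Espace => //; exact: l2_coef Lf.
apply: norm2_cvg0.
  by move=> n; apply: L2sB => //; apply: L2s_sum => m; exact: L2s_proj.
move=> eps e0; have [n0 Hn0] := expansion alpha nu_gt0 Lf e0.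
exists n0 => n n0n; have := Hn0 n.+1 (leq_trans n0n (leqnSn n)).
rewrite (_ : (fun z => _) = fun z => f z - \sum_(m < n) proj m.+1 f z)//.
apply/funext => z; rewrite big_ord_recl.
have -> : proj 0 f z = 0; last by rewrite add0r.
transitivity (synth 0 (coef f 0) z) => //.
by rewrite (@synth_finite _ nu alpha 0 _ 0) ?big_ord0.
Qed.

Lemma upper_closed :
  closed_subspace alpha nu (hilbert_sum alpha nu (fun m => Es m.+1)).
Proof.
split.
- by move=> f [].
- apply/upper_levels; split; first exact: L2space0.
  by move=> j; apply: inner0l; exact: e_L2s.
- move=> a f g /upper_levels[Hf cf] /upper_levels[Hg cg]; apply/upper_levels.
  split; first exact: L2space_lin.
  by move=> j; rewrite coef_lin ?cf ?cg ?mulr0 ?addr0//; exact: L2space_L2s.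
- move=> f Hf H; exists f; last exact: aeW.
  apply/upper_levels; split => // j; apply: coef_limit; first exact: L2space_L2s.
  move=> eps e0; have [g /upper_levels[Hg cg] fg] := H eps e0.
  by exists g; split => //; exact: L2space_L2s.
Qed.

Theorem Fspace_decomposition : orthogonal_decomposition2 alpha nu L2 (Fspace alpha nu)
  (hilbert_sum alpha nu (fun m => Es m.+1)).
Proof.
split; [by rewrite -Espace0; exact: (Espace_closed 0)|exact: upper_closed| |].
- move=> f g Ff /upper_levels[Hg cg]; have Lg := L2space_L2s Hg.
  have Lf := Fspace_L2s Ff; rewrite (inner_conj Lg Lf).
  rewrite {1}(Fspace_synth Ff) (orth_synth nu_gt0 Lg (l2_coef alpha nu_gt0 0 Lf)) ?conjc0//.
- apply/seteqP; split => [f Hf|f [g [h [Fg /upper_levels[Hh _] fE]]]].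
    have Lf := L2space_L2s Hf; have Lp := L2s_proj alpha nu_gt0 0 Lf.
    have Ep : Es 0 (proj 0 f) by apply: synth_Espace => //; exact: l2_coef Lf.
    exists (proj 0 f), (fun z => (-1) * proj 0 f z + f z); split.
    + by rewrite -Espace0.
    + apply/upper_levels; split; first by apply: L2space_lin => //; exact: Espace_L2 Ep.
      by move=> j; rewrite coef_lin// coef_proj// mulN1r addNr.
    + by move=> z; rewrite mulN1r addrA subrr add0r.
have -> : f = fun z => 1 * g z + h z by apply/funext => z; rewrite fE mul1r.
apply: L2space_lin => //; apply: (@Espace_L2 0); by rewrite Espace0.
Qed.

Lemma psi_e n : psi alpha nu n = e 0 (zi n).
Proof.
apply/funext => z; rewrite -[RHS]/(psi2 alpha nu 0 (iz (zi n)) z) /psi2 ziK hermiteE /=.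
have -> : 2 ^+ 0 * 0`!%:R = 1 :> R by rewrite fact0 expr0 mulr1.
by rewrite sqrtr1 invr1 (rmorph1 (real_complex R)) mul1r mulr1.
Qed.

Lemma opT_psi m n : opT nu m (psi alpha nu n) = e m (zi n).
Proof.
rewrite psi_e (e_synth nu alpha 0) (opT_synth alpha nu_gt0 m (delta_bound (zi n))).
by rewrite -e_synth.
Qed.

Lemma level_basis m : orthonormal_basis nu (Es m) (fun n => e m (zi n)).
Proof.
split.
- by move=> n; exact: e_Espace.
- by move=> n k; rewrite e_orthonormal// eqxx /= (can_eq ziK).
- move=> f Ef eps e0; have Lf := Espace_L2s Ef.
  have e2 : 0 < eps / 2 by rewrite divr_gt0.
  have [Ls Hs] := synth_approx alpha nu_gt0 m (l2_coef alpha nu_gt0 m Lf).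
  have [n0 /(_ n0 (leqnn _)) H] := Hs _ e2.
  exists (map iz (iota 0 n0)), (fun k => coef f m (zi k)).
  have -> : (fun z => f z - \sum_(n <- map iz (iota 0 n0)) coef f m (zi n) * e m (zi n) z) =
      fun z => synth m (coef f m) z - psum nu alpha m (coef f m) n0 z.
    apply/funext => z; rewrite {1}(Espace_synth Ef); congr (_ - _).
    rewrite big_map /psum -(big_mkord xpredT (fun j => coef f m j * e m j z)).
    by rewrite /index_iota subn0; apply: eq_bigr => j _; rewrite izK.
  rewrite nrmE; last by apply: L2sB => //; exact: L2s_psum.
  by rewrite lte_fin (le_lt_trans H)//; lra.
Qed.

(** The norm of a superposition depends on its coefficients only, not on the
    level: this gives the isometry. *)
Lemma nrm_synth_approx m c B : l2 c B -> forall eps : R, 0 < eps ->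
  exists n0, forall n, (n0 <= n)%N ->
  \sum_(j < n) sqc (c j) <= nrm nu (synth m c) <= \sum_(j < n) sqc (c j) + eps.
Proof.
move=> H eps e0; have [Ls Hs] := synth_approx alpha nu_gt0 m H.
have [n0 Hn0] := Hs eps e0; exists n0 => n n0n; have := Hn0 n n0n.
have Lp := L2s_psum alpha nu_gt0 m c n.
have ip : inner nu (synth m c) (psum nu alpha m c n) = (nrm nu (psum nu alpha m c n))%:C.
  rewrite -[LHS]conjcK -inner_conj// {1}/psum inner_suml//; last first.
    by move=> j; apply: L2sZ; exact: e_L2s.
  rewrite nrm_psum// -[RHS]JC; congr (_^*%C); rewrite rmorph_sum; apply: eq_bigr => j _.
  rewrite innerZl//; last exact: e_L2s.
  rewrite inner_conj//; last exact: e_L2s.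
  by rewrite (coef_synth alpha nu_gt0 m m j H) eqxx mulcJ.
have := nrm_ge0 nu (fun z => synth m c z - psum nu alpha m c n z).
rewrite nrmB// ip nrm_psum// ReC => h1 h2; apply/andP; split; lra.
Qed.

Lemma opT_isometry m f : Fspace alpha nu f ->
  Es m (opT nu m f) /\ norm2 nu (opT nu m f) = norm2 nu f.
Proof.
move=> Ff; have Lf := Fspace_L2s Ff; have H := l2_coef alpha nu_gt0 0 Lf.
have E : opT nu m f = synth m (coef f 0).
  by rewrite {1}(Fspace_synth Ff) (opT_synth alpha nu_gt0 m (l2_bounded H)).
rewrite E; split; first exact: synth_Espace H.
have Ls k : L2s nu (synth k (coef f 0)) by have [] := synth_approx alpha nu_gt0 k H.
have -> : norm2 nu f = norm2 nu (synth 0 (coef f 0)) by rewrite -(Fspace_synth Ff).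
rewrite (nrmE (Ls m)) (nrmE (Ls 0%N)); apply: (congr1 EFin).
have le k l (eps : R) : 0 < eps -> nrm nu (synth k (coef f 0)) <= nrm nu (synth l (coef f 0)) + eps.
  move=> e0; have [n1 H1] := nrm_synth_approx k H e0; have [n2 H2] := nrm_synth_approx l H e0.
  have /andP[_ h1] := H1 _ (leq_maxl n1 n2); have /andP[h2 _] := H2 _ (leq_maxr n1 n2).
  by apply: le_trans h1 _; rewrite lerD2r.
by apply/eqP; rewrite eq_le; apply/andP; split; apply/ler_addgt0Pr => eps; exact: le.
Qed.

End Spectrum.

Theorem mainTheorem4 (R : realType) (nu alpha : R) (nu_gt0 : 0 < nu) :
  [/\ forall lam : R[i],
        nontrivial_space (Espace alpha nu lam) <-> exists m : nat, lam = m%:R,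
      forall m : nat, infinite_dimensional (Espace alpha nu m%:R) &
      Espace alpha nu 0 = Fspace alpha nu]
  /\
  (hilbert_decomposition alpha nu (L2space alpha nu)
     (fun m => Espace alpha nu m%:R)
   /\
   orthogonal_decomposition2 alpha nu (L2space alpha nu) (Fspace alpha nu)
     (hilbert_sum alpha nu (fun m => Espace alpha nu m.+1%:R)))
  /\
  (orthonormal_basis nu (Fspace alpha nu) (psi alpha nu)
   /\
   forall m : nat, (0 < m)%N ->
     [/\ forall f, Fspace alpha nu f ->
           Espace alpha nu m%:R (opT nu m f)
           /\ norm2 nu (opT nu m f) = norm2 nu f,
         orthonormal_basis nu (Espace alpha nu m%:R)
           (fun n => opT nu m (psi alpha nu n)) &
         forall (n : int) (z : R[i]),
           opT nu m (psi alpha nu n) z = psi2 alpha nu m n z]).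

Proof.
have lvl m : (fun n => opT nu m (psi alpha nu n)) = fun n => e nu alpha m (zi n).
  by apply/funext => n; exact: opT_psi.
split; last split; last split.
- split; [exact: eigenvalues|exact: Espace_infinite|exact: Espace0].
- by split; [exact: L2_decomposition|exact: Fspace_decomposition].
- rewrite -Espace0// (_ : psi alpha nu = fun n => e nu alpha 0 (zi n)).
    exact: (level_basis alpha nu_gt0 0).
  by apply/funext => n; exact: psi_e.
- move=> m _; split.
  + by move=> f; exact: opT_isometry.
  + by rewrite lvl; exact: level_basis.
  + by move=> n z; rewrite opT_psi// /e ziK.
Qed.
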